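(* Let $k$ be an algebraically closed field, $A=kQ$ the path algebra of a finite quiver $Q$, $T$ a finite-dimensional left $A$-module with $\mathrm{Ext}^1_A(T,T)=0$, and $A[T]$ the one-point extension of $A$ by $T$. A dimension vector $(s,d)\in\mathbb N\times\mathbb N^{Q_0}$ is semi-stable if and only if $\gamma_{T^s,d}=d$ and there exists no HN-type \[ (s,d)^*=\big((s^1,d^1),\dots,(s^r,d^r)\big),\qquad r\ge2, \] with weight $(s,d)$ (i.e. $\sum_{i=1}^r(s^i,d^i)=(s,d)$) and $s^r\neq0$ such that \[ \langle(s^n,d^n),(s^l,d^l)\rangle_{A[T]}=0\qquad\text{for all }1\le n<l\le r. \]
   Context: $A[T]$ is the $k$-algebra of formal matrices $\begin{pmatrix} a & t\\ 0&\lambda\end{pmatrix}$ with $a\in A$, $t\in T$, $\lambda\in k$, with componentwise addition and formal matrix multiplication. Left $A[T]$-modules are identified with triples $(M,V,f)$ where $M$ is a left $A$-module, $V$ a $k$-vector space and $f:T\otimes_kV\to M$ an $A$-module map (morphisms are compatible pairs); the dimension vector is $(\dim V,\underline{\dim}\,M)$. The general rank $\gamma_{T^s,d}\in\mathbb N^{Q_0}$ is the rank (dimension vector of the image) of a general homomorphism from $T^s$ to a general representation of dimension vector $d$, i.e. for $M$ in a dense open subset of $\mathrm{Rep}_d(Q)=\prod_{(\alpha:i\to j)}\mathrm{Hom}_k(k^{d_i},k^{d_j})$ it is the rank attained on a dense open subset of $\mathrm{Hom}_A(T^s,M)$. Slope: $\mu(s,d)=\frac{s}{s+\sum_id_i}$,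 and $\mu(\tilde M)=\mu(\underline{\dim}\,\tilde M)$. $\tilde M$ is semi-stable if $\mu(U)\le\mu(\tilde M)$ for all proper subrepresentations $0\neq U\subset\tilde M$. A dimension vector is semi-stable if there is a semi-stable representation of $A[T]$ of that dimension vector. A tuple $((s^1,d^1),\dots,(s^r,d^r))$ of dimension vectors is an HN-type if each $(s^l,d^l)$ is semi-stable and $\mu(s^1,d^1)>\dots>\mu(s^r,d^r)$. $\langle(s,d),(s',d')\rangle_{A[T]}=ss'-s\langle\underline{\dim}\,T,d'\rangle_Q+\langle d,d'\rangle_Q$, with $\langle d,e\rangle_Q=\sum_{i\in Q_0}d_ie_i-\sum_{(\alpha:i\to j)\in Q_1}d_ie_j$.
   Formalization: The formal theorem assumes s > 0. For s = 0 and d ≠ 0 the equivalence is false: all slopes are 0, so (0,d) is semi-stable, while T^0 = 0 gives γ = 0 ≠ d; for (0,0) the slope is undefined. *)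

(* Defs.v *)
From mathcomp Require Import all_boot all_order all_algebra.
From mathcomp Require Import mpoly mxtens.

Set Implicit Arguments.
Unset Strict Implicit.
Unset Printing Implicit Defensive.

Import Order.TTheory GRing.Theory Num.Theory.
Local Open Scope ring_scope.

Record quiver := Quiver {
  vertex : finType;
  arrow : finType;
  src : arrow -> vertex;
  tgt : arrow -> vertex
}.

Definition dimvec (Q : quiver) : Type := {ffun vertex Q -> nat}.

(* The affine space of families of matrices of prescribed sizes. Both Rep_d(Q)
   and the ambient space of Hom_A(M, N) are of this form. *)
Definition mxfam (k : closedFieldType) (X : finType) (m n : X -> nat) : Type :=
  forall x : X, 'M[k]_(m x, n x).

Definition entry_index (X : finType) (m n : X -> nat) : finType :=
  {x : X & ('I_(m x) * 'I_(n x))%type}.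

Definition entries (k : closedFieldType) (X : finType) (m n : X -> nat)
    (F : mxfam k m n) (c : 'I_#|entry_index m n|) : k :=
  let e := enum_val c in F (tag e) (tagged e).1 (tagged e).2.

(* A Zariski open set is the complement of the common zero locus of a set S of
   polynomials in the matrix entries, i.e. a union of principal open sets. *)
Definition zariski_open (k : closedFieldType) (X : finType) (m n : X -> nat)
    (O : mxfam k m n -> Prop) : Prop :=
  exists S : {mpoly k[#|entry_index m n|]} -> Prop,
    forall F, O F <-> exists2 p, S p & p.@[entries F] != 0.

(* The trace of O on Y is open and dense in Y for the subspace topology. *)
Definition dense_open_in (k : closedFieldType) (X : finType) (m n : X -> nat)
    (Y O : mxfam k m n -> Prop) : Prop :=
  zariski_open O /\
  forall O', zariski_open O' -> (exists2 F, Y F & O' F) ->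
    exists F, [/\ Y F, O F & O' F].

(* Rep_d(Q): a finite-dimensional left kQ-module with M_i = k^(d i). Vectors are
   rows, so the arrow a acts by v |-> v *m M a. *)
Definition rep (k : closedFieldType) (Q : quiver) (d : vertex Q -> nat) : Type :=
  @mxfam k (arrow Q) (fun a => d (src a)) (fun a => d (tgt a)).

Definition is_hom (k : closedFieldType) (Q : quiver) (d e : vertex Q -> nat)
    (M : rep k d) (N : rep k e) (f : mxfam k d e) : Prop :=
  forall a : arrow Q, M a *m f (tgt a) = f (src a) *m N a.

(* Ext^1_A(M, N) = 0 in the sense of Yoneda: every short exact sequence
   0 -> N -> E -> M -> 0 splits. *)
Definition ext1_eq0 (k : closedFieldType) (Q : quiver) (d e : vertex Q -> nat)
    (M : rep k d) (N : rep k e) : Prop :=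
  forall (c : vertex Q -> nat) (E : rep k c) (u : mxfam k e c) (p : mxfam k c d),
    is_hom N E u -> is_hom E M p ->
    (forall i, row_free (u i)) -> (forall i, row_full (p i)) ->
    (forall i, (u i :=: kermx (p i))%MS) ->
    exists2 t : mxfam k d c, is_hom M E t & forall i, t i *m p i = 1%:M.

(* T^s, identified with T (x)_k k^s. *)
Definition rep_power (k : closedFieldType) (Q : quiver) (t : vertex Q -> nat)
    (T : rep k t) (s : nat) : rep k (fun i => t i * s)%N :=
  fun a => T a *t 1%:M.

(* [general_rank T s d g] says that the general rank of T^s -> M, for M of
   dimension vector d, is g; at most one g qualifies (general_rank_uniq). *)
Definition general_rank (k : closedFieldType) (Q : quiver) (t : vertex Q -> nat)
    (T : rep k t) (s : nat) (d g : dimvec Q) : Prop :=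
  exists2 U : rep k d -> Prop, dense_open_in (fun _ => True) U &
    forall M, U M ->
      exists2 W, dense_open_in (is_hom (rep_power T s) M) W &
        forall f, is_hom (rep_power T s) M f -> W f -> forall i, \rank (f i) = g i.

Lemma zariski_openT (k : closedFieldType) (X : finType) (m n : X -> nat) :
  zariski_open (fun _ : mxfam k m n => True).
Proof.
exists (fun p => p = 1) => F; split=> // _.
by exists 1 => //; rewrite meval1 oner_eq0.
Qed.

Lemma general_rank_uniq (k : closedFieldType) (Q : quiver) (t : vertex Q -> nat)
    (T : rep k t) (s : nat) (d g h : dimvec Q) :
  general_rank T s d g -> general_rank T s d h -> g = h.
Proof.
have dense_meet (X : finType) (m n : X -> nat) (Y O1 O2 : mxfam k m n -> Prop) :
    (exists F, Y F) -> dense_open_in Y O1 -> dense_open_in Y O2 ->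
    exists F, [/\ Y F, O1 F & O2 F].
  move=> [F YF] [oO1 dO1] [oO2 dO2].
  have [G [YG O2G _]] := dO2 _ (zariski_openT k m n) (ex_intro2 _ _ F YF I).
  by apply: dO1 => //; exists G.
move=> [U1 dU1 gU1] [U2 dU2 hU2].
have [M [_ U1M U2M]] := dense_meet _ _ _ _ _ _
  (ex_intro (fun M : rep k d => True) (fun=> 0) I) dU1 dU2.
have [W1 dW1 gW1] := gU1 _ U1M; have [W2 dW2 hW2] := hU2 _ U2M.
have ex_hom : exists f, is_hom (rep_power T s) M f.
  by exists (fun=> 0) => a; rewrite mulmx0 mul0mx.
have [f [fH W1f W2f]] := dense_meet _ _ _ _ _ _ ex_hom dW1 dW2.
by apply/ffunP=> i; rewrite -(gW1 f) // -(hW2 f).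
Qed.

(* A left A[T]-module (M, V, f) with V = k^s and dimension vector (s, d). *)
Record oprep (k : closedFieldType) (Q : quiver) (t : vertex Q -> nat)
    (T : rep k t) (s : nat) (d : vertex Q -> nat) := OPRep {
  op_mod : rep k d;
  op_map : mxfam k (fun i => t i * s)%N d;
  op_hom : is_hom (rep_power T s) op_mod op_map
}.

(* Subspaces W of V and U i of M_i are row spaces; 1%:M *t W spans T_i (x) W. *)
Definition is_subrep (k : closedFieldType) (Q : quiver) (t : vertex Q -> nat)
    (T : rep k t) (s : nat) (d : vertex Q -> nat) (Mt : oprep T s d)
    (W : 'M[k]_s) (U : mxfam k d d) : Prop :=
  (forall a : arrow Q, (U (src a) *m op_mod Mt a <= U (tgt a))%MS) /\
  (forall i : vertex Q, ((1%:M *t W) *m op_map Mt i <= U i)%MS).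

(* The value at (0, 0), where the slope is undefined, is 0 and is immaterial:
   an HN-type whose last entry has nonzero first component has no zero entry. *)
Definition slope (Q : quiver) (s : nat) (d : vertex Q -> nat) : rat :=
  s%:R / (s + \sum_i d i)%N%:R.

Definition semistable_rep (k : closedFieldType) (Q : quiver) (t : vertex Q -> nat)
    (T : rep k t) (s : nat) (d : vertex Q -> nat) (Mt : oprep T s d) : Prop :=
  forall (W : 'M[k]_s) (U : mxfam k d d),
    is_subrep Mt W U ->
    ~ (W = 0 /\ forall i, U i = 0) ->
    ~ (row_full W /\ forall i, row_full (U i)) ->
    slope (\rank W) (fun i => \rank (U i)) <= slope s d.

Definition semistable (k : closedFieldType) (Q : quiver) (t : vertex Q -> nat)
    (T : rep k t) (x : nat * dimvec Q) : Prop :=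
  exists Mt : oprep T x.1 x.2, semistable_rep Mt.

Definition HN_type (k : closedFieldType) (Q : quiver) (t : vertex Q -> nat)
    (T : rep k t) (h : seq (nat * dimvec Q)) : Prop :=
  (forall x, x \in h -> semistable T x) /\
  sorted (fun x y : nat * dimvec Q => slope y.1 y.2 < slope x.1 x.2) h.

Definition euler (Q : quiver) (d e : vertex Q -> nat) : int :=
  \sum_i (d i)%:Z * (e i)%:Z - \sum_a (d (src a))%:Z * (e (tgt a))%:Z.

Definition euler_op (Q : quiver) (t : vertex Q -> nat)
    (x y : nat * dimvec Q) : int :=
  x.1%:Z * y.1%:Z - x.1%:Z * euler t y.2 + euler x.2 y.2.

(* Main.v *)
Require Import Defs.
From HB Require Import structures.
From mathcomp Require Import all_boot all_order all_algebra.
From mathcomp Require Import perm mpoly mxtens zify ring.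
From Stdlib Require Import Classical FunctionalExtensionality.

(** An A[T]-module is a representation of the quiver obtained from Q by adding a
    vertex carrying V and, for every i, one arrow towards i for each basis vector
    of T_i; the A-linearity of T (x) V -> M becomes a family of quadratic
    relations. Differentiating the action of the base change group and the
    relations gives a complex C0 -> C1 -> C2 with Euler characteristic
    <x, y>_{A[T]}, whose cohomology in degrees 0 and 1 is Hom and Ext^1 and which
    is exact at C2 as soon as the second module is generated by its space V: that
    is the only use of Ext^1(T, T) = 0 (relmap_surj, chi_le0). A semistable module
    with V <> 0 is generated by V, since V and its image span a submodule
    (ssrep_fsurj). So a Harder-Narasimhan type whose last entry has a nonzero
    first component only has pairings <h_n, h_l> <= 0 for n < l, and the pairing
    vanishes exactly when Ext^1 does.

    If the general rank is d, there is a module generated by V. The modules of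
    dimension x = (s, d) generated by V form an irreducible family of the expected
    dimension; concretely, near such a module every point of the affine space of
    pairs (M, g), g arbitrary, is f + z for a unique A-linear f and a unique z in a
    fixed complement (generic_normal_form). If <e, x - e> < 0, the modules having
    a submodule of dimension e that is generated by its V-part depend on fewer
    parameters than the whole family: they are covered by finitely many polynomial
    maps whose sources have smaller dimension, hence they lie in a hypersurface
    (thin_destabilized). A generic module therefore has <e, x - e> >= 0 for all
    such submodules. Applied to the steps of its Harder-Narasimhan filtration,
    whose pairings are all <= 0, this makes every pairing vanish
    (generic_HN_zero); if no such type of length at least 2 exists, the generic
    module is semistable.

    Conversely, let N0 be semistable of dimension x and let h be a type as in the
    statement. Let N1 be semistable of dimension h_1 and N2 the sum of semistable
    modules of dimensions h_2, ..., h_r, so that Hom(N1, N2) = Ext^1(N1, N2) = 0.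
    Instead of comparing open strata, one joins N1 (+) N2, at 0, to N0, at
    infinity, by a curve of modules with polynomial coefficients in a parameter X
    (pencil_solution). Since Ext^1(N1, N2) = 0, the submodule N1 deforms along the
    curve modulo X^J for every J (lift_sub). Let LC(E) be the space of leading
    coefficients of the polynomial vectors of degree E that lie in the deformed
    submodule modulo X^J. These spaces increase with E, an arrow of N0 maps LC(E)
    into LC(E + delta) for a constant delta, and their dimensions for E < J add up
    to J h_1. So LC(E) is a submodule of N0 for all but a bounded number of E, and
    the semistability of N0 bounds J (mu(h_1) - mu(x)) independently of J, which is
    absurd for large J because mu(h_1) > mu(x) (lattice_slope_bound). *)

Set Implicit Arguments.
Unset Strict Implicit.
Unset Printing Implicit Defensive.

Import Order.TTheory GRing.Theory Num.Theory.
Local Open Scope ring_scope.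

(** * Polynomial functions and thin sets *)

(** Polynomiality is a predicate on functions relative to a set C of coordinate
    functions, so that matrix-valued constructions (determinants, adjugates) can be
    treated without choosing an ordering of the variables. *)
Inductive polyfun (k : comNzRingType) (V : Type) (C : (V -> k) -> Prop) :
  (V -> k) -> Prop :=
| polyfun_coord c : C c -> polyfun C c
| polyfun_const a : polyfun C (fun=> a)
| polyfun_add f g : polyfun C f -> polyfun C g -> polyfun C (fun v => f v + g v)
| polyfun_mul f g : polyfun C f -> polyfun C g -> polyfun C (fun v => f v * g v)
| polyfun_ext f g : f =1 g -> polyfun C f -> polyfun C g.

Definition polymx (k : comNzRingType) (V : Type) (C : (V -> k) -> Prop) m n
    (F : V -> 'M[k]_(m, n)) : Prop :=
  forall i j, polyfun C (fun v => F v i j).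

Section PolyFun.
Variables (k : comNzRingType) (V : Type) (C : (V -> k) -> Prop).

Lemma polyfun_opp f : polyfun C f -> polyfun C (fun v => - f v).
Proof.
move=> pf; apply: polyfun_ext (polyfun_mul (polyfun_const C (-1)) pf) => v.
by rewrite mulN1r.
Qed.

Lemma polyfun_sum (I : Type) (r : seq I) (P : pred I) (f : I -> V -> k) :
  (forall i, P i -> polyfun C (f i)) ->
  polyfun C (fun v => \sum_(i <- r | P i) f i v).
Proof.
move=> pf; elim: r => [|i r IH].
  by apply: polyfun_ext (polyfun_const C 0) => v; rewrite big_nil.
case: (boolP (P i)) => Pi.
  apply: polyfun_ext (polyfun_add (pf i Pi) IH) => v.
  by rewrite big_cons Pi.
by apply: polyfun_ext IH => v; rewrite big_cons (negPf Pi).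
Qed.

Lemma polyfun_prod (I : Type) (r : seq I) (P : pred I) (f : I -> V -> k) :
  (forall i, P i -> polyfun C (f i)) ->
  polyfun C (fun v => \prod_(i <- r | P i) f i v).
Proof.
move=> pf; elim: r => [|i r IH].
  by apply: polyfun_ext (polyfun_const C 1) => v; rewrite big_nil.
case: (boolP (P i)) => Pi.
  apply: polyfun_ext (polyfun_mul (pf i Pi) IH) => v.
  by rewrite big_cons Pi.
by apply: polyfun_ext IH => v; rewrite big_cons (negPf Pi).
Qed.

Lemma polymx_const m n (A : 'M_(m, n)) : polymx C (fun=> A).
Proof. by move=> i j; apply: polyfun_const. Qed.

Lemma polymx_add m n (F G : V -> 'M_(m, n)) :
  polymx C F -> polymx C G -> polymx C (fun v => F v + G v).
Proof.
move=> pF pG i j.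
by apply: polyfun_ext (polyfun_add (pF i j) (pG i j)) => v; rewrite mxE.
Qed.

Lemma polymx_opp m n (F : V -> 'M_(m, n)) : polymx C F -> polymx C (fun v => - F v).
Proof.
by move=> pF i j; apply: polyfun_ext (polyfun_opp (pF i j)) => v; rewrite mxE.
Qed.

Lemma polymx_scale m n f (F : V -> 'M_(m, n)) :
  polyfun C f -> polymx C F -> polymx C (fun v => f v *: F v).
Proof.
move=> pf pF i j.
by apply: polyfun_ext (polyfun_mul pf (pF i j)) => v; rewrite mxE.
Qed.

Lemma polymx_mul m n p (F : V -> 'M_(m, n)) (G : V -> 'M_(n, p)) :
  polymx C F -> polymx C G -> polymx C (fun v => F v *m G v).
Proof.
move=> pF pG i j.
apply: (@polyfun_ext _ _ _ (fun v => \sum_l F v i l * G v l j)) => [v|].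
  by rewrite mxE.
by apply: polyfun_sum => l _; apply: polyfun_mul.
Qed.

Lemma polymx_sum m n (I : Type) (r : seq I) (P : pred I) (F : I -> V -> 'M_(m, n)) :
  (forall i, P i -> polymx C (F i)) ->
  polymx C (fun v => \sum_(i <- r | P i) F i v).
Proof.
move=> pF i j.
apply: (@polyfun_ext _ _ _ (fun v => \sum_(l <- r | P l) F l v i j)) => [v|].
  by rewrite summxE.
by apply: polyfun_sum => l Pl; apply: pF.
Qed.

Lemma polymx_block m1 m2 n1 n2 (F1 : V -> 'M_(m1, n1)) (F2 : V -> 'M_(m1, n2))
    (F3 : V -> 'M_(m2, n1)) (F4 : V -> 'M_(m2, n2)) :
  polymx C F1 -> polymx C F2 -> polymx C F3 -> polymx C F4 ->
  polymx C (fun v => block_mx (F1 v) (F2 v) (F3 v) (F4 v)).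
Proof.
move=> p1 p2 p3 p4 i j.
case: (split_ordP i) => i' ->; case: (split_ordP j) => j' ->.
- by apply: polyfun_ext (p1 i' j') => v; rewrite block_mxEul.
- by apply: polyfun_ext (p2 i' j') => v; rewrite block_mxEur.
- by apply: polyfun_ext (p3 i' j') => v; rewrite block_mxEdl.
- by apply: polyfun_ext (p4 i' j') => v; rewrite block_mxEdr.
Qed.

Lemma polymx_row m n1 n2 (F1 : V -> 'M_(m, n1)) (F2 : V -> 'M_(m, n2)) :
  polymx C F1 -> polymx C F2 -> polymx C (fun v => row_mx (F1 v) (F2 v)).
Proof.
move=> p1 p2 i j; case: (split_ordP j) => j' ->.
- by apply: polyfun_ext (p1 i j') => v; rewrite row_mxEl.
- by apply: polyfun_ext (p2 i j') => v; rewrite row_mxEr.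
Qed.

Lemma polyfun_det n (F : V -> 'M_n) : polymx C F -> polyfun C (fun v => \det (F v)).
Proof.
move=> pF; rewrite /determinant.
apply: polyfun_sum => s _; apply: polyfun_mul; first exact: polyfun_const.
by apply: polyfun_prod.
Qed.

Lemma polymx_adj n (F : V -> 'M_n) : polymx C F -> polymx C (fun v => \adj (F v)).
Proof.
move=> pF i j.
apply: (@polyfun_ext _ _ _ (fun v => cofactor (F v) j i)) => [v|]; first by rewrite mxE.
rewrite /cofactor; apply: polyfun_mul; first exact: polyfun_const.
apply: polyfun_det => a b.
by apply: polyfun_ext (pF (lift j a) (lift i b)) => v; rewrite !mxE.
Qed.

Lemma polyfun_comp (W : Type) (D : (W -> k) -> Prop) (F : V -> W) f :
  (forall c, D c -> polyfun C (c \o F)) -> polyfun D f -> polyfun C (f \o F).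
Proof.
move=> pF; elim=> {f} [c /pF //|a|f g _ pf _ pg|f g _ pf _ pg|f g fg _ pf].
- exact: polyfun_const.
- exact: polyfun_add.
- exact: polyfun_mul.
- by apply: polyfun_ext pf => v /=; rewrite fg.
Qed.

(** Restricting to a curve reduces questions of non-vanishing to one variable. *)
Lemma polyfun_path (g : k -> V) f :
  (forall c, C c -> exists P : {poly k}, forall t, c (g t) = P.[t]) ->
  polyfun C f -> exists P : {poly k}, forall t, f (g t) = P.[t].
Proof.
move=> pg; elim=> {f} [c /pg //|a|f h _ [P fP] _ [R hR]|f h _ [P fP] _ [R hR]|f h fh _ [P fP]].
- by exists a%:P => t; rewrite hornerC.
- by exists (P + R) => t; rewrite hornerD fP hR.
- by exists (P * R) => t; rewrite hornerM fP hR.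
- by exists P => t; rewrite -fh fP.
Qed.

Lemma polyfun_mpoly n (co : V -> 'I_n -> k) f :
  (forall c, C c -> exists j, forall v, c v = co v j) ->
  polyfun C f -> exists p : {mpoly k[n]}, forall v, f v = p.@[co v].
Proof.
move=> pc; elim=> {f} [c /pc[j cj]|a|f h _ [P fP] _ [R hR]|f h _ [P fP] _ [R hR]|f h fh _ [P fP]].
- by exists 'X_j => v; rewrite mevalXU cj.
- by exists a%:MP => v; rewrite mevalC.
- by exists (P + R) => v; rewrite mevalD fP hR.
- by exists (P * R) => v; rewrite mevalM fP hR.
- by exists P => v; rewrite -fh fP.
Qed.

End PolyFun.

Section Infinite.
Variable k : closedFieldType.

Lemma closed_field_fresh (s : seq k) : exists x, x \notin s.
Proof.
pose p : {poly k} := \prod_(a <- s) ('X - a%:P).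
have [s0|s0] := eqVneq s [::]; first by exists 0; rewrite s0.
have szp : size p = (size s).+1 by rewrite size_prod_XsubC.
have /closed_rootP[x /rootP] : size (p + 1) != 1%N.
  by rewrite size_polyDl szp ?size_poly1 ?eqSS ?size_eq0 // ltnS lt0n size_eq0.
rewrite hornerD hornerC => px; exists x; apply/negP => xs.
move: px; have /rootP -> : root p x by rewrite root_prod_XsubC.
by rewrite add0r => /eqP; rewrite oner_eq0.
Qed.

Lemma closed_field_uniq_seq n : exists2 s : seq k, size s = n & uniq s.
Proof.
elim: n => [|n [s <- us]]; first by exists [::].
by have [x xs] := closed_field_fresh s; exists (x :: s); rewrite //= xs.
Qed.

Lemma poly_nonroot (p : {poly k}) : p != 0 -> exists x, p.[x] != 0.
Proof.
move=> p0; have [s szs us] := closed_field_uniq_seq (size p).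
have /allPn[x _ px] : ~~ all (root p) s.
  by apply/negP => /(max_poly_roots p0) /(_ us); rewrite szs ltnn.
by exists x.
Qed.

End Infinite.

Definition fam_coord (k : closedFieldType) (X : finType) (m n : X -> nat)
    (c : mxfam k m n -> k) : Prop :=
  exists x i j, c = fun F => F x i j.

Definition fun_coord (k : closedFieldType) (J : finType) (c : (J -> k) -> k) : Prop :=
  exists j, c = fun v => v j.

(** A proper Zariski closed set, up to passing to a subset. *)
Definition thin (k : closedFieldType) (X : finType) (m n : X -> nat)
    (Z : mxfam k m n -> Prop) : Prop :=
  exists psi, [/\ polyfun (@fam_coord k X m n) psi, (exists y, psi y != 0) &
    forall y, Z y -> psi y = 0].

Section Thin.
Variables (k : closedFieldType) (X : finType) (m n : X -> nat).
Local Notation Y := (mxfam k m n).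
Local Notation C := (@fam_coord k X m n).

Definition segment (F G : Y) (t : k) : Y := fun x => F x + t *: (G x - F x).

Lemma polyfun_segment f F G : polyfun C f ->
  exists P : {poly k}, forall t, f (segment F G t) = P.[t].
Proof.
apply: polyfun_path => c [x [i [j ->]]].
exists ((F x i j)%:P + 'X * (G x i j - F x i j)%:P) => t.
by rewrite !mxE !hornerE.
Qed.

Lemma segment0 F G : segment F G 0 = F.
Proof. by apply: functional_extensionality_dep => x; rewrite /segment scale0r addr0. Qed.

Lemma segment1 F G : segment F G 1 = G.
Proof.
by apply: functional_extensionality_dep => x; rewrite /segment scale1r addrC subrK.
Qed.

(** The affine space is irreducible: on the segment from F to G both functions
    become nonzero polynomials in one variable. *)
Lemma polyfun_common_nonzero f g F G :
  polyfun C f -> polyfun C g -> f F != 0 -> g G != 0 ->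
  exists t, f (segment F G t) != 0 /\ g (segment F G t) != 0.
Proof.
move=> pf pg fF gG.
have [P fP] := polyfun_segment F G pf; have [R gR] := polyfun_segment F G pg.
have P0 : P != 0.
  by apply: contraNneq fF => P0; rewrite -(segment0 F G) fP P0 horner0.
have R0 : R != 0.
  by apply: contraNneq gG => R0; rewrite -(segment1 F G) gR R0 horner0.
have [t] := poly_nonroot (mulf_neq0 P0 R0).
by rewrite hornerM mulf_eq0 negb_or -fP -gR => /andP; exists t.
Qed.

Lemma thin_bigU (L : finType) (Z : L -> Y -> Prop) :
  (forall l, thin (Z l)) -> thin (fun y => exists l, Z l y).
Proof.
move=> tZ.
suff [psi [ppsi nz Zpsi]] : exists psi, [/\ polyfun C psi, (exists y, psi y != 0) &
    forall y l, l \in enum L -> Z l y -> psi y = 0].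
  by exists psi; split=> // y [l]; apply: Zpsi; rewrite mem_enum.
elim: (enum L) => [|l r [psi [ppsi [F nzF] Zpsi]]].
  by exists (fun=> 1); split=> //; [exact: polyfun_const|exists (fun=> 0); rewrite oner_eq0].
have [phi [pphi [G nzG] Zphi]] := tZ l.
exists (fun y => psi y * phi y); split; first exact: polyfun_mul.
  have [u [nz1 nz2]] := polyfun_common_nonzero ppsi pphi nzF nzG.
  by exists (segment F G u); apply: mulf_neq0.
move=> y l'; rewrite inE => /orP[/eqP->|l'r] Zy.
  by rewrite (Zphi y) ?mulr0.
by rewrite (Zpsi y l') ?mul0r.
Qed.

Lemma thin_sub (Z Z' : Y -> Prop) : (forall y, Z y -> Z' y) -> thin Z' -> thin Z.
Proof.
by move=> ZZ' [psi [ppsi nz Zpsi]]; exists psi; split=> // y /ZZ'; apply: Zpsi.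
Qed.

Lemma thin_meets (Z : Y -> Prop) f F : thin Z -> polyfun C f -> f F != 0 ->
  exists2 y, f y != 0 & ~ Z y.
Proof.
move=> [psi [ppsi [G nzG] Zpsi]] pf fF.
have [u [nz1 nz2]] := polyfun_common_nonzero pf ppsi fF nzG.
by exists (segment F G u) => // /Zpsi /eqP; rewrite (negPf nz2).
Qed.

End Thin.

Lemma msizeM_bound (k : idomainType) n (p q : {mpoly k[n]}) a b :
  (msize p <= a.+1)%N -> (msize q <= b.+1)%N -> (msize (p * q) <= (a + b).+1)%N.
Proof.
have [->|p0] := eqVneq p 0; first by rewrite mul0r msize0.
have [->|q0] := eqVneq q 0; first by rewrite mulr0 msize0.
by rewrite msizeM //; lia.
Qed.

Lemma msize_prod_bound (k : idomainType) n (I : Type) (r : seq I)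
    (p : I -> {mpoly k[n]}) c :
  (forall i, msize (p i) <= c.+1)%N ->
  (msize (\prod_(i <- r) p i) <= (size r * c).+1)%N.
Proof.
move=> pc; elim: r => [|i r IH]; first by rewrite big_nil msize1.
by rewrite big_cons /= mulSn; apply: msizeM_bound.
Qed.

Lemma card_bmultinom_le n b : (#|{: 'X_{1..n < b}}| <= b ^ n)%N.
Proof.
pose f (m : 'X_{1..n < b}) : {ffun 'I_n -> 'I_b} :=
  [ffun i => insubd (Ordinal (leq_ltn_trans (leq0n _) (bmdeg m))) (m i)].
have fi : injective f.
  move=> m1 m2 /ffunP e; apply/eqP; rewrite bmeqP; apply/eqP/mnmP => i.
  have lt m : ((m : 'X_{1..n < b}) i < b)%N.
    by apply: leq_ltn_trans (bmdeg m); rewrite mdegE (bigD1 i) //= leq_addr.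
  by have := congr1 val (e i); rewrite !ffunE !val_insubd !lt.
have := leq_card f fi.
by rewrite card_ffun !card_ord.
Qed.

(** Polynomial maps from a space of smaller dimension are not dominant. Let N < M
    be the dimensions of source and target. For every D the products of Lagrange polynomials attached
    to the points of a grid with D^M points are linearly independent as functions.
    Composed with F they have degree at most c D M, for a constant c, so they lie in a
    space whose dimension grows like D^N; for large D some combination of them
    vanishes on the image. *)
Lemma thin_image (k : closedFieldType) (X : finType) (m n : X -> nat) (J : finType) (F : (J -> k) -> mxfam k m n) :
  (forall x, polymx (@fun_coord k J) (fun v => F v x)) ->
  (#|J| < #|entry_index m n|)%N -> thin (fun y => exists v, y = F v).
Proof.
set E := entry_index m n; set M := #|E|; set N := #|J| => pF ltNM.
pose ev (e : E) (y : mxfam k m n) : k := y (tag e) (tagged e).1 (tagged e).2.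
pose co (v : J -> k) (i : 'I_N) := v (enum_val i).
have /fin_all_exists[P FP] (e : E) : exists p : {mpoly k[N]},
    forall v, ev e (F v) = p.@[co v].
  apply: (polyfun_mpoly (co := co)) (pF (tag e) _ _) => c [j ->].
  by exists (enum_rank j) => v; rewrite /co enum_rankK.
pose c := \max_e msize (P e).
have Pc e : (msize (P e) <= c.+1)%N.
  by apply: leqW; apply: (leq_bigmax_cond (F := fun e => msize (P e))).
(* This size makes (M D c + 1)^N < D^M whenever N < M. *)
pose D := ((M * c).+1 ^ N).+1.
have [a sza ua] := closed_field_uniq_seq k D.
pose G := {ffun E -> 'I_D}.
(* The polynomials lag g are dual to the points of the grid up to nonzero scalars. *)
pose lag (g : G) (y : E -> k) := \prod_e \prod_(j < D | j != g e) (y e - a`_j).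
pose lagP (g : G) : {mpoly k[N]} := 
  \prod_(ej <- [seq (e, j) | e <- enum E, j <- [seq j <- enum 'I_D | j != g e]])
     (P ej.1 - (a`_ej.2)%:MP).
have lagPE g v : (lagP g).@[co v] = lag g (fun e => ev e (F v)).
  rewrite /lagP big_allpairs_dep /= big_enum /= rmorph_prod; apply: eq_bigr => e _.
  rewrite big_filter big_enum_cond rmorph_prod; apply: eq_bigr => j _.
  by rewrite /= mevalB mevalC FP.
pose B := (M * D * c).+1.
have szl g : (msize (lagP g) <= B)%N.
  apply: (@leq_trans ((size [seq (e, j) | e <- enum E, j <- [seq j <- enum 'I_D | j != g e]]) * c).+1).
    apply: msize_prod_bound => -[e j] /=.
    apply: leq_trans (msizeD_le _ _) _.
    by rewrite geq_max Pc msizeN msizeC (leq_trans (leq_b1 _)).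
  rewrite ltnS leq_mul2r; apply/orP; right.
  rewrite size_allpairs_dep.
  have -> : (M * D = sumn [seq D | e <- enum E])%N.
    by rewrite sumnE big_map big_enum sum_nat_const.
  rewrite !sumnE !big_map; apply: leq_sum => e _.
  by rewrite size_filter (leq_trans (count_size _ _)) // size_enum_ord.
(* More grid points than monomials: the rows of coefficients are dependent. *)
pose A : 'M[k]_(#|{: G}|, #|{: 'X_{1..N < B}}|) :=
  \matrix_(i, j) (lagP (enum_val i))@_(enum_val j : 'X_{1..N < B}).
have ltA : (#|{: 'X_{1..N < B}}| < #|{: G}|)%N.
  apply: leq_ltn_trans (card_bmultinom_le _ _) _.
  rewrite card_ffun card_ord -/E -/M.
  apply: (@leq_ltn_trans (((M * c).+1 * D) ^ N)).
    have leB : (B <= (M * c).+1 * D)%N by rewrite /B mulSn mulnAC; lia.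
    by case: (N) => // N'; rewrite leq_exp2r.
  rewrite expnMn; apply: (@leq_trans (D ^ N.+1)); last by rewrite leq_pexp2l.
  by rewrite expnS ltn_pmul2r ?expn_gt0 // /D ltnSn.
have /rowV0Pn[u uker u0] : kermx A != 0.
  rewrite -mxrank_eq0 mxrank_ker subn_eq0 -ltnNge.
  by apply: leq_ltn_trans (rank_leq_col _) ltA.
have uA : u *m A = 0 by apply/sub_kermxP.
have relP : \sum_i u 0 i *: lagP (enum_val i) = 0.
  apply/mpolyP => mm; rewrite mcoeff0 raddf_sum /=.
  case: (ltnP (mdeg mm) B) => [lt|ge].
    have := congr1 (fun X : 'rV_ _ => X 0 (enum_rank (BMultinom lt))) uA.
    rewrite !mxE => {2}<-; apply: eq_bigr => i _.
    by rewrite mcoeffZ !mxE enum_rankK.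
  rewrite big1 // => i _; rewrite mcoeffZ memN_msupp_eq0 ?mulr0 //.
  by apply: msize_mdeg_ge; apply: leq_trans (szl _) ge.
exists (fun y => \sum_i u 0 i * lag (enum_val i) (fun e => ev e y)); split.
- apply: polyfun_sum => i _; apply: polyfun_mul; first exact: polyfun_const.
  apply: polyfun_prod => e _; apply: polyfun_prod => j _.
  apply: polyfun_add; last exact: polyfun_const.
  by apply: polyfun_coord; exists (tag e), (tagged e).1, (tagged e).2.
- have /existsP[i ui] : [exists i, u 0 i != 0].
    apply: contraNT u0; rewrite negb_exists => /forallP u0.
    by apply/eqP/rowP => i; rewrite mxE; apply/eqP; have := u0 i; rewrite negbK.
  pose g := enum_val i.
  pose y : mxfam k m n := fun x => \matrix_(b, d) a`_(g (existT _ x (b, d))).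
  have yE e : ev e y = a`_(g e).
    by rewrite /ev mxE; case: (e) => x [b d].
  exists y; rewrite (bigD1 i) //= [X in _ + X]big1 ?addr0 => [|i' ne].
    rewrite mulf_neq0 //; apply/prodf_neq0 => e _; apply/prodf_neq0 => j ne.
    rewrite yE subr_eq0 nth_uniq ?sza // eq_sym.
    exact: ne.
  have /existsP[e ne'] : [exists e, enum_val i' e != g e].
    apply: contraNT ne; rewrite negb_exists => /forallP e; apply/eqP/enum_val_inj.
    by apply/ffunP => x; apply/eqP; have := e x; rewrite negbK.
  apply/eqP; rewrite mulf_eq0; apply/orP; right.
  have ne2 : g e != enum_val i' e by rewrite eq_sym.
  by rewrite /lag (bigD1 e) //= (bigD1 (g e)) //= yE subrr !mul0r.
- move=> y [v ->].
  have := congr1 (meval (co v)) relP; rewrite meval0 raddf_sum /=; apply: etrans.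
  by apply: eq_bigr => i _; rewrite mevalZ lagPE.
Qed.

(** * Linear algebra of families of matrices *)

Section Vec.
Variables (k : closedFieldType) (X : finType) (m n : X -> nat).

Definition vec (F : mxfam k m n) : 'rV[k]_#|entry_index m n| := \row_c entries F c.

Definition unvec (v : 'rV[k]_#|entry_index m n|) : mxfam k m n :=
  fun x => \matrix_(i, j)
    v 0 (enum_rank (Tagged (fun x => ('I_(m x) * 'I_(n x))%type) (i, j))).

Lemma vecK : cancel vec unvec.
Proof.
move=> F; apply: functional_extensionality_dep => x; apply/matrixP => i j.
by rewrite !mxE /entries enum_rankK.
Qed.

Lemma unvecK : cancel unvec vec.
Proof.
move=> v; apply/rowP => c; rewrite mxE /entries mxE.
set e := Tagged _ _; suff -> : e = enum_val c by rewrite enum_valK.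
by rewrite /e; case: (enum_val c) => x [].
Qed.

Lemma card_entry_index : #|entry_index m n| = (\sum_x m x * n x)%N.
Proof.
rewrite card_tagged sumnE big_map big_enum /=.
by apply: eq_bigr => x _; rewrite card_prod !card_ord.
Qed.

Lemma unvecD v w x : unvec (v + w) x = unvec v x + unvec w x.
Proof. by apply/matrixP => i j; rewrite !mxE. Qed.

Lemma unvecZ a v x : unvec (a *: v) x = a *: unvec v x.
Proof. by apply/matrixP => i j; rewrite !mxE. Qed.

Lemma vec0P F : vec F = 0 <-> forall x, F x = 0.
Proof.
split=> [F0 x|F0]; first by rewrite -(vecK F) F0; apply/matrixP => i j; rewrite !mxE.
by apply/rowP => c; rewrite !mxE /entries F0 mxE.
Qed.

Lemma vecD F G : vec (fun x => F x + G x) = vec F + vec G.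
Proof. by apply/rowP => c; rewrite !mxE /entries mxE. Qed.

Lemma vecZ a F : vec (fun x => a *: F x) = a *: vec F.
Proof. by apply/rowP => c; rewrite !mxE /entries mxE. Qed.

End Vec.

Section LinearFam.
Variables (k : closedFieldType) (X X' : finType) (m n : X -> nat) (m' n' : X' -> nat).

Definition linfam (L : mxfam k m n -> mxfam k m' n') : Prop :=
  forall a F G x, L (fun y => a *: F y + G y) x = a *: L F x + L G x.

(** The matrix of a linear map between spaces of families, in the bases given by the
    enumeration of the entries. *)
Definition fammx (L : mxfam k m n -> mxfam k m' n') : 'M[k]_(_, _) :=
  \matrix_(c, c') vec (L (unvec (delta_mx 0 c))) 0 c'.

Lemma fammxE L F : linfam L -> vec (L F) = vec F *m fammx L.
Proof.
move=> linL; rewrite -{1}(vecK F).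
have L0 : vec (L (unvec 0)) = 0.
  have /(_ _)L2 := linL (-1) (unvec 0) (unvec 0).
  apply/vec0P => x; have := L2 x.
  have -> : (fun y => -1 *: unvec 0 y + unvec 0 y) = unvec 0 :> mxfam k m n.
    by apply: functional_extensionality_dep => y; rewrite scaleN1r addNr;
      apply/matrixP => i j; rewrite !mxE.
  by move=> ->; rewrite scaleN1r addNr.
have LD a v w : vec (L (unvec (a *: v + w))) = a *: vec (L (unvec v)) + vec (L (unvec w)).
  rewrite -vecZ -vecD; congr vec; apply: functional_extensionality_dep => x.
  rewrite -linL; congr (L _ x); apply: functional_extensionality_dep => y.
  by rewrite unvecD unvecZ.
rewrite {1}(row_sum_delta (vec F)).
transitivity (\sum_c vec F 0 c *: vec (L (unvec (delta_mx 0 c)))).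
  elim: (index_enum _) => [|c r IH]; first by rewrite !big_nil.
  by rewrite !big_cons LD IH.
by apply/rowP => c'; rewrite summxE mxE; apply: eq_bigr => c _; rewrite !mxE.
Qed.

Lemma fammx_surj L : linfam L -> (forall G, exists F, forall x, L F x = G x) ->
  \rank (fammx L) = #|entry_index m' n'|.
Proof.
move=> linL surjL; apply/eqP/row_fullP.
have /fin_all_exists[B BP] (c : 'I_#|entry_index m' n'|) :
    exists v : 'rV_#|entry_index m n|, v *m fammx L = delta_mx 0 c.
  have [F FG] := surjL (unvec (delta_mx 0 c)); exists (vec F).
  rewrite -fammxE // -(unvecK (delta_mx 0 c)); congr vec.
  by apply: functional_extensionality_dep.
exists (\matrix_c B c); apply/row_matrixP => c.
by rewrite row_mul rowK BP row1.
Qed.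

End LinearFam.

(** Rank count for a complex that is injective on the left and surjective on the
    right: its Euler characteristic is minus the dimension of the middle cohomology. *)
Lemma fam_exact (k : closedFieldType) (X0 X1 X2 : finType) (m0 n0 : X0 -> nat)
    (m1 n1 : X1 -> nat) (m2 n2 : X2 -> nat)
    (L0 : mxfam k m0 n0 -> mxfam k m1 n1) (L1 : mxfam k m1 n1 -> mxfam k m2 n2) :
  linfam L0 -> linfam L1 -> (forall F x, L1 (L0 F) x = 0) ->
  (forall F, (forall x, L0 F x = 0) -> forall x, F x = 0) ->
  (forall G, exists F, forall x, L1 F x = G x) ->
  (\sum_x m0 x * n0 x + \sum_x m2 x * n2 x <= \sum_x m1 x * n1 x)%N /\
  ((\sum_x m0 x * n0 x + \sum_x m2 x * n2 x = \sum_x m1 x * n1 x)%N ->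
   forall G, (forall x, L1 G x = 0) -> exists F, forall x, L0 F x = G x).
Proof.
move=> lin0 lin1 L10 inj0 surj1; rewrite -!card_entry_index.
have D10 : fammx L0 *m fammx L1 = 0.
  apply/row_matrixP => c; rewrite row_mul rowE row0.
  rewrite -(unvecK (delta_mx 0 c)) -!fammxE //.
  by apply/vec0P => x; apply: L10.
have r0 : \rank (fammx L0) = #|entry_index m0 n0|.
  apply/eqP; rewrite -/(row_free _) -kermx_eq0; apply/rowV0P => v /sub_kermxP v0.
  rewrite -(unvecK v); apply/vec0P; apply: inj0; apply/vec0P.
  by rewrite fammxE // unvecK.
have r1 := fammx_surj lin1 surj1.
have sub : (fammx L0 <= kermx (fammx L1))%MS by apply/sub_kermxP.
have := mxrankS sub; rewrite mxrank_ker r0 r1 => le.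
have le1 : (#|entry_index m2 n2| <= #|entry_index m1 n1|)%N.
  by rewrite -r1 rank_leq_row.
split=> [|eqc G G0]; first by lia.
have /eqmxP eqk : (fammx L0 == kermx (fammx L1))%MS.
  by rewrite -(geq_leqif (mxrank_leqif_eq sub)) mxrank_ker r0 r1; lia.
have : (vec G <= fammx L0)%MS.
  by rewrite eqk; apply/sub_kermxP; rewrite -fammxE //; apply/vec0P.
case/submxP => v Gv; exists (unvec v) => x.
have : vec (L0 (unvec v)) = vec G by rewrite fammxE // unvecK.
by move/(congr1 (@unvec _ _ _ _)); rewrite !vecK => ->.
Qed.

(** * Modules over the one-point extension and their Euler form *)

(** The arrow inr (i, u) carries the action of the u-th basis vector of T_i, as a map
    from V to M_i. *)
Definition ope (Q : quiver) (t : vertex Q -> nat) : quiver :=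
  @Quiver (option (vertex Q)) (arrow Q + {i : vertex Q & 'I_(t i)})%type
    (fun b => match b with inl a => Some (src a) | inr _ => None end)
    (fun b => match b with inl a => Some (tgt a) | inr q => Some (tag q) end).

Section Ope.
Variables (k : closedFieldType) (Q : quiver) (t : vertex Q -> nat) (T : rep k t).

Local Notation Qh := (ope t).
Implicit Types x y : vertex Qh -> nat.

Definition oarr (a : arrow Q) : arrow Qh := inl a.
Definition vec_arr (i : vertex Q) (u : 'I_(t i)) : arrow Qh :=
  inr (Tagged (fun i => 'I_(t i)) u).

Definition rel_index : finType := {a : arrow Q & 'I_(t (src a))}.

Definition tvec x (N : rep k x) (i : vertex Q) (u : 'I_(t i)) :
  'M[k]_(x None, x (Some i)) := N (vec_arr u).
Definition omod x (N : rep k x) (a : arrow Q) :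
  'M[k]_(x (Some (src a)), x (Some (tgt a))) := N (oarr a).

Definition tpart x y (xi : @mxfam k (arrow Qh) (fun b => x (src b)) (fun b => y (tgt b))) :
  @mxfam k {i & 'I_(t i)} (fun=> x None) (fun q => y (Some (tag q))) := fun q => xi (inr q).

Definition sat_rel x (N : rep k x) : Prop :=
  forall (a : arrow Q) (u : 'I_(t (src a))),
    tvec N u *m omod N a = \sum_v T a u v *: tvec N v.

(** T (x) V -> M is surjective; a right inverse over each vertex is easier to
    transport than a rank condition. *)
Definition fsurj x (N : rep k x) : Prop :=
  forall i, exists R : 'I_(t i) -> 'M[k]_(x (Some i), x None),
    \sum_u R u *m tvec N u = 1%:M.

(** A cocycle Z is the off-diagonal block of an extension of T by T, and a splitting
    of that extension is a coboundary equal to Z. *)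
Lemma ext1_eq0_cocycle : ext1_eq0 T T ->
  forall Z : rep k t, exists xi : mxfam k t t,
    forall a, Z a = xi (src a) *m T a - T a *m xi (tgt a).
Proof.
move=> hT Z.
have [|||||s sE sp] := hT (fun i => t i + t i)%N (fun a => block_mx (T a) 0 (Z a) (T a))
  (fun i => row_mx 1%:M 0) (fun i => col_mx 0 1%:M).
- by move=> a; rewrite mul_row_block mul_mx_row !mul1mx !mul0mx !mulmx1 !mulmx0 !addr0.
- by move=> a; rewrite mul_block_col mul_col_mx !mulmx0 !mulmx1 !mul0mx !mul1mx !add0r.
- move=> i; apply/row_freeP; exists (col_mx 1%:M 0).
  by rewrite mul_row_col mulmx1 mul0mx addr0.
- move=> i; apply/row_fullP; exists (row_mx 0 1%:M).
  by rewrite mul_row_col mulmx1 mul0mx add0r.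
- move=> i; apply/eqmxP/andP; split.
    by apply/sub_kermxP; rewrite mul_row_col mulmx0 mul0mx addr0.
  apply/rV_subP => v /sub_kermxP; rewrite -(hsubmxK v) mul_row_col mulmx0 add0r mulmx1 => ->.
  apply/submxP; exists (lsubmx v).
  by rewrite mul_mx_row mulmx1 mulmx0.
exists (fun i => - lsubmx (s i)) => a.
have sr i : rsubmx (s i) = 1%:M.
  by have := sp i; rewrite -{1}(hsubmxK (s i)) mul_row_col mulmx0 add0r mulmx1.
have := sE a; rewrite -(hsubmxK (s (src a))) -{1}(hsubmxK (s (tgt a))) !sr.
rewrite mul_row_block mul_mx_row => /eq_row_mx[+ _].
rewrite mul1mx mulmxN mulNmx opprK => ->.
by rewrite row_mxKl addrA addNr add0r.
Qed.

Section Relmap.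
Variables (s : nat) (x : vertex Q -> nat).

Definition tfam_at (g : @mxfam k {i & 'I_(t i)} (fun=> s) (fun q => x (tag q)))
    i (u : 'I_(t i)) : 'M[k]_(s, x i) := g (Tagged (fun i => 'I_(t i)) u).

Definition relmap (M : forall a : arrow Q, 'M[k]_(x (src a), x (tgt a)))
    (g : @mxfam k {i & 'I_(t i)} (fun=> s) (fun q => x (tag q))) :
  @mxfam k rel_index (fun=> s) (fun r => x (tgt (tag r))) :=
  fun r => tfam_at g (tagged r) *m M (tag r)
    - \sum_v T (tag r) (tagged r) v *: tfam_at g v.

Lemma relmap_linear M : linfam (relmap M).
Proof.
move=> c F G r; rewrite /relmap {1}/tfam_at mulmxDl -scalemxAl scalerBr addrACA -opprD.
rewrite scaler_sumr -big_split /=; congr (_ - _); apply: eq_bigr => v _.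
by rewrite /tfam_at scalerDr !scalerA mulrC.
Qed.

End Relmap.

Lemma sat_relE x (N : rep k x) : sat_rel N <->
  forall r, relmap (x := fun i => x (Some i)) (omod N) (tpart (N : @mxfam _ _ _ _)) r = 0.
Proof.
split=> [relN [a u]|rN a u]; first by rewrite /relmap [X in X - _]relN subrr.
by apply/eqP; rewrite -subr_eq0; apply/eqP; apply: (rN (Tagged _ u)).
Qed.

(** The cokernel of this map is Ext^1(T^s, M). A cocycle with values in M lifts along
    the surjection from T^(x None) onto M to a cocycle with values in T^(x None),
    which is a coboundary. *)
Lemma relmap_surj x (N : rep k x) s : ext1_eq0 T T -> sat_rel N -> fsurj N ->
  forall G, exists g, forall r, relmap (s := s) (x := fun i => x (Some i)) (omod N) g r = G r.
Proof.
move=> hT relN surjN G.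
have /fin_all_exists[R RN] := surjN.
pose G' a u : 'M_(s, x (Some (tgt a))) := G (Tagged (fun a => 'I_(t (src a))) u).
(* One cocycle with values in T for each pair of a basis vector of k^s and of V. *)
have /fin_all_exists[xi xiP] (cd : 'I_s * 'I_(x None)) : exists xi : mxfam k t t,
    forall a, (\matrix_(u, v) (G' a u *m R (tgt a) v) cd.1 cd.2) =
       xi (src a) *m T a - T a *m xi (tgt a).
  exact: (ext1_eq0_cocycle hT).
pose Xi i u v : 'M_(s, x None) := \matrix_(c, d) xi (c, d) i u v.
exists (fun q => \sum_v Xi (tag q) (tagged q) v *m tvec N v) => -[a u].
rewrite /relmap /= mulmx_suml.
have -> : G (existT _ a u) = \sum_v (G' a u *m R (tgt a) v) *m tvec N v.
  under eq_bigr => v _ do rewrite -mulmxA.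
  by rewrite -mulmx_sumr RN mulmx1.
have E v : G' a u *m R (tgt a) v =
    \sum_w T a w v *: Xi (src a) u w - \sum_w T a u w *: Xi (tgt a) w v.
  apply/matrixP => c d; have /matrixP/(_ u v) := xiP (c, d) a.
  rewrite mxE /= => ->; rewrite !mxE !summxE.
  by congr (_ - _); apply: eq_bigr => w _; rewrite !mxE // mulrC.
under [RHS]eq_bigr => v _ do rewrite E mulmxBl !mulmx_suml.
rewrite sumrB; congr (_ - _).
  under eq_bigr => v _ do rewrite -mulmxA relN mulmx_sumr.
  rewrite exchange_big /=; apply: eq_bigr => v _; apply: eq_bigr => w _.
  by rewrite -scalemxAr scalemxAl.
under eq_bigr => v _ do rewrite scaler_sumr.
rewrite exchange_big /=; apply: eq_bigr => v _; apply: eq_bigr => w _.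
by rewrite scalemxAl.
Qed.

(** <x, y>_{A[T]}, with one summand for each of the three terms of the complex below. *)
Definition chi x y : int :=
  (\sum_i x i * y i + \sum_(r : rel_index) x None * y (Some (tgt (tag r))))%N%:Z
  - (\sum_(b : arrow Qh) x (src b) * y (tgt b))%N%:Z.

Section Complex.
Variables (x y : vertex Qh -> nat) (N : rep k x) (P : rep k y).

(** Its kernel is Hom(N, P). *)
Definition dhom (phi : mxfam k x y) :
  @mxfam k (arrow Qh) (fun b => x (src b)) (fun b => y (tgt b)) :=
  fun b => phi (src b) *m P b - N b *m phi (tgt b).

(** The differential of the relations, in the off-diagonal direction of extensions of
    N by P; modulo the image of dhom, its kernel is Ext^1(N, P). *)
Definition drel (xi : @mxfam k (arrow Qh) (fun b => x (src b)) (fun b => y (tgt b))) :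
  @mxfam k rel_index (fun=> x None) (fun r => y (Some (tgt (tag r)))) :=
  fun r => tvec N (tagged r) *m xi (oarr (tag r))
    + relmap (x := fun i => y (Some i)) (omod P) (tpart xi) r.

Lemma dhom_linear : linfam dhom.
Proof.
move=> c F G b; rewrite /dhom mulmxDl mulmxDr -scalemxAl -scalemxAr scalerBr.
by rewrite opprD addrACA.
Qed.

Lemma drel_linear : linfam drel.
Proof.
move=> c F G r; rewrite /drel mulmxDr -scalemxAr scalerDr.
by rewrite -addrA [in RHS]addrACA -addrA relmap_linear.
Qed.

Lemma dhom0P phi : (forall b, dhom phi b = 0) <-> is_hom N P phi.
Proof.
split=> H b; first by have /eqP := H b; rewrite subr_eq0 => /eqP.
by rewrite /dhom H subrr.
Qed.

Lemma drel_dhom phi r : sat_rel N -> sat_rel P -> drel (dhom phi) r = 0.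
Proof.
move=> relN relP; case: r => a u; rewrite /drel /relmap.
have ea : dhom phi (oarr a) =
  phi (Some (src a)) *m omod P a - omod N a *m phi (Some (tgt a)) by [].
have ev i (v : 'I_(t i)) : tfam_at (x := fun i => y (Some i)) (tpart (dhom phi)) v =
  phi None *m tvec P v - tvec N v *m phi (Some i) by [].
rewrite [tag _]/= [tagged _]/= ea.
under eq_bigr => v _ do rewrite ev scalerBr scalemxAr scalemxAl.
rewrite sumrB -mulmx_sumr -mulmx_suml -relN -relP ev.
rewrite mulmxBr mulmxBl !mulmxA opprB.
set A := tvec N u *m _ *m _; set B := tvec N u *m _ *m _; set D := phi None *m _ *m _.
have -> : D - A + (B - D) = - (A - B) by rewrite opprB addrC addrA subrK.
exact: subrr.
Qed.

Lemma drel_surj : ext1_eq0 T T -> sat_rel P -> fsurj P ->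
  forall G, exists xi, forall r, drel xi r = G r.
Proof.
move=> hT relP surjP G; have [g gG] := relmap_surj hT relP surjP G.
exists (fun b => match b as b return 'M[k]_(x (@src Qh b), y (@tgt Qh b))
  with inl a => 0 | inr q => g q end) => r.
by rewrite /drel /= mulmx0 add0r -gG.
Qed.

(** With Hom = 0 and Ext^2 = 0, the Euler characteristic is - dim Ext^1. The last part
    says that Ext^1 = 0, in the form in which it is used: every infinitesimal
    deformation is a coboundary. *)
Lemma chi_le0 : ext1_eq0 T T -> sat_rel N -> sat_rel P -> fsurj P ->
  (forall phi, is_hom N P phi -> forall i, phi i = 0) ->
  chi x y <= 0 /\
  (chi x y = 0 -> forall xi, (forall r, drel xi r = 0) ->
     exists phi, forall b, dhom phi b = xi b).
Proof.
move=> hT relN relP surjP hom0.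
have [] := fam_exact dhom_linear drel_linear.
- by move=> F r; apply: drel_dhom.
- by move=> F /dhom0P; apply: hom0.
- exact: drel_surj.
rewrite /chi => le ex; split; first by rewrite subr_le0 lez_nat.
move=> /eqP; rewrite subr_eq0 eqz_nat => /eqP; exact: ex.
Qed.

End Complex.
End Ope.

(** * Semistable modules *)

Section Semistable.
Variables (k : closedFieldType) (Q : quiver) (t : vertex Q -> nat) (T : rep k t).
Local Notation Qh := (ope t).
Implicit Types x y e : vertex Qh -> nat.

Definition mdim x : nat := \sum_i x (Some i).

(** Submodules are given by injective homomorphisms, and mu(e) <= mu(x) is cleared of
    denominators: for s' / (s' + D') <= s / (s + D) this is s' D <= s D'. *)
Definition ssrep x (N : rep k x) : Prop :=
  forall e (A : rep k e) (f : mxfam k e x),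
    is_hom A N f -> (forall i, row_free (f i)) -> (e None * mdim x <= x None * mdim e)%N.

Definition ssdim x : Prop := exists2 N : rep k x, sat_rel T N & ssrep N.

Lemma hom_tvec x y (N : rep k x) (P : rep k y) f i (u : 'I_(t i)) : is_hom N P f ->
  tvec N u *m f (Some i) = f None *m tvec P u.
Proof. by move=> hf; apply: (hf (vec_arr u)). Qed.

Lemma hom_omod x y (N : rep k x) (P : rep k y) f a : is_hom N P f ->
  omod N a *m f (Some (tgt a)) = f (Some (src a)) *m omod P a.
Proof. by move=> hf; apply: (hf (oarr t a)). Qed.

Lemma sat_rel_sub x y (N : rep k x) (P : rep k y) f :
  is_hom N P f -> (forall i, row_free (f i)) -> sat_rel T P -> sat_rel T N.
Proof.
move=> hf ff relP a u; apply: (row_free_inj (ff (Some (tgt a)))).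
rewrite -mulmxA (hom_omod _ hf) mulmxA (hom_tvec _ hf) -mulmxA relP mulmx_sumr mulmx_suml.
by apply: eq_bigr => v _; rewrite -scalemxAl (hom_tvec _ hf) scalemxAr.
Qed.

Lemma row_full_injl m n p (B : 'M[k]_(m, n)) : row_full B ->
  injective (mulmx B : 'M_(n, p) -> 'M_(m, p)).
Proof. by case/row_fullP => C CB X Y /(congr1 (mulmx C)); rewrite !mulmxA CB !mul1mx. Qed.

Lemma sat_rel_quo x y (N : rep k x) (P : rep k y) f :
  is_hom N P f -> (forall i, row_full (f i)) -> sat_rel T N -> sat_rel T P.
Proof.
move=> hf ff relN a u; apply: (row_full_injl (ff None)).
have e := hom_tvec u hf; rewrite mulmxA -e -mulmxA -(hom_omod _ hf) mulmxA relN mulmx_sumr mulmx_suml.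
by apply: eq_bigr => v _; rewrite -scalemxAl (hom_tvec _ hf) scalemxAr.
Qed.

Lemma fsurj_quo x y (N : rep k x) (P : rep k y) f :
  is_hom N P f -> (forall i, row_full (f i)) -> fsurj N -> fsurj P.
Proof.
move=> hf ff sN i; have [R RN] := sN i; have /row_fullP[g gf] := ff (Some i).
exists (fun u => g *m R u *m f None).
transitivity (\sum_u g *m (R u *m tvec N u) *m f (Some i)).
  by apply: eq_bigr => u _; rewrite -!mulmxA (hom_tvec _ hf).
by rewrite -mulmx_suml -mulmx_sumr RN mulmx1.
Qed.

Definition stable x (N : rep k x) (r : vertex Qh -> nat) (U : mxfam k r x) : Prop :=
  forall b, (U (src b) *m N b <= U (tgt b))%MS.

Lemma ssrep_stable x (N : rep k x) r (U : mxfam k r x) : ssrep N -> stable N U ->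
  (\rank (U None) * mdim x <= x None * \sum_i \rank (U (Some i)))%N.
Proof.
move=> sN sU; pose f i := row_base (U i).
apply: (sN _ (fun b => f (src b) *m N b *m pinvmx (f (tgt b))) f).
  by move=> b; rewrite mulmxKpV // /f (eqmxMr _ (eq_row_base _)) eq_row_base.
by move=> i; apply: row_base_free.
Qed.

(** V together with the submodule that it generates has slope at least mu(x), with
    equality only if it is everything. *)
Lemma ssrep_fsurj x (N : rep k x) :
  sat_rel T N -> ssrep N -> (0 < x None)%N -> fsurj N.
Proof.
move=> relN sN x0.
pose U : mxfam k x x := fun j => match j as j return 'M[k]_(x j) with
  | None => 1%:M | Some i => (\sum_u <<tvec N u : 'M_(x None, x (Some i))>>)%MS end.
have sU : stable N U.
  case=> [a|[i u]].
    change ((\sum_u <<tvec N u : 'M_(x None, x (Some (src a)))>>)%MS *m omod N a <=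
      \sum_u <<tvec N u : 'M_(x None, x (Some (tgt a)))>>)%MS.
    rewrite sumsmxMr_gen; apply/sumsmx_subP => u _; rewrite genmxE.
    rewrite (eqmxMr _ (genmxE _)) relN.
    apply: summx_sub => v _; apply: scalemx_sub.
    by rewrite (sumsmx_sup v) // genmxE.
  change (1%:M *m tvec N u <= \sum_u <<tvec N u : 'M_(x None, x (Some i))>>)%MS.
  by rewrite mul1mx (sumsmx_sup u) // genmxE.
have := ssrep_stable sN sU; rewrite [U None]/= mxrank1 leq_pmul2l // => le.
have Ufull i : row_full (U (Some i)).
  rewrite /row_full eqn_leq rank_leq_col /=.
  have le2 : (\sum_(j | j != i) \rank (U (Some j)) <= \sum_(j | j != i) x (Some j))%N.
    by apply: leq_sum => j _; apply: rank_leq_col.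
  move: le; rewrite /mdim (bigD1 i) // [X in (_ <= X)%N](bigD1 i) //=.
  by move: le2; set A := (\sum_(j | _) \rank _)%N; set B := (\sum_(j | _) _)%N; lia.
move=> i; have := submx_full (1%:M : 'M_(x (Some i))) (Ufull i).
case/sub_sumsmxP => R RE.
have /fin_all_exists[S SE] u : exists S, <<tvec N u : 'M_(x None, x (Some i))>>%MS = S *m tvec N u.
  by apply/submxP; rewrite genmxE.
exists (fun u => R u *m S u); rewrite RE.
by apply: eq_bigr => u _; rewrite SE mulmxA.
Qed.
End Semistable.

(** * Short exact sequences and Harder-Narasimhan filtrations *)

Section SES.
Variables (k : closedFieldType) (Q : quiver) (t : vertex Q -> nat).
Local Notation Qh := (ope t).
Implicit Types x y e : vertex Qh -> nat.

(** A short exact sequence 0 -> A -> N -> D -> 0 with a splitting of the underlying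
    vector spaces; the splitting replaces all computations with row spaces. *)
Record ses x e e' (N : rep k x) (A : rep k e) (D : rep k e') : Type := SES {
  ses_i : mxfam k e x;
  ses_r : mxfam k x e;
  ses_s : mxfam k e' x;
  ses_p : mxfam k x e';
  ses_ir : forall j, ses_i j *m ses_r j = 1%:M;
  ses_sp : forall j, ses_s j *m ses_p j = 1%:M;
  ses_ip : forall j, ses_i j *m ses_p j = 0;
  ses_sr : forall j, ses_s j *m ses_r j = 0;
  ses_ri : forall j, ses_r j *m ses_i j + ses_p j *m ses_s j = 1%:M;
  ses_ihom : is_hom A N ses_i;
  ses_phom : is_hom N D ses_p
}.

Lemma row_free_r m n (f : 'M[k]_(m, n)) g : f *m g = 1%:M -> row_free f.
Proof. by move=> fg; apply/row_freeP; exists g. Qed.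

Lemma row_full_l m n (f : 'M[k]_(m, n)) g : g *m f = 1%:M -> row_full f.
Proof. by move=> fg; apply/row_fullP; exists g. Qed.

Lemma ses_dim x e e' (N : rep k x) (A : rep k e) (D : rep k e') :
  ses N A D -> forall j, x j = (e j + e' j)%N.
Proof.
move=> S j; pose P := col_mx (ses_i S j) (ses_s S j); pose R := row_mx (ses_r S j) (ses_p S j).
have PR : P *m R = 1%:M.
  by rewrite /P /R mul_col_row ses_ir ses_sp ses_ip ses_sr -scalar_mx_block.
have RP : R *m P = 1%:M by rewrite /P /R mul_row_col ses_ri.
by have /eqP := row_full_l RP; have /eqP -> := row_free_r PR.
Qed.

Lemma ses_of_mono x e (N : rep k x) (A : rep k e) f :
  is_hom A N f -> (forall i, row_free (f i)) ->
  exists e' (D : rep k e'), inhabited (ses N A D).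
Proof.
move=> hf ff.
pose c j := row_base (f j)^C%MS; pose P j := col_mx (f j) (c j).
have Pfull j : row_full (P j).
  rewrite -sub1mx /P -addsmxE.
  have := addsmx_compl_full (f j); rewrite -sub1mx => /submx_trans -> //.
  by rewrite addsmxS // eq_row_base.
have Pfree j : row_free (P j).
  have /eqP Pj := Pfull j; rewrite /row_free Pj.
  have le : (e j <= x j)%N.
    rewrite -(eqP (ff j)). exact: rank_leq_col.
  have /eqP rf := ff j. rewrite mxrank_compl rf; apply/eqP; lia.
pose R j := pinvmx (P j).
have PR j : P j *m R j = 1%:M by rewrite mulmxVp.
have RP j : R j *m P j = 1%:M by rewrite mulVpmx.
have RE j : R j = row_mx (lsubmx (R j)) (rsubmx (R j)) by rewrite hsubmxK.
have PR' j := PR j; have RP' j := RP j.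
have E j : [/\ f j *m lsubmx (R j) = 1%:M, f j *m rsubmx (R j) = 0,
    c j *m lsubmx (R j) = 0 & c j *m rsubmx (R j) = 1%:M].
  by have := PR j; rewrite /P {1}RE mul_col_row scalar_mx_block => /eq_block_mx[-> -> -> ->].
have RI j : lsubmx (R j) *m f j + rsubmx (R j) *m c j = 1%:M.
  by rewrite -RP {3}RE mul_row_col.
exists (fun j => \rank (f j)^C)%MS, (fun b => c (src b) *m N b *m rsubmx (R (tgt b))).
constructor; exists f (fun j => lsubmx (R j)) c (fun j => rsubmx (R j)) => //.
- by move=> j; case: (E j).
- by move=> j; case: (E j).
- by move=> j; case: (E j).
- by move=> j; case: (E j).
move=> b; rewrite !mulmxA.
rewrite -[N b in LHS]mul1mx -(RI (src b)) !mulmxDl -[_ *m f _ *m N b]mulmxA -hf.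
by rewrite -!mulmxA; case: (E (tgt b)) => _ -> _ _; rewrite !mulmx0 add0r.
Qed.

(** Modules generated by V are closed under extensions: what is left after lifting
    the generators of D lies in A. *)
Lemma fsurj_ses x e e' (N : rep k x) (A : rep k e) (D : rep k e') :
  ses N A D -> fsurj A -> fsurj D -> fsurj N.
Proof.
move=> S sA sD i; have [RA RAE] := sA i; have [RD RDE] := sD i.
pose Y := \sum_u ses_p S (Some i) *m RD u *m ses_s S None *m tvec N u.
have Yp : (1%:M - Y) *m ses_p S (Some i) = 0.
  rewrite mulmxBl mul1mx mulmx_suml.
  rewrite (_ : \sum_u _ = ses_p S (Some i) *m \sum_u RD u *m tvec D u).
    by rewrite RDE mulmx1 subrr.
  rewrite mulmx_sumr; apply: eq_bigr => u _.
  by rewrite -!mulmxA (hom_tvec _ (ses_phom S)) (mulmxA (ses_s S _)) ses_sp mul1mx.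
have YE : Y = 1%:M - (1%:M - Y) by rewrite subKr.
move: (1%:M - Y) Yp YE => W Wp YE.
exists (fun u => W *m ses_r S (Some i) *m RA u *m ses_i S None
  + ses_p S (Some i) *m RD u *m ses_s S None).
under eq_bigr => u _ do rewrite mulmxDl.
rewrite big_split /= -/Y YE.
rewrite (_ : \sum_u _ = W *m ses_r S (Some i) *m (\sum_u RA u *m tvec A u) *m ses_i S (Some i)).
  rewrite RAE mulmx1 -mulmxA (_ : ses_r S _ *m _ = 1%:M - ses_p S (Some i) *m ses_s S (Some i)).
    by rewrite mulmxBr mulmx1 mulmxA Wp mul0mx subr0 addrC subrK.
  by rewrite -(ses_ri S (Some i)) addrK.
rewrite mulmx_sumr mulmx_suml; apply: eq_bigr => u _.
by rewrite -!mulmxA (hom_tvec u (ses_ihom S)).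
Qed.

Lemma ses_quo_full x e e' (N : rep k x) (A : rep k e) (D : rep k e') (S : ses N A D) j :
  row_full (ses_p S j).
Proof. exact: row_full_l (ses_sp S j). Qed.

Lemma ses_sub_free x e e' (N : rep k x) (A : rep k e) (D : rep k e') (S : ses N A D) j :
  row_free (ses_i S j).
Proof. exact: row_free_r (ses_ir S j). Qed.

Definition ext_rep e e' (A : rep k e) (D : rep k e')
    (C : @mxfam k (arrow Qh) (fun b => e' (src b)) (fun b => e (tgt b))) :
  rep k (fun j => e j + e' j)%N :=
  fun b => block_mx (A b) 0 (C b) (D b).

Lemma ext_rep_ses e e' (A : rep k e) (D : rep k e') C : ses (ext_rep A D C) A D.
Proof.
exists (fun j => row_mx 1%:M 0) (fun j => col_mx 1%:M 0)
  (fun j => row_mx 0 1%:M) (fun j => col_mx 0 1%:M).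
- by move=> j; rewrite mul_row_col mulmx1 mul0mx addr0.
- by move=> j; rewrite mul_row_col mulmx1 mul0mx add0r.
- by move=> j; rewrite mul_row_col mulmx0 mul0mx addr0.
- by move=> j; rewrite mul_row_col mulmx0 mul0mx addr0.
- move=> j; rewrite !mul_col_row !mulmx0 !mul0mx !mulmx1 add_block_mx !addr0 !add0r.
  by rewrite -scalar_mx_block.
- by move=> b; rewrite mul_row_block mul_mx_row !mul1mx !mul0mx !mulmx1 !mulmx0 !addr0.
- by move=> b; rewrite mul_block_col mul_col_mx !mulmx0 !mulmx1 !mul0mx !mul1mx !add0r.
Qed.

(** With pre_rep, the preimage in N of a submodule A1 of D. *)
Definition pre_i x e e' e1 (N : rep k x) (A : rep k e) (D : rep k e') (S : ses N A D)
    (g : mxfam k e1 e') : mxfam k (fun j => e j + e1 j)%N x :=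
  fun j => col_mx (ses_i S j) (g j *m ses_s S j).

Definition pre_rep x e e' e1 (N : rep k x) (A : rep k e) (D : rep k e') (S : ses N A D)
    (A1 : rep k e1) (g : mxfam k e1 e') : rep k (fun j => e j + e1 j)%N :=
  ext_rep A A1 (fun b => g (src b) *m ses_s S (src b) *m N b *m ses_r S (tgt b)).

Lemma pre_hom x e e' e1 (N : rep k x) (A : rep k e) (D : rep k e') (S : ses N A D)
    (A1 : rep k e1) (g : mxfam k e1 e') :
  is_hom A1 D g -> is_hom (pre_rep S A1 g) N (pre_i S g).
Proof.
move=> hg b; rewrite /pre_rep /ext_rep /pre_i mul_block_col mul_col_mx mul0mx addr0.
rewrite (ses_ihom S); congr col_mx.
rewrite mulmxA hg -[N b in RHS]mulmx1 -(ses_ri S (tgt b)) mulmxDr mulmxDr !mulmxA.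
congr (_ + _); rewrite -!mulmxA; congr (_ *m _).
by rewrite !mulmxA -(mulmxA _ (N b)) (ses_phom S) mulmxA ses_sp mul1mx.
Qed.

Lemma pre_free x e e' e1 (N : rep k x) (A : rep k e) (D : rep k e') (S : ses N A D)
    (g : mxfam k e1 e') j : row_free (g j) -> row_free (pre_i S g j).
Proof.
case/row_freeP => h gh; apply: (@row_free_r _ _ _ (row_mx (ses_r S j) (ses_p S j *m h))).
rewrite mul_col_row ses_ir mulmxA ses_ip mul0mx -mulmxA ses_sr mulmx0.
by rewrite -mulmxA (mulmxA _ _ h) ses_sp mul1mx gh -scalar_mx_block.
Qed.

Lemma pre_ses x e e' e1 e2 (N : rep k x) (A : rep k e) (D : rep k e') (S : ses N A D)
    (A1 : rep k e1) (D1 : rep k e2) (S1 : ses D A1 D1) :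
  ses N (pre_rep S A1 (ses_i S1)) D1.
Proof.
exists (pre_i S (ses_i S1)) (fun j => row_mx (ses_r S j) (ses_p S j *m ses_r S1 j))
  (fun j => ses_s S1 j *m ses_s S j) (fun j => ses_p S j *m ses_p S1 j).
- move=> j; rewrite mul_col_row ses_ir mulmxA ses_ip mul0mx -mulmxA ses_sr mulmx0.
  by rewrite -mulmxA (mulmxA _ _ (ses_r S1 j)) ses_sp mul1mx ses_ir -scalar_mx_block.
- by move=> j; rewrite -mulmxA (mulmxA _ _ (ses_p S1 j)) ses_sp mul1mx ses_sp.
- move=> j; rewrite mul_col_mx mulmxA ses_ip mul0mx -mulmxA (mulmxA (ses_s S j)).
  by rewrite ses_sp mul1mx ses_ip col_mx0.
- move=> j; rewrite mul_mx_row -mulmxA ses_sr mulmx0 -mulmxA (mulmxA (ses_s S j)).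
  by rewrite ses_sp mul1mx ses_sr row_mx0.
- move=> j; rewrite mul_row_col -!mulmxA -addrA -mulmxDr !mulmxA -mulmxDl ses_ri mul1mx.
  exact: ses_ri.
- exact: pre_hom (ses_ihom S1).
- by move=> b; rewrite mulmxA (ses_phom S) -!mulmxA (ses_phom S1).
Qed.

Definition slope_gt x y : bool := (y None * mdim x < x None * mdim y)%N.

(** The image of f is a quotient of N and a submodule of P, so its slope would be both
    at least mu(x) and at most mu(y). *)
Lemma ss_hom0 x y (N : rep k x) (P : rep k y) f :
  ssrep N -> ssrep P -> (0 < x None)%N -> slope_gt x y ->
  is_hom N P f -> forall i, f i = 0.
Proof.
move=> sN sP x0 gt hf.
have stK : stable N (fun i => kermx (f i)).
  by move=> b; apply/sub_kermxP; rewrite -mulmxA hf mulmxA mulmx_ker mul0mx.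
have stI : stable P f by move=> b; rewrite -hf submxMl.
have := ssrep_stable sN stK; have := ssrep_stable sP stI.
have rk i : (\rank (f i) <= x i)%N := rank_leq_row _.
rewrite mxrank_ker (eq_bigr _ (fun i _ => mxrank_ker (f (Some i)))).
set I := (\sum_i \rank (f (Some i)))%N.
have -> : (\sum_i (x (Some i) - \rank (f (Some i))) = mdim x - I)%N.
  by rewrite sumnB.
have Ile : (I <= mdim x)%N by apply: leq_sum.
move: gt (rk None); rewrite /slope_gt; set a := \rank (f None) => gt alx h1 h2.
have /andP[/eqP a0 /eqP I0] : (a == 0)%N && (I == 0)%N.
  have h3 : (x None * I <= a * mdim x)%N.
    by move: h2; rewrite mulnBl mulnBr; nia.
  have h4 : (I * (x None * mdim y) <= I * (y None * mdim x))%N by nia.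
  have I0 : I = 0%N by nia.
  by rewrite I0 in h1 *; nia.
case=> [i|]; apply/eqP; rewrite -mxrank_eq0.
  by move/eqP: I0; rewrite /I sum_nat_eq0 => /forallP/(_ i).
by rewrite -/a a0.
Qed.

End SES.

Lemma slope_le_nat (a b a' b' : nat) : (0 < a + b)%N -> (0 < a' + b')%N ->
  (a'%:R / (a' + b')%:R <= a%:R / (a + b)%:R :> rat) = (a' * b <= a * b')%N.
Proof.
move=> p p'; rewrite ler_pdivrMr ?ltr0n // mulrAC ler_pdivlMr ?ltr0n //.
by rewrite -!natrM ler_nat !mulnDr [(a * a')%N]mulnC leq_add2l.
Qed.

Section HN.
Variables (k : closedFieldType) (Q : quiver) (t : vertex Q -> nat) (T : rep k t).
Local Notation Qh := (ope t).
Implicit Types x y e : vertex Qh -> nat.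

Definition mono x e (N : rep k x) (A : rep k e) (f : mxfam k e x) : Prop :=
  is_hom A N f /\ forall i, row_free (f i).

Lemma mono_id x (N : rep k x) : mono N N (fun=> 1%:M).
Proof.
by split=> [b|i]; [rewrite mul1mx mulmx1|apply: (row_free_r (mul1mx _))].
Qed.

Lemma mono_comp x e e' (N : rep k x) (A : rep k e) (B : rep k e') f g :
  mono N A f -> mono A B g -> mono N B (fun i => g i *m f i).
Proof.
move=> [hf ff] [hg fg]; split=> [b|i].
  by rewrite mulmxA hg -mulmxA hf mulmxA.
by rewrite /row_free mxrankMfree ?ff //; apply: fg.
Qed.

Lemma mono_le x e (N : rep k x) (A : rep k e) f : mono N A f -> forall i, (e i <= x i)%N.
Proof. by move=> [_ ff] i; rewrite -(eqP (ff i)) rank_leq_col. Qed.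

Definition slope_ge x y : bool := (y None * mdim x <= x None * mdim y)%N.

(** The second clause says that e is the largest among the submodules of maximal
    slope: at equal positive slope, a larger top dimension means a larger submodule. *)
Lemma max_destabilizing x (N : rep k x) : (0 < x None)%N ->
  exists e (A : rep k e) (f : mxfam k e x), [/\ mono N A f, (0 < e None)%N &
    forall e' (A' : rep k e') f', mono N A' f' -> (0 < e' None)%N ->
      slope_ge e e' /\ (slope_ge e' e -> e' None <= e None)%N].
Proof.
move=> x0; pose I := ('I_(x None).+1 * 'I_(mdim x).+1)%type.
pose R (i : I) := (exists e (A : rep k e) (f : mxfam k e x),
  [/\ mono N A f, (0 < e None)%N, e None = i.1 & mdim e = i.2]).
have /fin_all_exists[P PR] (i : I) : exists b : bool, b <-> R i.
  by case: (classic (R i)) => H; [exists true|exists false].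
have inI e (A : rep k e) f : mono N A f -> (0 < e None)%N ->
    exists2 i : I, P i & e None = i.1 /\ mdim e = i.2.
  move=> m e0; have le := mono_le m.
  have le2 : (mdim e < (mdim x).+1)%N by rewrite ltnS; apply: leq_sum.
  exists (inord (e None), Ordinal le2); last by rewrite inordK ?ltnS.
  by apply/PR; exists e, A, f; split=> //=; rewrite inordK ?ltnS.
have [i0 Pi0 _] := inI _ _ _ (mono_id N) x0.
pose key (i : I) : rat := (i.1 : nat)%:R / (i.1 + i.2)%N%:R.
case: (@Order.TotalTheory.arg_maxP _ _ _ i0 P key Pi0) => i1 Pi1 max1.
pose P2 i := P i && (key i1 <= key i).
have P2i1 : P2 i1 by rewrite /P2 Pi1 lexx.
case: (@arg_maxnP _ i1 P2 (fun i => i.1) P2i1) => i /andP[Pi ki] max2.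
have [e [A [f [m e0 e1 e2]]]] := (PR i).1 Pi.
exists e, A, f; split=> // e' A' f' m' e'0.
have [j Pj [j1 j2]] := inI _ _ _ m' e'0.
have kj : key j <= key i by apply: le_trans ki; apply: max1.
split.
  rewrite /slope_ge e1 e2 j1 j2 -slope_le_nat //; first by rewrite -e1 addn_gt0 e0.
  by rewrite -j1 addn_gt0 e'0.
rewrite /slope_ge e1 e2 j1 j2 -slope_le_nat ?addn_gt0 -?e1 -?j1 ?e0 ?e'0 //.
rewrite e1 j1 => kij; apply: max2; rewrite /P2 Pj /=.
exact: le_trans ki kij.
Qed.

Definition dimsum (h : seq (vertex Qh -> nat)) : vertex Qh -> nat :=
  foldr (fun y z j => y j + z j)%N (fun=> 0%N) h.

(** Harder-Narasimhan types all of whose entries have a nonzero first component. *)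
Fixpoint hn_list (h : seq (vertex Qh -> nat)) : Prop :=
  match h with
  | [::] => True
  | y :: h' => [/\ ssdim T y, (0 < y None)%N,
      (match h' with [::] => True | z :: _ => slope_gt y z end) & hn_list h']
  end.

Definition zero_rep : rep k (fun _ : vertex Qh => 0%N) := fun=> 0.

Lemma fsurj_zero x (N : rep k x) : (forall i, x (Some i) = 0)%N -> fsurj N.
Proof.
move=> x0 i; exists (fun=> 0); apply/matrixP => a b.
by suff: (a < 0)%N by []; rewrite -[X in (_ < X)%N](x0 i).
Qed.

Lemma fsurj_no_top x (N : rep k x) : fsurj N -> x None = 0%N -> forall i, x (Some i) = 0%N.
Proof.
move=> sN x0 i; have [R RN] := sN i; have : \rank (1%:M : 'M[k]_(x (Some i))) = 0%N.
  rewrite -RN big1 ?mxrank0 // => u _.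
  have -> : R u = 0 by apply/matrixP => a b; suff: (b < 0)%N by []; rewrite -[X in (_ < X)%N]x0.
  by rewrite mul0mx.
by rewrite mxrank1.
Qed.

Lemma ses_zero x (N : rep k x) : ses N zero_rep N.
Proof.
exists (fun=> 0) (fun=> 0) (fun=> 1%:M) (fun=> 1%:M) => [j|j|j|j|j|b|b].
- by apply/matrixP => -[].
- by rewrite mul1mx.
- by rewrite mul0mx.
- by rewrite mulmx0.
- by rewrite mulmx0 mul1mx add0r.
- by rewrite mulmx0 mul0mx.
- by rewrite mulmx1 mul1mx.
Qed.

(** The recursion splits off the largest submodule of maximal slope. Every step of the
    filtration is generated by its V-part, because its semistable factors are. *)
Lemma HN_exists n x (N : rep k x) : (x None + mdim x <= n)%N ->
  sat_rel T N -> fsurj N -> (0 < x None)%N ->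
  exists h, [/\ hn_list h, h <> [::], (forall j, dimsum h j = x j) &
    forall p, exists eA eD (A : rep k eA) (D : rep k eD),
      [/\ forall j, eA j = dimsum (take p h) j, forall j, eD j = dimsum (drop p h) j,
        inhabited (ses N A D) & fsurj A]].
Proof.
elim: n x N => [|n IH] x N.
  by rewrite leqn0 addn_eq0 => /andP[/eqP->].
move=> le relN sN x0; have [e [A [f [m e0 max]]]] := max_destabilizing N x0.
have relA : sat_rel T A := sat_rel_sub m.1 m.2 relN.
have ssA : ssrep A.
  move=> e1 A1 g hg fg; have [->|e10] := posnP (e1 None); first by rewrite mul0n.
  by have [] := max _ _ _ (mono_comp m (conj hg fg)) e10.
have sA : fsurj A := ssrep_fsurj relA ssA e0.
have ssde : ssdim T e by exists A.
have [e' [D [S]]] := ses_of_mono m.1 m.2.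
have dimx := ses_dim S.
have relD : sat_rel T D := sat_rel_quo (ses_phom S) (ses_quo_full S) relN.
have sD : fsurj D := fsurj_quo (ses_phom S) (ses_quo_full S) sN.
have [D0|D0] := posnP (e' None).
  have D0' : forall j, e' j = 0%N.
    by move=> [i|//]; apply: fsurj_no_top sD D0 i.
  exists [:: e]; split=> //= [j|p].
  - by rewrite dimx D0'.
  - case: p => [|p].
      exists (fun=> 0%N), x, zero_rep, N; split=> //.
      + by move=> j; rewrite dimx D0'.
      + by constructor; apply: ses_zero.
      + exact: fsurj_zero.
    exists e, e', A, D; split=> //.
    by move=> j /=; rewrite addn0.
have lt : (e' None + mdim e' <= n)%N.
  move: le; rewrite dimx /mdim; under [X in (_ + X <= _)%N -> _]eq_bigr => i _ do rewrite dimx.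
  by rewrite big_split /=; move: e0; lia.
have [h [hl hn dh hS]] := IH _ D lt relD sD D0.
(* By maximality, all submodules of the quotient D have slope below mu(e). *)
have gt e1 (A1 : rep k e1) g : mono D A1 g -> (0 < e1 None)%N -> slope_gt e e1.
  move=> [hg fg] e10.
  have m' : mono N (pre_rep S A1 g) (pre_i S g).
    by split; [apply: pre_hom|move=> j; apply: pre_free].
  have [] := max _ _ _ m'; first by rewrite addn_gt0 e0.
  rewrite /slope_ge /slope_gt /mdim big_split /= -/(mdim e) -/(mdim e1).
  rewrite !mulnDl !mulnDr leq_add2l => l1 l2.
  rewrite ltn_neqAle l1 andbT; apply/eqP => eq1; move: l2; rewrite eq1 => /(_ (leqnn _)).
  by move: e10; lia.
exists (e :: h); split=> // [|j|p].
- case: h hl hn dh hS => // z h hl _ dh hS /=; split=> //.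
  have [eA [eD [A1 [D1 [dA dD [S1] sA1]]]]] := hS 1%N.
  have eAz j : eA j = z j by rewrite dA /= take0 /= addn0.
  have z0 : (0 < z None)%N by case: hl.
  have := gt _ A1 (ses_i S1) (conj (ses_ihom S1) (ses_sub_free S1)).
  rewrite eAz => /(_ z0); rewrite /slope_gt eAz /mdim.
  by under [X in (_ < _ * X)%N -> _]eq_bigr => i _ do rewrite eAz.
- by rewrite /= dh dimx.
- case: p => [|p].
    exists (fun=> 0%N), x, zero_rep, N; split=> //.
    + by move=> j; rewrite dimx /= dh.
    + by constructor; apply: ses_zero.
    + exact: fsurj_zero.
  have [eA [eD [A1 [D1 [dA dD [S1] sA1]]]]] := hS p.
  exists (fun j => e j + eA j)%N, eD, (pre_rep S A1 (ses_i S1)), D1; split=> //.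
  + by move=> j /=; rewrite dA.
  + by constructor; apply: pre_ses.
  + exact: fsurj_ses (ext_rep_ses _ _ _) sA sA1.
Qed.

End HN.

(** * Euler pairings along a Harder-Narasimhan type *)

Section Chi.
Variables (k : closedFieldType) (Q : quiver) (t : vertex Q -> nat) (T : rep k t).
Hypothesis hT : ext1_eq0 T T.
Local Notation Qh := (ope t).
Implicit Types x y z : vertex Qh -> nat.

Local Notation d0 := (fun _ : vertex Qh => 0%N).

Lemma chi_addl x y z : chi (fun j => x j + y j)%N z = chi x z + chi y z.
Proof.
have e (I : finType) (F G H : I -> nat) :
    (\sum_i (F i + G i) * H i = \sum_i F i * H i + \sum_i G i * H i)%N.
  by rewrite -big_split; apply: eq_bigr => i _; rewrite mulnDl.
by rewrite /chi !e; lia.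
Qed.

Lemma chi_addr x y z : chi x (fun j => y j + z j)%N = chi x y + chi x z.
Proof.
have e (I : finType) (F G H : I -> nat) :
    (\sum_i F i * (G i + H i) = \sum_i F i * G i + \sum_i F i * H i)%N.
  by rewrite -big_split; apply: eq_bigr => i _; rewrite mulnDr.
by rewrite /chi !e; lia.
Qed.

Lemma chi0r x : chi x d0 = 0.
Proof.
have := chi_addr x d0 d0.
have -> : (fun j => d0 j + d0 j)%N = d0 by apply: functional_extensionality.
by lia.
Qed.

(** Hom and Ext^2 vanish. *)
Lemma chi_pair_le0 y z : ssdim T y -> ssdim T z -> (0 < y None)%N -> (0 < z None)%N ->
  slope_gt y z -> chi y z <= 0.
Proof.
move=> [N relN sN] [P relP sP] y0 z0 gt.
have sP' := ssrep_fsurj relP sP z0.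
exact: (chi_le0 hT relN relP sP' (fun f => ss_hom0 sN sP y0 gt)).1.
Qed.

Lemma hn_list_gt y h : hn_list T (y :: h) -> forall l, (l < size h)%N ->
  [/\ ssdim T (nth d0 h l), (0 < nth d0 h l None)%N & slope_gt y (nth d0 h l)].
Proof.
elim: h y => [//|z h IH] y [_ y0 gt hl] [_|l lt].
  by case: hl => sz z0 _ _.
have [sw w0 gt'] := IH _ hl l lt; split=> //=.
case: hl => _ z0 _ _; move: gt gt' z0 y0 w0; rewrite /slope_gt.
set w := nth _ _ _; set Y := mdim y; set Z := mdim z; set W := mdim w => h1 h2 z0 y0 w0.
have h3 : (z None * (w None * Y) <= y None * (w None * Z))%N by nia.
have h4 : (y None * (w None * Z) < y None * (z None * W))%N by rewrite ltn_pmul2l.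
have h5 : (z None * (w None * Y) < z None * (y None * W))%N.
  by apply: leq_ltn_trans h3 _; rewrite [ltnRHS]mulnCA.
by move: h5; rewrite ltn_pmul2l.
Qed.

Lemma chi_dimsum_le0 y h : (forall l, (l < size h)%N -> chi y (nth d0 h l) <= 0) ->
  chi y (dimsum h) <= 0 /\
  ((exists2 l, (l < size h)%N & chi y (nth d0 h l) <> 0) -> chi y (dimsum h) < 0).
Proof.
elim: h => [|z h IH] le; first by rewrite /= chi0r; split=> // -[].
have [l1 l2] := IH (fun l => le l.+1); have le0 := le 0%N isT.
rewrite /= chi_addr; split; first by rewrite -[0]addr0 lerD.
move=> [[|l] lt ne].
  have : chi y z < 0 by rewrite lt_neqAle le0 andbT; apply/eqP.
  by move=> c; rewrite -[0]addr0; apply: ltr_leD.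
rewrite -[0]addr0; apply: ler_ltD => //; apply: l2.
by exists l.
Qed.

Lemma chi_dimsum0 y h : (forall l, (l < size h)%N -> chi y (nth d0 h l) = 0) ->
  chi y (dimsum h) = 0.
Proof.
elim: h => [|z h IH] le; first by rewrite /= chi0r.
by rewrite /= chi_addr (le 0%N) // add0r IH // => l; apply: (le l.+1).
Qed.

(** The pairing of the two parts of h cut at p is the sum of the pairings across the
    cut, which are all <= 0; a nonzero pairing of h_n and h_l makes the cut at p
    negative for n < p <= l. *)
Lemma hn_list_split h : hn_list T h ->
  (forall n l, (n < l < size h)%N -> chi (nth d0 h n) (nth d0 h l) = 0) \/
  exists p, chi (dimsum (take p h)) (dimsum (drop p h)) < 0.
Proof.
elim: h => [|y h IH] hl; first by left=> n l; rewrite ltn0 andbF.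
have hl' : hn_list T h by case: hl.
have le l : (l < size h)%N -> chi y (nth d0 h l) <= 0.
  move=> lt; have [sz z0 gt] := hn_list_gt hl lt.
  by case: hl => sy y0 _ _; apply: chi_pair_le0.
case: (IH hl') => [eq0|[p neg]]; last first.
  right; exists p.+1; rewrite /= chi_addl -[0]addr0; apply: ler_ltD => //.
  apply: (chi_dimsum_le0 _).1 => l; rewrite size_drop => lt.
  by rewrite nth_drop; apply: le; lia.
case: (classic (exists2 l, (l < size h)%N & chi y (nth d0 h l) <> 0)) => [ex|nex].
  right; exists 1%N; rewrite take_cons take0 drop1 /=.
  have -> : (fun j => y j + 0)%N = y by apply: functional_extensionality => j; rewrite addn0.
  exact: (chi_dimsum_le0 le).2.
left=> -[|n] [|l] //=; last exact: eq0.
by rewrite ltnS => lt; apply: NNPP => ne; apply: nex; exists l.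
Qed.

Lemma sat_rel_joint x y z (N : rep k x) (A : rep k y) (D : rep k z) f g :
  is_hom N A f -> is_hom N D g -> (forall j, row_free (row_mx (f j) (g j))) ->
  sat_rel T A -> sat_rel T D -> sat_rel T N.
Proof.
move=> hf hg free relA relD a u; apply: (row_free_inj (free (Some (tgt a)))).
have eq w (B : rep k w) h : is_hom N B h -> sat_rel T B ->
    tvec N u *m omod N a *m h (Some (tgt a)) =
    (\sum_v T a u v *: tvec N v) *m h (Some (tgt a)).
  move=> hh relB; rewrite -mulmxA (hom_omod _ hh) mulmxA (hom_tvec _ hh) -mulmxA relB.
  rewrite mulmx_sumr mulmx_suml.
  by apply: eq_bigr => v _; rewrite -scalemxAl (hom_tvec _ hh) scalemxAr.
by rewrite !mul_mx_row !(eq _ _ _ hf relA) !(eq _ _ _ hg relD).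
Qed.

Lemma direct_sum y z (A : rep k y) (D : rep k z) :
  exists N : rep k (fun j => y j + z j)%N, [/\ N = ext_rep A D (fun=> 0),
    (sat_rel T A -> sat_rel T D -> sat_rel T N),
    (fsurj A -> fsurj D -> fsurj N) &
    forall x (P : rep k x), (forall f, is_hom P A f -> forall j, f j = 0) ->
      (forall f, is_hom P D f -> forall j, f j = 0) ->
      forall f, is_hom P N f -> forall j, f j = 0].
Proof.
pose N := ext_rep A D (fun=> 0); exists N.
pose f j : 'M[k]_(y j + z j, y j) := col_mx 1%:M 0.
pose g j : 'M[k]_(y j + z j, z j) := col_mx 0 1%:M.
have hf : is_hom N A f.
  by move=> b; rewrite mul_block_col mul_col_mx !mulmx0 !mulmx1 !mul0mx !mul1mx !addr0.
have hg : is_hom N D g.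
  by move=> b; rewrite mul_block_col mul_col_mx !mulmx0 !mulmx1 !mul0mx !mul1mx !add0r.
have fg j : row_mx (f j) (g j) = 1%:M.
  by rewrite -block_mxEh -scalar_mx_block.
have free j : row_free (row_mx (f j) (g j)) by rewrite fg row_free_unit unitmx1.
split=> //.
- exact: sat_rel_joint hf hg free.
- exact: fsurj_ses (ext_rep_ses A D _).
move=> x P homA homD h hh j.
have h1 : h j *m f j = 0.
  by apply: (homA (fun j => h j *m f j)) => b; rewrite mulmxA hh -!mulmxA hf.
have h2 : h j *m g j = 0.
  by apply: (homD (fun j => h j *m g j)) => b; rewrite mulmxA hh -!mulmxA hg.
by rewrite -[h j]mulmx1 -fg mul_mx_row h1 h2 row_mx0.
Qed.

(** The complement N2 of h_1 in the type: a direct sum of semistable modules of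
    slope smaller than mu(y). *)
Lemma hom0_direct_sum y h (P : rep k y) : ssrep P -> (0 < y None)%N ->
  (forall l, (l < size h)%N ->
    [/\ ssdim T (nth d0 h l), (0 < nth d0 h l None)%N & slope_gt y (nth d0 h l)]) ->
  exists N : rep k (dimsum h), [/\ sat_rel T N, fsurj N &
    forall f, is_hom P N f -> forall j, f j = 0].
Proof.
move=> sP y0; elim: h => [|z h IH] hh.
  exists (@zero_rep _ _ _); split.
  - by move=> a u; apply/matrixP => i [].
  - exact: fsurj_zero.
  - by move=> f _ j; apply/matrixP => i [].
have [N [relN sN homN]] := IH (fun l => hh l.+1).
have [[D relD sD] z0 gt] := hh 0%N isT.
have [M [_ relM sM homM]] := direct_sum D N.
exists M; split; [exact: relM|apply: sM => //; exact: ssrep_fsurj relD sD z0|].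
by apply: homM => // f; apply: ss_hom0 sP sD y0 gt.
Qed.

End Chi.

(** * Charts for subspaces and kernels *)

Section Charts.
Variable k : fieldType.

(** For a bijection pi, a permutation matrix between index sets whose sizes are equal
    but not convertible; this avoids casts. *)
Definition chart_mx (p n : nat) (pi : {ffun 'I_p -> 'I_n}) : 'M[k]_(p, n) :=
  \matrix_(a, b) (pi a == b)%:R.

Lemma mul_tr_chart_mx m p n (pi : {ffun 'I_p -> 'I_n}) (B : 'M[k]_(m, n)) :
  B *m (chart_mx pi)^T = \matrix_(i, c) B i (pi c).
Proof.
apply/matrixP => i c; rewrite !mxE (bigD1 (pi c)) //= !mxE eqxx mulr1 big1 ?addr0 // => b ne.
by rewrite !mxE eq_sym (negPf ne) mulr0.
Qed.

(** The Grassmannian is covered by the finitely many charts indexed by pi. *)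
Lemma chart_ex r m n (B : 'M[k]_(r, n)) : row_free B -> n = (r + m)%N ->
  exists pi : {ffun 'I_(r + m) -> 'I_n},
    [/\ chart_mx pi *m (chart_mx pi)^T = 1%:M, (chart_mx pi)^T *m chart_mx pi = 1%:M &
      lsubmx (B *m (chart_mx pi)^T) \in unitmx].
Proof.
move=> freeB nE; have fullB : row_full B^T by rewrite /row_full mxrank_tr.
pose f := fullrankfun fullB; pose A := [set j | j \notin codom f].
have finj : injective f by apply: fullrankfun_inj.
have cA : #|A| = m.
  have cc : (r + #|[predC codom f]| = #|'I_n|)%N.
    by rewrite -(cardC (mem (codom f))) card_codom // card_ord.
  move/addnI: (etrans cc (etrans (card_ord n) nE)) => <-; apply: eq_card => j.
  by rewrite !inE.
pose g (b : 'I_m) : 'I_n := enum_val (cast_ord (esym cA) b).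
pose h (c : 'I_(r + m)) : 'I_n := match split c with inl a => f a | inr b => g b end.
pose pi : {ffun 'I_(r + m) -> 'I_n} := finfun h.
have gA b : g b \notin codom f by have := enum_valP (cast_ord (esym cA) b); rewrite inE.
have pi_inj : injective pi.
  move=> c c'; rewrite !ffunE /h.
  case: (split_ordP c) => a ->; case: (split_ordP c') => a' -> e.
  - by rewrite (finj _ _ e).
  - by have := gA a'; rewrite -e codom_f.
  - by have := gA a; rewrite e codom_f.
  - by have /enum_val_inj /cast_ord_inj -> := e.
have PP : chart_mx pi *m (chart_mx pi)^T = 1%:M.
  apply/matrixP => c c'; rewrite mul_tr_chart_mx !mxE (inj_eq pi_inj).
  by [].
exists pi; split=> //.
  have fullP : row_full (chart_mx pi).
    have /eqP rP : row_free (chart_mx pi) by apply/row_freeP; eexists; exact: PP.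
    by rewrite /row_full rP; apply/eqP.
  have [L LP] := row_fullP fullP.
  by have <- : L = (chart_mx pi)^T by rewrite -[L]mulmx1 -PP mulmxA LP mul1mx.
have -> : lsubmx (B *m (chart_mx pi)^T) = (rowsub f B^T)^T.
  apply/matrixP => i a; rewrite mul_tr_chart_mx !mxE ffunE /h.
  by case: (split_ordP (lshift m a)) => a' /eqP; rewrite eq_shift // => /eqP ->.
by rewrite unitmx_tr -row_full_unit fullrowsub_full.
Qed.

(** Cramer's rule: once the rows of K are permuted so that the upper square block K1
    is invertible, a vector (y1, y2) of the kernel has y1 = - y2 K2 K1^-1. Taking
    y2 = (det K1) phi makes the parametrization polynomial in K and phi. *)
Definition kernel_chart (N l m : nat) (pi : {ffun 'I_(l + m) -> 'I_N}) (K : 'M[k]_(N, l))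
    (phi : 'rV[k]_m) : 'rV[k]_N :=
  let K' := chart_mx pi *m K in
  row_mx (- (phi *m dsubmx K' *m \adj (usubmx K'))) (\det (usubmx K') *: phi) *m chart_mx pi.

Lemma kernel_chart_cover N l m (K : 'M[k]_(N, l)) (y : 'rV[k]_N) :
  N = (l + m)%N -> \rank K = l -> y *m K = 0 ->
  exists (pi : {ffun 'I_(l + m) -> 'I_N}) phi, y = kernel_chart pi K phi.
Proof.
move=> NE rK yK; have free : row_free K^T by rewrite /row_free mxrank_tr rK.
have [pi [PP QP unit]] := chart_ex free NE; exists pi.
rewrite /kernel_chart; set K' := chart_mx pi *m K; set y' := y *m (chart_mx pi)^T.
have K1 : usubmx K' \in unitmx.
  rewrite -unitmx_tr; congr (_ \in unitmx): unit.
  by rewrite -trmx_mul; apply/matrixP => i j; rewrite !mxE.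
have y'K : lsubmx y' *m usubmx K' + rsubmx y' *m dsubmx K' = 0.
  rewrite -mul_row_col hsubmxK vsubmxK /y' /K' mulmxA -(mulmxA y) QP mulmx1.
  exact: yK.
have dn0 : \det (usubmx K') != 0 by rewrite -unitfE; apply: K1.
exists ((\det (usubmx K'))^-1 *: rsubmx y').
rewrite scalerA divff // scale1r -scalemxAl.
have -> : - ((\det (usubmx K'))^-1 *: (rsubmx y' *m dsubmx K') *m \adj (usubmx K')) = lsubmx y'.
  have -> : rsubmx y' *m dsubmx K' = - (lsubmx y' *m usubmx K').
    by apply/eqP; rewrite -addr_eq0 addrC y'K.
  rewrite -scalemxAl mulNmx -mulmxA mul_mx_adj scalerN opprK mul_mx_scalar scalerA.
  by rewrite mulVf // scale1r.
by rewrite hsubmxK /y' -mulmxA QP mulmx1.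
Qed.

Lemma row_full_block_lower m1 m2 n1 n2 (P : 'M[k]_(m1, n1)) (R : 'M[k]_(m2, n1))
    (D : 'M[k]_(m2, n2)) :
  row_full P -> row_full D -> row_full (block_mx P 0 R D).
Proof.
case/row_fullP => P' PP; case/row_fullP => D' DD; apply/row_fullP.
exists (block_mx P' 0 (- (D' *m R *m P')) D').
rewrite mulmx_block !mul0mx !mulmx0 !addr0 PP DD mulNmx -(mulmxA (D' *m R)) PP mulmx1 addNr add0r.
by rewrite -scalar_mx_block.
Qed.

End Charts.

(** * Counting the parameters of destabilized modules *)

Lemma polymx_fammx (k : closedFieldType) (V : Type) (C : (V -> k) -> Prop)
    (X X' : finType) (m n : X -> nat) (m' n' : X' -> nat)
    (L : V -> mxfam k m n -> mxfam k m' n') :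
  (forall F x, polymx C (fun v => L v F x)) -> polymx C (fun v => fammx (L v)).
Proof.
move=> pL c c'; pose e := enum_val c'.
apply: polyfun_ext (pL (unvec (delta_mx 0 c)) (tag e) (tagged e).1 (tagged e).2) => v.
by rewrite mxE mxE.
Qed.

Lemma polymx_kernel_chart (k : fieldType) (V : Type) (C : (V -> k) -> Prop) N l m
    (pi : {ffun 'I_(l + m) -> 'I_N}) (K : V -> 'M[k]_(N, l)) (phi : V -> 'rV[k]_m) :
  polymx C K -> polymx C phi -> polymx C (fun v => kernel_chart pi (K v) (phi v)).
Proof.
move=> pK pphi; have pK' : polymx C (fun v => chart_mx k pi *m K v).
  by apply: polymx_mul => //; apply: polymx_const.
have pu : polymx C (fun v => usubmx (chart_mx k pi *m K v)).
  by move=> i j; apply: polyfun_ext (pK' (lshift m i) j) => v; rewrite [RHS]mxE.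
have pd : polymx C (fun v => dsubmx (chart_mx k pi *m K v)).
  by move=> i j; apply: polyfun_ext (pK' (rshift l i) j) => v; rewrite [RHS]mxE.
apply: polymx_mul; last exact: polymx_const.
apply: polymx_row; last by apply: polymx_scale => //; apply: polyfun_det.
by apply: polymx_opp; apply: polymx_mul; [apply: polymx_mul|apply: polymx_adj].
Qed.

Section Famof.
Variables (k : closedFieldType) (X : finType) (m n : X -> nat) (J : finType).

Definition famof (f : entry_index m n -> J) (v : J -> k) : mxfam k m n :=
  fun y => \matrix_(i, j) v (f (Tagged (fun x => ('I_(m x) * 'I_(n x))%type) (i, j))).

Lemma famofK (f : entry_index m n -> J) (v : J -> k) (F : mxfam k m n) :
  (forall c, v (f c) = F (tag c) (tagged c).1 (tagged c).2) -> famof f v = F.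
Proof.
move=> vF; apply: functional_extensionality_dep => y; apply/matrixP => i j.
by rewrite mxE vF.
Qed.

Lemma polymx_famof (f : entry_index m n -> J) y : polymx (@fun_coord k J) (fun v => famof f v y).
Proof.
move=> i j; apply: (@polyfun_ext _ _ _ (fun v => v (f (Tagged _ (i, j))))) => [v|].
  by rewrite mxE.
by apply: polyfun_coord; eexists.
Qed.

End Famof.

(** Charts covering the pairs (M, f + z S) such that (M, f) is a module with a
    submodule of dimension e generated by its V-part. The parameters are the chart
    coordinates w of the subspaces, the three blocks A, C, D of the Q-part in an
    adapted basis, the coordinates phi in the kernel of the relations on the V-part,
    and z. *)
Section ThinDestabilized.
Variables (k : closedFieldType) (Q : quiver) (t : vertex Q -> nat) (T : rep k t).
Hypothesis hT : ext1_eq0 T T.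
Local Notation Qh := (ope t).
Variables (x e e' : vertex Qh -> nat).
Local Notation TI := {i : vertex Q & 'I_(t i)}.
Local Notation L1 s x := (@mxfam k TI (fun=> s) (fun q => x (Some (tag q)))).
Local Notation L2 s x := (@mxfam k (rel_index t) (fun=> s) (fun r => x (Some (tgt (tag r))))).
Local Notation dim1 s x := (#|@entry_index TI (fun=> s) (fun q => x (Some (tag q)))|).
Local Notation dim2 s x :=
  (#|@entry_index (rel_index t) (fun=> s) (fun r => x (Some (tgt (tag r))))|).
Local Notation modfam u v :=
  (@mxfam k (arrow Q) (fun a => u (Some (src a))) (fun a => v (Some (tgt a)))).

(** A representation with relations, moved in the direction f off the relations. *)
Definition perturb (N : rep k x) (f : L1 (x None) x) : rep k x := fun b =>
  match b as b return 'M[k]_(x (@src Qh b), x (@tgt Qh b)) with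
  | inl a => N (inl a) | inr q => N (inr q) + f q end.

(** Once the Q-part M is fixed, the relations are linear in the V-part. *)
Definition relmx s y (M : modfam y y) : 'M[k]_(dim1 s y, dim2 s y) :=
  fammx (relmap (s := s) (x := fun i => y (Some i)) T M).

Definition mixmap (C : modfam e' e) (g : L1 (e' None) e') : L2 (e' None) e :=
  fun r => tfam_at (x := fun i => e' (Some i)) g (tagged r) *m C (tag r).

(** The relations on block triangular V-parts, ordered as sub, mixed, quotient. Only
    the quotient block contributes through C, to the mixed relations. *)
Definition tri_relmx (A : modfam e e) (C : modfam e' e) (D : modfam e' e') :=
  block_mx (block_mx (relmx (e None) A) 0 0 (relmx (e' None) A)) 0
    (row_mx 0 (fammx (mixmap C))) (relmx (e' None) D).

Lemma mixmap_linear C : linfam (mixmap C).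
Proof. by move=> a F G r; rewrite /mixmap {1}/tfam_at mulmxDl -scalemxAl. Qed.

Definition Ntri := (dim1 (e None) e + dim1 (e' None) e + dim1 (e' None) e')%N.
Definition ltri := (dim2 (e None) e + dim2 (e' None) e + dim2 (e' None) e')%N.

Lemma rank_relmx s y (A : rep k y) : sat_rel T A -> fsurj A ->
  \rank (relmx s (omod A)) = dim2 s y.
Proof.
by move=> relA sA; apply: fammx_surj; [apply: relmap_linear|apply: relmap_surj].
Qed.

(** Because both the submodule and the quotient are generated by their V-parts, the
    relations are independent; so the kernel has the expected dimension. *)
Lemma rank_tri_relmx (A : rep k e) (D : rep k e') C :
  sat_rel T A -> fsurj A -> sat_rel T D -> fsurj D ->
  \rank (tri_relmx (omod A) C (omod D)) = ltri.
Proof.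
move=> relA sA relD sD; apply/eqP; apply: row_full_block_lower; last first.
  by apply/eqP; apply: rank_relmx.
by apply: row_full_block_lower; apply/eqP; apply: rank_relmx.
Qed.

Lemma relmx0 s y (M : modfam y y) (g : L1 s y) :
  (forall r, relmap (x := fun i => y (Some i)) T M g r = 0) -> vec g *m relmx s M = 0.
Proof.
by move=> g0; rewrite -fammxE; [apply/vec0P|apply: relmap_linear].
Qed.

Definition trivec (yA : L1 (e None) e) (yC : L1 (e' None) e) (yD : L1 (e' None) e') :
  'rV[k]_Ntri := row_mx (row_mx (vec yA) (vec yC)) (vec yD).

Lemma tri_relmx0 (A : rep k e) (D : rep k e')
    (C : @mxfam k (arrow Qh) (fun b => e' (src b)) (fun b => e (tgt b))) :
  sat_rel T (ext_rep A D C) -> sat_rel T A -> sat_rel T D ->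
  trivec (tpart A) (tpart C) (tpart D) *m
    tri_relmx (omod A) (fun a => C (oarr t a)) (omod D) = 0.
Proof.
move=> relB relA relD.
have hA : vec (tpart (A : @mxfam _ _ _ _)) *m relmx (e None) (omod A) = 0.
  by apply: relmx0; apply: (sat_relE T A).1.
have hD : vec (tpart (D : @mxfam _ _ _ _)) *m relmx (e' None) (omod D) = 0.
  by apply: relmx0; apply: (sat_relE T D).1.
rewrite /trivec /tri_relmx !mul_row_block !mulmx0 !addr0 add0r hA hD.
rewrite mul_mx_row mulmx0 add_row_mx addr0.
suff -> : vec (tpart C) *m relmx (e' None) (omod A) +
    vec (tpart D) *m fammx (mixmap (fun a => C (oarr t a))) = 0 by rewrite addr0 !row_mx0.
rewrite -!fammxE; [|exact: mixmap_linear|exact: relmap_linear].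
rewrite -vecD; apply/vec0P => -[a u].
pose l : 'M[k]_(e' None, e None + e' None) := row_mx 0 1%:M.
pose r : 'M[k]_(e (Some (tgt a)) + e' (Some (tgt a)), e (Some (tgt a))) := col_mx 1%:M 0.
have := congr1 (fun M => l *m M *m r) (relB a u).
rewrite /l /r mulmx_sumr mulmx_suml.
have tE i (v : 'I_(t i)) : row_mx 0 1%:M *m tvec (ext_rep A D C) v =
    row_mx (C (vec_arr v)) (tvec D v).
  by rewrite /tvec /ext_rep mul_row_block !mul0mx !mul1mx !add0r.
rewrite mulmxA tE -mulmxA /omod /ext_rep mul_block_col !mulmx1 !mulmx0 !addr0.
rewrite mul_row_col => eq.
rewrite /mixmap /relmap /= addrAC; apply/eqP; rewrite subr_eq0; apply/eqP.
apply: (etrans eq).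
apply: eq_bigr => v _; rewrite -scalemxAr -scalemxAl tE mul_row_col mulmx1 mulmx0 addr0.
by [].
Qed.


Variable S : 'M[k]_(dim2 (x None) x, dim1 (x None) x).

Local Notation m := (Ntri - ltri)%N.
Local Notation Jw := (@entry_index (vertex Qh) e e').
Local Notation JA := (@entry_index (arrow Q) (fun a => e (Some (src a))) (fun a => e (Some (tgt a)))).
Local Notation JC := (@entry_index (arrow Q) (fun a => e' (Some (src a))) (fun a => e (Some (tgt a)))).
Local Notation JD := (@entry_index (arrow Q) (fun a => e' (Some (src a))) (fun a => e' (Some (tgt a)))).
Local Notation J := (Jw + JA + JC + JD + 'I_m + 'I_(dim2 (x None) x))%type.

Definition par_w (v : J -> k) := famof (fun c : Jw => inl (inl (inl (inl (inl c)))) : J) v.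
Definition par_A (v : J -> k) : modfam e e := famof (fun c : JA => inl (inl (inl (inl (inr c)))) : J) v.
Definition par_C (v : J -> k) : modfam e' e := famof (fun c : JC => inl (inl (inl (inr c))) : J) v.
Definition par_D (v : J -> k) : modfam e' e' := famof (fun c : JD => inl (inl (inr c)) : J) v.
Definition par_phi (v : J -> k) : 'rV[k]_m := \row_c v (inl (inr c)).
Definition par_z (v : J -> k) : 'rV[k]_(dim2 (x None) x) := \row_c v (inr c).

Definition chartP (pi : forall j, {ffun 'I_(e j + e' j) -> 'I_(x j)}) (w : mxfam k e e') j :
  'M[k]_(e j + e' j, x j) := block_mx 1%:M (w j) 0 1%:M *m chart_mx k (pi j).
(** The inverse of chartP when the pi j are the bijections of chart_ex. *)
Definition chartR (pi : forall j, {ffun 'I_(e j + e' j) -> 'I_(x j)}) (w : mxfam k e e') j :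
  'M[k]_(x j, e j + e' j) := (chart_mx k (pi j))^T *m block_mx 1%:M (- w j) 0 1%:M.

Definition tri_rep (w : mxfam k e e') pi (A : modfam e e) (C : modfam e' e) (D : modfam e' e')
    (y : 'rV[k]_Ntri) : rep k x := fun b =>
  match b as b return 'M[k]_(x (@src Qh b), x (@tgt Qh b)) with
  | inl a => chartR pi w (Some (src a)) *m block_mx (A a) 0 (C a) (D a)
               *m chartP pi w (Some (tgt a))
  | inr q => chartR pi w None *m block_mx (unvec (lsubmx (lsubmx y)) q) 0
               (unvec (rsubmx (lsubmx y)) q) (unvec (rsubmx y) q)
               *m chartP pi w (Some (tag q))
  end.

Definition destab_chart (pi : forall j, {ffun 'I_(e j + e' j) -> 'I_(x j)})
    (sigma : {ffun 'I_(ltri + m) -> 'I_Ntri}) (v : J -> k) : rep k x :=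
  perturb (tri_rep (par_w v) pi (par_A v) (par_C v) (par_D v)
      (kernel_chart sigma (tri_relmx (par_A v) (par_C v) (par_D v)) (par_phi v)))
    (unvec (par_z v *m S)).

Lemma polymx_destab_chart pi sigma b :
  polymx (@fun_coord k J) (fun v => destab_chart pi sigma v b).
Proof.
have pw j : polymx (@fun_coord k J) (fun v => par_w v j) by apply: polymx_famof.
have pA a : polymx (@fun_coord k J) (fun v => par_A v a) by apply: polymx_famof.
have pC a : polymx (@fun_coord k J) (fun v => par_C v a) by apply: polymx_famof.
have pD a : polymx (@fun_coord k J) (fun v => par_D v a) by apply: polymx_famof.
have pphi : polymx (@fun_coord k J) par_phi.
  move=> i j; apply: (@polyfun_ext _ _ _ (fun v => v (inl (inr j)))) => [v|]; first by rewrite mxE.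
  by apply: polyfun_coord; eexists.
have pz : polymx (@fun_coord k J) par_z.
  move=> i j; apply: (@polyfun_ext _ _ _ (fun v => v (inr j))) => [v|]; first by rewrite mxE.
  by apply: polyfun_coord; eexists.
have pP j : polymx (@fun_coord k J) (fun v => chartP pi (par_w v) j).
  apply: polymx_mul; last exact: polymx_const.
  by apply: polymx_block => //; apply: polymx_const.
have pR j : polymx (@fun_coord k J) (fun v => chartR pi (par_w v) j).
  apply: polymx_mul; first exact: polymx_const.
  by apply: polymx_block => //; try apply: polymx_const; apply: polymx_opp.
have prel s y (M : (J -> k) -> modfam y y) :
    (forall a, polymx (@fun_coord k J) (fun v => M v a)) ->
    polymx (@fun_coord k J) (fun v => relmx s (M v)).
  move=> pM; apply: polymx_fammx => F r; apply: polymx_add; last exact: polymx_const.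
  by apply: polymx_mul; first exact: polymx_const.
have pK : polymx (@fun_coord k J) (fun v => tri_relmx (par_A v) (par_C v) (par_D v)).
  apply: polymx_block; [|exact: polymx_const| |exact: prel].
    by apply: polymx_block; [apply: prel|apply: polymx_const|apply: polymx_const|apply: prel].
  apply: polymx_row; first exact: polymx_const.
  apply: polymx_fammx => F r; apply: polymx_mul; first exact: polymx_const.
  exact: pC.
set ky := fun v => kernel_chart sigma (tri_relmx (par_A v) (par_C v) (par_D v)) (par_phi v).
have py : polymx (@fun_coord k J) ky by apply: polymx_kernel_chart.
case: b => [a|q].
  apply: polymx_mul; last exact: pP.
  apply: polymx_mul; first exact: pR.
  by apply: polymx_block => //; apply: polymx_const.
apply: polymx_add; last first.
  have pzS : polymx (@fun_coord k J) (fun v => par_z v *m S).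
    by apply: polymx_mul => //; apply: polymx_const.
  by move=> i j; apply: polyfun_ext (pzS 0 _) => v; rewrite [RHS]mxE.
apply: polymx_mul; last exact: pP.
apply: polymx_mul; first exact: pR.
apply: polymx_block; [|exact: polymx_const| |] => i j.
- apply: (@polyfun_ext _ _ _ (fun v => ky v 0 (lshift _ (lshift _ (enum_rank (Tagged _ (i, j))))))); last exact: py.
  by move=> v; rewrite [RHS]mxE [RHS]mxE [RHS]mxE.
- apply: (@polyfun_ext _ _ _ (fun v => ky v 0 (lshift _ (rshift _ (enum_rank (Tagged _ (i, j))))))); last exact: py.
  by move=> v; rewrite [RHS]mxE [RHS]mxE [RHS]mxE.
- apply: (@polyfun_ext _ _ _ (fun v => ky v 0 (rshift _ (enum_rank (Tagged _ (i, j)))))); last exact: py.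
  by move=> v; rewrite [RHS]mxE [RHS]mxE.
Qed.

Hypothesis dimx : forall j, x j = (e j + e' j)%N.

Lemma block_unipotent_mul n1 n2 (w : 'M[k]_(n1, n2)) :
  block_mx 1%:M w 0 1%:M *m block_mx 1%:M (- w) 0 1%:M = 1%:M.
Proof.
rewrite mulmx_block !mulmx1 !mul1mx !mulmx0 !mul0mx !addr0 !add0r addNr.
by rewrite -scalar_mx_block.
Qed.

(** Adapt bases to the submodule, in a chart of the Grassmannian at each vertex; the
    V-part then lies in the kernel of tri_relmx. *)
Lemma destab_chart_cover (N : rep k x) (A0 : rep k e) (D0 : rep k e') z :
  sat_rel T N -> fsurj N -> ses N A0 D0 -> fsurj A0 ->
  exists pi sigma v, perturb N (unvec (z *m S)) = destab_chart pi sigma v.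
Proof.
move=> relN sN ses0 sA0.
have /fin_all_exists[pi piP] j := chart_ex (ses_sub_free ses0 j) (dimx j).
pose X j := lsubmx (ses_i ses0 j *m (chart_mx k (pi j))^T).
pose w : mxfam k e e' := fun j => invmx (X j) *m rsubmx (ses_i ses0 j *m (chart_mx k (pi j))^T).
pose P := chartP pi w; pose R := chartR pi w.
have PR j : P j *m R j = 1%:M.
  have [h _ _] := piP j; rewrite /P /R /chartP /chartR mulmxA -(mulmxA _ _ _^T) h mulmx1.
  exact: block_unipotent_mul.
have RP j : R j *m P j = 1%:M.
  have [_ h _] := piP j; have := block_unipotent_mul (- w j); rewrite opprK => uu.
  by rewrite /P /R /chartP /chartR mulmxA -(mulmxA _^T) uu mulmx1.
pose P1 j := usubmx (P j); pose P2 j := dsubmx (P j).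
pose R1 j := lsubmx (R j); pose R2 j := rsubmx (R j).
have PRb j : [/\ P1 j *m R1 j = 1%:M, P1 j *m R2 j = 0, P2 j *m R1 j = 0 & P2 j *m R2 j = 1%:M].
  have := PR j; rewrite -[P j]vsubmxK -[R j]hsubmxK mul_col_row scalar_mx_block.
  by move=> /eq_block_mx[].
have RPb j : R1 j *m P1 j + R2 j *m P2 j = 1%:M.
  by rewrite -(RP j) -[P j in RHS]vsubmxK -[R j in RHS]hsubmxK mul_row_col.
have XP1 j : X j *m P1 j = ses_i ses0 j.
  have [_ h u] := piP j.
  have -> : P1 j = row_mx 1%:M (w j) *m chart_mx k (pi j).
    by rewrite /P1 /P /chartP block_mxEv mul_col_mx col_mxKu.
  rewrite mulmxA mul_mx_row mulmx1 /w mulKVmx //.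
  by rewrite hsubmxK -mulmxA h mulmx1.
have [PE RE] : P = chartP pi w /\ R = chartR pi w by [].
clearbody P R.
pose B : rep k (fun j => e j + e' j)%N := fun b => P (src b) *m N b *m R (tgt b).
pose A : rep k e := fun b => P1 (src b) *m N b *m R1 (tgt b).
pose C : @mxfam k (arrow Qh) (fun b => e' (src b)) (fun b => e (tgt b)) :=
  fun b => P2 (src b) *m N b *m R1 (tgt b).
pose D : rep k e' := fun b => P2 (src b) *m N b *m R2 (tgt b).
have hA0 b : X (src b) *m P1 (src b) *m N b = A0 b *m X (tgt b) *m P1 (tgt b).
  by rewrite -[in RHS]mulmxA !XP1 (ses_ihom ses0).
have ur0 b : P1 (src b) *m N b *m R2 (tgt b) = 0.
  have [_ _ u] := piP (src b).
  apply: (can_inj (mulKmx u)); rewrite !mulmxA hA0 mulmx0 -(mulmxA (A0 b *m _)).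
  by have [_ -> _ _] := PRb (tgt b); rewrite mulmx0.
have BE : B = ext_rep A D C.
  apply: functional_extensionality_dep => b; rewrite /B /ext_rep.
  rewrite -[P _]vsubmxK -[R _]hsubmxK mul_col_mx mul_col_row.
  by rewrite -/(P1 _) -/(P2 _) -/(R1 _) -/(R2 _) ur0.
have homA : is_hom A N P1.
  move=> b; rewrite /A -mulmxA -[RHS]mulmx1 -(RPb (tgt b)) mulmxDr !mulmxA ur0 mul0mx addr0.
  by rewrite -!mulmxA.
have homD : is_hom N D R2.
  move=> b; rewrite /D !mulmxA -[N b in LHS]mul1mx -(RPb (src b)) !mulmxDl.
  by rewrite -!mulmxA (mulmxA (P1 _)) ur0 mulmx0 add0r.
have P1free j : row_free (P1 j) by have [h _ _ _] := PRb j; apply: row_free_r h.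
have R2full j : row_full (R2 j) by have [_ _ _ h] := PRb j; apply: row_full_l h.
have relA : sat_rel T A := sat_rel_sub homA P1free relN.
have relD : sat_rel T D := sat_rel_quo homD R2full relN.
have sD : fsurj D := fsurj_quo homD R2full sN.
have homX : is_hom A0 A X.
  move=> b; apply: (row_free_inj (P1free (tgt b))).
  by rewrite -hA0 -[in RHS]mulmxA homA mulmxA.
have sA : fsurj A.
  by apply: fsurj_quo homX _ sA0 => j; have [_ _ u] := piP j; rewrite row_full_unit.
have relB : sat_rel T (ext_rep A D C).
  have hB : is_hom (ext_rep A D C) N P.
    move=> b; rewrite -BE -[B b]/(P (src b) *m N b *m R (tgt b)).
    by rewrite -(mulmxA (P _ *m N b)) RP mulmx1.
  by apply: sat_rel_sub hB _ relN => j; apply: row_free_r (PR j).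
have NE b : N b = R (src b) *m block_mx (A b) 0 (C b) (D b) *m P (tgt b).
  rewrite -[block_mx _ _ _ _]/(ext_rep A D C b) -BE -[B b]/(P (src b) *m N b *m R (tgt b)).
  by rewrite !mulmxA RP mul1mx -(mulmxA (N b)) RP mulmx1.
have rk := rank_tri_relmx (fun a => C (oarr t a)) relA sA relD sD.
have Nl : Ntri = (ltri + m)%N by rewrite subnKC // -rk rank_leq_row.
have [sigma [phi yE]] := kernel_chart_cover Nl rk (tri_relmx0 relB relA relD).
pose v (j : J) : k := match j with
  | inl (inl (inl (inl (inl c)))) => w (tag c) (tagged c).1 (tagged c).2
  | inl (inl (inl (inl (inr c)))) => omod A (tag c) (tagged c).1 (tagged c).2
  | inl (inl (inl (inr c))) => C (oarr t (tag c)) (tagged c).1 (tagged c).2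
  | inl (inl (inr c)) => omod D (tag c) (tagged c).1 (tagged c).2
  | inl (inr c) => phi 0 c
  | inr c => z 0 c end.
exists pi, sigma, v.
have vw : par_w v = w by apply: famofK.
have vA : par_A v = omod A by apply: famofK.
have vC : par_C v = fun a => C (oarr t a) by apply: famofK.
have vD : par_D v = omod D by apply: famofK.
have vphi : par_phi v = phi by apply/rowP => c; rewrite mxE.
have vz : par_z v = z by apply/rowP => c; rewrite mxE.
rewrite /destab_chart vw vA vC vD vphi vz -yE; congr perturb.
apply: functional_extensionality_dep => -[a|q]; rewrite NE PE RE //.
by rewrite /tri_rep /trivec !row_mxKl !row_mxKr !vecK.
Qed.

(** The number of parameters falls short of the dimension of the ambient space by
    exactly - chi e e'. *)
Lemma card_destab_chart : chi e e' < 0 -> (ltri <= Ntri)%N ->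
  (#|{: J}| < #|@entry_index (arrow Qh) (fun b => x (src b)) (fun b => x (tgt b))|)%N.
Proof.
have sumB (F : arrow Qh -> nat) : (\sum_b F b = \sum_a F (inl a) + \sum_q F (inr q))%N.
  by rewrite big_sumType.
have sumX (I : finType) (F G : I -> vertex Qh) :
    (\sum_i x (F i) * x (G i) = \sum_i e (F i) * e (G i) + \sum_i e (F i) * e' (G i)
      + \sum_i e' (F i) * e (G i) + \sum_i e' (F i) * e' (G i))%N.
  by rewrite -!big_split; apply: eq_bigr => i _; rewrite !dimx /=; lia.
rewrite /chi /Ntri /ltri subr_lt0 ltz_nat !card_sum !card_ord !card_entry_index !sumB !sumX /=.
set b1 := (\sum_r e None * e _)%N; set b2 := (\sum_r e' None * e _)%N.
set b3 := (\sum_r e' None * e' _)%N; set b4 := (\sum_r e None * e' _)%N.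
set c1 := (\sum_q e None * e (Some (tag q)))%N; set c2 := (\sum_q e' None * e (Some (tag q)))%N.
set c3 := (\sum_q e' None * e' (Some (tag q)))%N; set c4 := (\sum_q e None * e' (Some (tag q)))%N.
set a1 := (\sum_j _)%N; set a2 := (\sum_a _)%N; set a3 := (\sum_a _)%N; set a4 := (\sum_a _)%N.
set a5 := (\sum_a _)%N.
by lia.
Qed.

End ThinDestabilized.

Lemma thin_empty (k : closedFieldType) (X : finType) (m n : X -> nat) (Z : mxfam k m n -> Prop) :
  (forall y, ~ Z y) -> thin Z.
Proof.
move=> Z0; exists (fun=> 1); split; first exact: polyfun_const.
  by exists (fun=> 0); apply: oner_neq0.
by move=> y /Z0.
Qed.

(** The S-directions supply the dimension that the relations cut out, so the count can
    be made in the affine space of all representations instead of the variety of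
    modules. *)
Lemma thin_destabilized (k : closedFieldType) (Q : quiver) (t : vertex Q -> nat) (T : rep k t)
    (x e e' : vertex (ope t) -> nat)
    (S : 'M[k]_(#|@entry_index (rel_index t) (fun=> x None) (fun r => x (Some (tgt (tag r))))|,
      #|@entry_index {i : vertex Q & 'I_(t i)} (fun=> x None) (fun q => x (Some (tag q)))|)) :
  ext1_eq0 T T -> chi e e' < 0 ->
  thin (fun Y : rep k x => exists N z, [/\ sat_rel T N, fsurj N,
    (exists (A : rep k e) (D : rep k e'), inhabited (ses N A D) /\ fsurj A) &
    Y = perturb N (unvec (z *m S))]).
Proof.
move=> hT neg; set Z := (X in thin X).
case: (classic (exists Y, Z Y)) => [[Y [N [z [relN sN [A [D [[ses0] sA]]] _]]]]|Z0]; last first.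
  by apply: thin_empty => Y ZY; apply: Z0; exists Y.
have dimx := ses_dim ses0.
have relA : sat_rel T A := sat_rel_sub (ses_ihom ses0) (ses_sub_free ses0) relN.
have relD : sat_rel T D := sat_rel_quo (ses_phom ses0) (ses_quo_full ses0) relN.
have sD : fsurj D := fsurj_quo (ses_phom ses0) (ses_quo_full ses0) sN.
have le : (ltri e e' <= Ntri e e')%N.
  by rewrite -(rank_tri_relmx hT (fun=> 0) relA sA relD sD) rank_leq_row.
pose L := ({dffun forall j, {ffun 'I_(e j + e' j) -> 'I_(x j)}} *
  {ffun 'I_(ltri e e' + (Ntri e e' - ltri e e')) -> 'I_(Ntri e e')})%type.
apply: (@thin_sub _ _ _ _ _ (fun Y => exists l : L, exists v, Y = destab_chart T S l.1 l.2 v)).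
  move=> _ [M [u [relM sM [B [E [[sesM] sB]]] ->]]].
  have [pi [sigma [v ->]]] := destab_chart_cover hT S dimx u relM sM sesM sB.
  have piE : (fun j => (finfun pi : {dffun forall j, {ffun 'I_(e j + e' j) -> 'I_(x j)}}) j) = pi.
    by apply: functional_extensionality_dep => j; rewrite ffunE.
  by exists (finfun pi, sigma), v; rewrite -{1}piE.
apply: thin_bigU => l; apply: thin_image; first exact: polymx_destab_chart.
exact: card_destab_chart.
Qed.

(** * Harder-Narasimhan types of generic modules *)

Section Generic.
Variables (k : closedFieldType) (Q : quiver) (t : vertex Q -> nat) (T : rep k t).
Hypothesis hT : ext1_eq0 T T.
Local Notation Qh := (ope t).
Variable x : vertex Qh -> nat.
Local Notation Y := (rep k x).
Local Notation C := (@fam_coord k (arrow Qh) (fun b => x (src b)) (fun b => x (tgt b))).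
Local Notation tfam := (@mxfam k {i : vertex Q & 'I_(t i)} (fun=> x None) (fun q => x (Some (tag q)))).

Local Notation lift_mx := 'M[k]_(
  #|@entry_index (rel_index t) (fun=> x None) (fun r => x (Some (tgt (tag r))))|,
  #|@entry_index {i : vertex Q & 'I_(t i)} (fun=> x None) (fun q => x (Some (tag q)))|).

Definition with_tfam (N : Y) (f : tfam) : Y := fun b =>
  match b as b return 'M[k]_(x (@src Qh b), x (@tgt Qh b)) with
  | inl a => N (inl a) | inr q => f q end.

(** S is a section of the relations at N1, so delta(N') = det (S K(N')) is nonzero near
    N1. There the tuple g of the V-part splits as f + z S with z = g K (S K)^-1 and
    f K = 0, and h = delta f is polynomial. The function psi also contains
    determinants that test that f is surjective. *)
Lemma generic_normal_form (N1 : Y) : sat_rel T N1 -> fsurj N1 ->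
  exists (S : lift_mx) psi, [/\ polyfun C psi, psi N1 != 0 &
    forall N' : Y, psi N' != 0 -> exists N z,
      [/\ sat_rel T N, fsurj N & N' = perturb N (unvec (z *m S))]].
Proof.
move=> rel1 s1; pose K (N : Y) := relmx T (x None) (omod N).
have /row_fullP[S SK1] : row_full (K N1) by apply/eqP; apply: rank_relmx.
have /fin_all_exists[R RN] := s1.
pose g (N : Y) := vec (tpart (N : @mxfam _ _ _ _)).
pose delta N := \det (S *m K N).
pose h N := delta N *: g N - g N *m K N *m \adj (S *m K N) *m S.
pose hat (N : Y) i (u : 'I_(t i)) := tfam_at (x := fun i => x (Some i)) (unvec (h N)) u.
pose psi N := delta N * \prod_i \det (\sum_u R i u *m hat N i u).
exists S, psi; split.
- have pO a : polymx C (fun N : Y => omod N a).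
    by move=> i j; apply: polyfun_coord; exists (inl a), i, j.
  have pK : polymx C K.
    apply: polymx_fammx => F r; apply: polymx_add; last exact: polymx_const.
    by apply: polymx_mul; [apply: polymx_const|apply: pO].
  have pSK : polymx C (fun N => S *m K N) by apply: polymx_mul; first exact: polymx_const.
  have pg : polymx C g.
    move=> i j; apply: polyfun_coord; pose e := enum_val j.
    exists (inr (tag e)), (tagged e).1, (tagged e).2.
    by apply: functional_extensionality => N; rewrite mxE.
  have ph : polymx C h.
    apply: polymx_add; first by apply: polymx_scale => //; apply: polyfun_det.
    apply: polymx_opp; apply: polymx_mul; last exact: polymx_const.
    by apply: polymx_mul; [apply: polymx_mul|apply: polymx_adj].
  apply: polyfun_mul; first exact: polyfun_det.
  apply: polyfun_prod => i _; apply: polyfun_det; apply: polymx_sum => u _.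
  apply: polymx_mul; first exact: polymx_const.
  by move=> a b; apply: polyfun_ext (ph 0 _) => N; rewrite [RHS]mxE.
- have gK : g N1 *m K N1 = 0 by apply: relmx0; apply: (sat_relE T N1).1.
  have d1 : delta N1 = 1 by rewrite /delta SK1 det1.
  have hg : h N1 = g N1 by rewrite /h gK !mul0mx subr0 d1 scale1r.
  rewrite /psi d1 mul1r; apply/prodf_neq0 => i _.
  rewrite (_ : \sum_u _ = 1%:M) ?det1 ?oner_neq0 // -(RN i).
  by apply: eq_bigr => u _; rewrite /hat hg vecK.
move=> N; rewrite /psi mulf_eq0 negb_or => /andP[dn0 /prodf_neq0 pn0].
pose f : tfam := unvec ((delta N)^-1 *: h N).
pose N0 := with_tfam N f.
have unitSK : S *m K N \in unitmx by rewrite unitmxE unitfE.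
have hK : h N *m K N = 0.
  rewrite /h mulmxBl -scalemxAl -(mulmxA _ S) -(mulmxA _ (\adj _)) mul_adj_mx.
  by rewrite mul_mx_scalar subrr.
exists N0, ((delta N)^-1 *: (g N *m K N *m \adj (S *m K N))); split.
- apply/sat_relE => r.
  have : vec (relmap (x := fun i => x (Some i)) T (omod N0) (tpart (N0 : @mxfam _ _ _ _))) = 0.
    rewrite fammxE; last exact: relmap_linear.
    rewrite -[X in vec X]/f /f unvecK -scalemxAl.
    by rewrite -[fammx _]/(K N) hK scaler0.
  by move/vec0P.
- move=> i; exists (fun u => delta N *: (invmx (\sum_u R i u *m hat N i u) *m R i u)).
  have unitR : (\sum_u R i u *m hat N i u) \in unitmx by rewrite unitmxE unitfE pn0.
  rewrite -[RHS](mulVmx unitR) mulmx_sumr; apply: eq_bigr => u _.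
  rewrite -scalemxAl scalemxAr -mulmxA; congr (_ *m (_ *m _)).
  rewrite -[tvec N0 u]/(tfam_at (x := fun i => x (Some i)) f u) /tfam_at /f unvecZ.
  by rewrite scalerA divff // scale1r.
apply: functional_extensionality_dep => -[a|q] //=.
rewrite -unvecD -scalemxAl -scalerDr subrK scalerA mulVf // scale1r.
by rewrite /g vecK.
Qed.

(** Only finitely many dimension vectors e occur, so the modules with a submodule such
    that chi e e' < 0 form a thin set. *)
Lemma generic_sub_chi_ge0 (N1 : Y) : sat_rel T N1 -> fsurj N1 ->
  exists N : Y, [/\ sat_rel T N, fsurj N &
    forall e e' (A : rep k e) (D : rep k e'), ses N A D -> fsurj A -> 0 <= chi (t := t) e e'].
Proof.
move=> rel1 s1; have [S [psi [ppsi psi1 psiP]]] := generic_normal_form rel1 s1.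
pose b := (\max_j x j).+1; pose L : finType := {ffun vertex Qh -> 'I_b}.
pose de (l : L) j : nat := l j; pose dq (l : L) j := (x j - l j)%N.
pose Z (l : L) (N' : Y) := chi (t := t) (de l) (dq l) < 0 /\ exists N z,
  [/\ sat_rel T N, fsurj N, (exists (A : rep k (de l)) (D : rep k (dq l)),
    inhabited (ses N A D) /\ fsurj A) & N' = perturb N (unvec (z *m S))].
have thinZ l : thin (Z l).
  case: (ltrP (chi (t := t) (de l) (dq l)) 0) => neg; last first.
    by apply: thin_empty => N' []; rewrite ltNge neg.
  by apply: thin_sub (thin_destabilized S hT neg) => N' [].
have [N' nz notZ] := thin_meets (thin_bigU thinZ) ppsi psi1.
have [N [z [relN sN N'E]]] := psiP N' nz.
exists N; split=> // e e' A D S0 sA; rewrite leNgt; apply/negP => neg; apply: notZ.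
have dimx := ses_dim S0.
have lt j : (e j < b)%N.
  by rewrite ltnS (leq_trans _ (leq_bigmax_cond (F := x) j isT)) // dimx leq_addr.
pose l : L := [ffun j => Ordinal (lt j)].
have lE : de l = e by apply: functional_extensionality => j; rewrite /de ffunE.
have lE' : dq l = e'.
  by apply: functional_extensionality => j; rewrite /dq ffunE /= dimx addKn.
exists l; rewrite /Z lE lE'; split=> //; exists N, z; split=> //.
by exists A, D.
Qed.

Lemma generic_HN_zero (N1 : Y) : (0 < x None)%N -> sat_rel T N1 -> fsurj N1 ->
  exists h, [/\ hn_list T h, h <> [::], forall j, dimsum h j = x j &
    forall n l, (n < l < size h)%N ->
      chi (t := t) (nth (fun=> 0%N) h n) (nth (fun=> 0%N) h l) = 0].
Proof.
move=> x0 rel1 s1; have [N [relN sN chiN]] := generic_sub_chi_ge0 rel1 s1.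
have [h [hl hn hd hS]] := HN_exists (leqnn _) relN sN x0.
exists h; split=> //; case: (hn_list_split hT hl) => // -[p neg].
have [eA [eD [A [D [eAE eDE [S] sA]]]]] := hS p.
have := chiN _ _ _ _ S sA; rewrite leNgt.
have -> : eA = dimsum (take p h) by apply: functional_extensionality.
have -> : eD = dimsum (drop p h) by apply: functional_extensionality.
by rewrite neg.
Qed.

End Generic.

(** * Leading coefficients of polynomial vectors *)

Section LinearPredicates.
Variable k : fieldType.

(** A predicate stable under linear combinations is membership in a row space; the
    matrix is reached by adding vectors as long as the rank increases. *)
Lemma linpred_mx n (P : 'rV[k]_n -> Prop) :
  P 0 -> (forall a u v, P u -> P v -> P (a *: u + v)) ->
  exists A : 'M[k]_n, forall v, (v <= A)%MS <-> P v.
Proof.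
move=> P0 PD.
suff grow m (A : 'M[k]_n) : (forall v, (v <= A)%MS -> P v) -> (n - \rank A <= m)%N ->
    exists A : 'M[k]_n, forall v, (v <= A)%MS <-> P v.
  by apply: (grow n 0) => [v|]; rewrite ?submx0 ?leq_subr // => /eqP->.
elim: m A => [|m IH] A AP le.
  exists A => v; split=> [/AP //|_]; apply: submx_full.
  by rewrite /row_full eqn_leq rank_leq_col -subn_eq0 -leqn0.
case: (classic (exists2 v, P v & ~~ (v <= A)%MS)) => [[v Pv nv]|nex]; last first.
  exists A => v; split=> [/AP //|Pv]; apply: NNPP => nv; apply: nex; exists v => //.
  exact/negP.
apply: (IH (A + v)%MS) => [u|].
  case/sub_addsmxP => -[a b] /= ->; have -> : b *m v = (b 0 0) *: v.
    by rewrite {1}[b]mx11_scalar mul_scalar_mx.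
  by rewrite addrC; apply: PD => //; apply: AP; apply: submxMl.
have lt : (\rank A < \rank (A + v)%MS)%N.
  rewrite ltnNge; apply: contra nv => le2.
  have : (A == A + v)%MS by rewrite -(geq_leqif (mxrank_leqif_eq (addsmxSl A v))).
  by move/eqmxP => ->; apply: addsmxSr.
by move: le (rank_leq_col (A + v)%MS); lia.
Qed.

(** Row vectors of length n * J encode row vectors of n polynomials of degree less
    than J. *)
Definition rowpoly n J (u : 'rV[k]_(n * J)) : 'rV[{poly k}]_n :=
  \row_i rVpoly (row i (vec_mx u)).
Definition rowpoly_inv n J (p : 'rV[{poly k}]_n) : 'rV[k]_(n * J) :=
  mxvec (\matrix_i poly_rV (p 0 i)).
Definition row_size_le n E (p : 'rV[{poly k}]_n) : Prop := forall i, (size (p 0%R i) <= E)%N.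
Definition row_coef m n E (p : 'M[{poly k}]_(m, n)) : 'M[k]_(m, n) := map_mx (coefp E) p.

Lemma rowpoly_invK n J (p : 'rV[{poly k}]_n) : row_size_le J p -> rowpoly (rowpoly_inv J p) = p.
Proof. by move=> sp; apply/rowP => i; rewrite !mxE mxvecK rowK poly_rV_K. Qed.

Lemma rowpolyK n J (u : 'rV[k]_(n * J)) : rowpoly_inv J (rowpoly u) = u.
Proof.
rewrite -[RHS]vec_mxK; congr mxvec; apply/row_matrixP => i.
by rewrite rowK mxE rVpolyK.
Qed.

Lemma row_size_rowpoly n J (u : 'rV[k]_(n * J)) : row_size_le J (rowpoly u).
Proof. by move=> i; rewrite mxE; apply: size_poly. Qed.

Lemma rowpolyD n J a (u v : 'rV[k]_(n * J)) :
  rowpoly (a *: u + v) = a%:P *: rowpoly u + rowpoly v.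
Proof.
apply/rowP => i; rewrite !mxE linearP /= linearP linearP /=.
by rewrite mul_polyC.
Qed.

Definition lead_space n (P : 'rV[{poly k}]_n -> Prop) E (v : 'rV[k]_n) : Prop :=
  exists p, [/\ P p, row_size_le E.+1 p & row_coef E p = v].

Definition poly_linear n (P : 'rV[{poly k}]_n -> Prop) : Prop :=
  P 0 /\ forall a p q, P p -> P q -> P (a%:P *: p + q).

Lemma row_coefD m n E a (p q : 'M[{poly k}]_(m, n)) :
  row_coef E (a%:P *: p + q) = a *: row_coef E p + row_coef E q.
Proof. by apply/matrixP => i j; rewrite !mxE /= coefD coefCM. Qed.

Lemma row_size_leD n E a (p q : 'rV[{poly k}]_n) :
  row_size_le E p -> row_size_le E q -> row_size_le E (a%:P *: p + q).
Proof.
move=> sp sq i; rewrite !mxE (leq_trans (size_polyD _ _)) // geq_max sq andbT.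
by rewrite mul_polyC (leq_trans (size_scale_leq _ _)).
Qed.

Lemma row_size_le0 n E : row_size_le E (0 : 'rV_n).
Proof. by move=> i; rewrite mxE size_poly0. Qed.

Lemma lead_space_mx n (P : 'rV[{poly k}]_n -> Prop) E : poly_linear P ->
  exists A : 'M[k]_n, forall v, (v <= A)%MS <-> lead_space P E v.
Proof.
move=> [P0 PD]; apply: linpred_mx => [|a u v [p [Pp sp <-]] [q [Pq sq <-]]].
  by exists 0; split=> //; [apply: row_size_le0|apply/rowP => i; rewrite !mxE /= coef0].
exists (a%:P *: p + q); split; [exact: PD|exact: row_size_leD|exact: row_coefD].
Qed.

(** Filter the polynomial vectors in P by degree: the coefficient of degree E
    identifies the E-th graded piece with the E-th space of leading coefficients. *)
Lemma lead_count r n J (P : 'rV[{poly k}]_n -> Prop) (U : 'M[k]_(r, n * J))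
    (A : nat -> 'M[k]_n) :
  poly_linear P -> (forall u, (u <= U)%MS <-> P (rowpoly u)) ->
  (forall E, (E < J)%N -> forall v, (v <= A E)%MS <-> lead_space P E v) ->
  \rank U = (\sum_(E < J) \rank (A E))%N.
Proof.
move=> [P0 PD] UP AP.
have rp0 : rowpoly (0 : 'rV[k]_(n * J)) = 0.
  by apply/rowP => i; rewrite !mxE linear0 row0 linear0.
have ex E : exists B : 'M[k]_(n * J), forall u, (u <= B)%MS <->
    P (rowpoly u) /\ row_size_le E (rowpoly u).
  apply: linpred_mx => [|a u v [Pu su] [Pv sv]]; rewrite ?rp0 ?rowpolyD.
    by split=> //; apply: row_size_le0.
  by split; [apply: PD|apply: row_size_leD].
have main m : (m <= J)%N -> forall r' (B : 'M[k]_(r', n * J)),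
    (forall u, (u <= B)%MS <-> P (rowpoly u) /\ row_size_le m (rowpoly u)) ->
    \rank B = (\sum_(E < m) \rank (A E))%N.
  elim: m => [|m IH] le r' B BP.
    rewrite big_ord0; apply/eqP; rewrite mxrank_eq0; apply/eqP/row_matrixP => i; rewrite row0.
    have /BP[_ s0] : (row i B <= B)%MS by apply: row_sub.
    rewrite -[LHS]rowpolyK (_ : rowpoly _ = 0); last first.
      by apply/rowP => j; have := s0 j; rewrite leqn0 size_poly_eq0 => /eqP ->; rewrite mxE.
    by rewrite -rp0 rowpolyK.
  have [B' BP'] := ex m; rewrite big_ord_recr /= -(IH (ltnW le) _ B') //.
  pose C := lin1_mx (fun u : 'rV[k]_(n * J) => row_coef m (rowpoly u)).
  have CE u : u *m C = row_coef m (rowpoly u).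
    have lin : linear (fun u : 'rV[k]_(n * J) => row_coef m (rowpoly u)).
      by move=> a v w; rewrite rowpolyD row_coefD.
    pose Lm := GRing.isLinear.Build _ _ _ _ _ lin.
    pose L : {linear 'rV[k]_(n * J) -> 'rV[k]_n} := HB.pack (fun u : 'rV[k]_(n * J) => row_coef m (rowpoly u)) Lm.
    by rewrite -[C]/(lin1_mx L) mul_rV_lin1.
  rewrite -(mxrank_mul_ker B C) addnC; congr (_ + _)%N.
    apply/eqP; rewrite eqn_leq; apply/andP; split; apply: mxrankS; apply/rV_subP => u.
      rewrite sub_capmx => /andP[/BP[Pu su] /sub_kermxP]; rewrite CE => c0.
      apply/BP'; split=> // i; have := su i; rewrite leq_eqVlt ltnS => /orP[/eqP si|//].
      have := congr1 (fun M : 'rV_n => M 0 i) c0; rewrite mxE [RHS]mxE /=.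
      set p := rowpoly u 0 i => pm; have : lead_coef p = 0 by rewrite lead_coefE si.
      by move/eqP; rewrite lead_coef_eq0 => /eqP ->; rewrite size_poly0.
    move=> /BP'[Pu su]; rewrite sub_capmx; apply/andP; split.
      by apply/BP; split=> // i; apply: leqW.
    apply/sub_kermxP; rewrite CE; apply/rowP => i; rewrite mxE [RHS]mxE.
    by rewrite /= nth_default.
  apply/eqP; rewrite eqn_leq; apply/andP; split; apply: mxrankS; apply/rV_subP => v.
    case/submxP => D ->; rewrite mulmxA CE; apply/(AP m le).
    have /BP[Pu su] : (D *m B <= B)%MS by apply: submxMl.
    by exists (rowpoly (D *m B)).
  case/(AP m le) => p [Pp sp <-].
  have sJ : row_size_le J p by move=> i; apply: leq_trans (sp i) le.
  have : (rowpoly_inv J p <= B)%MS by apply/BP; rewrite rowpoly_invK.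
  by move/(submxMr C); rewrite CE rowpoly_invK.
apply: main => // u; split=> [/UP Pu|[Pu _]]; last exact/UP.
by split=> //; apply: row_size_rowpoly.
Qed.

End LinearPredicates.

Section CommonSection.
Variable k : closedFieldType.

(** Two surjections of the same rank have a common section up to invertible matrices:
    each of the two determinants is nonzero at one end of the segment from S0 to S1. *)
Lemma common_section N l (A B : 'M[k]_(N, l)) : \rank A = l -> \rank B = l ->
  exists S : 'M[k]_(l, N), S *m A = 1%:M /\ S *m B \in unitmx.
Proof.
move=> /eqP/row_fullP[S0 S0A] /eqP/row_fullP[S1 S1B].
pose S (a : k) := (1 - a) *: S0 + a *: S1.
have polyS (M : 'M[k]_(N, l)) : exists P : {poly k}, forall a, \det (S a *m M) = P.[a].
  apply: (@polyfun_path _ _ (fun c => c = id) id (fun a => \det (S a *m M))).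
    by move=> c ->; exists 'X => a; rewrite hornerX.
  have pid : polyfun (fun c : k -> k => c = id) (fun a => a) by apply: polyfun_coord.
  apply: polyfun_det; apply: polymx_mul; last exact: polymx_const.
  apply: polymx_add; apply: polymx_scale => //; try exact: polymx_const.
  by apply: polyfun_add; [apply: polyfun_const|apply: polyfun_opp].
have [P PA] := polyS A; have [R RB] := polyS B.
have P0 : P != 0.
  have := PA 0; rewrite /S subr0 scale1r scale0r addr0 S0A det1 => P1.
  by apply/eqP => P0; move: P1; rewrite P0 horner0 => /eqP; rewrite oner_eq0.
have R0 : R != 0.
  have := RB 1; rewrite /S subrr scale1r scale0r add0r S1B det1 => R1.
  by apply/eqP => R0; move: R1; rewrite R0 horner0 => /eqP; rewrite oner_eq0.
have [a] := poly_nonroot (mulf_neq0 P0 R0).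
rewrite hornerM -PA -RB mulf_eq0 negb_or => /andP[nA nB].
have uA : S a *m A \in unitmx by rewrite unitmxE unitfE.
have uB : S a *m B \in unitmx by rewrite unitmxE unitfE.
exists (invmx (S a *m A) *m S a); rewrite -!mulmxA mulVmx //; split=> //.
by rewrite unitmx_mul uB unitmx_inv uA.
Qed.

Lemma size_det_poly n (M : 'M[{poly k}]_n) :
  (forall i j, (size (M i j) <= 2)%N) -> (size (\det M) <= n.+1)%N.
Proof.
move=> sM; rewrite /determinant; apply: leq_trans (size_sum _ _ _) _.
apply/bigmax_leqP => s _; rewrite -signr_odd.
have sp : (size (\prod_i M i (s i))%R <= n.+1)%N.
  apply: leq_trans (size_poly_prod_leq _ _) _.
  rewrite card_ord; have : (\sum_i size (M i (s i)) <= \sum_(i < n) 2)%N.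
    by apply: leq_sum.
  by rewrite sum_nat_const card_ord; lia.
case: (odd _); last by rewrite mul1r.
by rewrite expr1 mulN1r size_polyN.
Qed.

Lemma size_adj_char_poly n (A : 'M[k]_n) i j :
  (size (\adj (char_poly_mx A) i j) <= n)%N.
Proof.
rewrite mxE /cofactor; set d := \det _.
have sd : (size d <= n)%N.
  have := size_det_poly (M := row' j (col' i (char_poly_mx A))).
  rewrite (ltn_predK (ltn_ord i)); apply => a b; rewrite !mxE.
  apply: leq_trans (size_polyD _ _) _; rewrite size_polyN geq_max.
  rewrite (leq_trans (size_polyC_leq1 _)) // andbT.
  by case: (_ == _); rewrite ?mulr1n ?mulr0n ?size_polyX ?size_poly0.
rewrite -signr_odd; case: (odd _); last by rewrite mul1r.
by rewrite expr1 mulN1r size_polyN.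
Qed.

End CommonSection.

(** * Deforming a submodule along a curve *)

Section PolyMx.
Variable k : fieldType.
Implicit Types m n p : nat.

Lemma row_coef0M m n p (A : 'M[{poly k}]_(m, n)) (B : 'M_(n, p)) :
  row_coef 0 (A *m B) = row_coef 0 A *m row_coef 0 B.
Proof.
apply/matrixP => i j; rewrite !mxE /= coef_sum; apply: eq_bigr => l _.
by rewrite coef0M !mxE.
Qed.

Lemma row_coef_add m n E (A B : 'M[{poly k}]_(m, n)) :
  row_coef E (A + B) = row_coef E A + row_coef E B.
Proof. by apply/matrixP => i j; rewrite !mxE /= coefD. Qed.

Lemma row_coef_opp m n E (A : 'M[{poly k}]_(m, n)) : row_coef E (- A) = - row_coef E A.
Proof. by apply/matrixP => i j; rewrite !mxE /= coefN. Qed.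

Lemma row_coef_0 m n E : row_coef E (0 : 'M[{poly k}]_(m, n)) = 0.
Proof. by apply/matrixP => i j; rewrite !mxE /= coef0. Qed.

Lemma row_coef0_1 n : row_coef 0 (1%:M : 'M[{poly k}]_n) = 1%:M.
Proof.
by apply/matrixP => i j; rewrite !mxE /=; case: (_ == _); rewrite ?mulr1n ?mulr0n ?coef1 ?coef0.
Qed.

Lemma row_coef0_scale m n (a : {poly k}) (A : 'M[{poly k}]_(m, n)) :
  row_coef 0 (a *: A) = a`_0 *: row_coef 0 A.
Proof. by apply/matrixP => i j; rewrite !mxE /= coef0M. Qed.

Lemma row_coef_sum m n E (I : finType) (F : I -> 'M[{poly k}]_(m, n)) :
  row_coef E (\sum_i F i) = \sum_i row_coef E (F i).
Proof.
apply: (big_morph (row_coef E)); [exact: row_coef_add|exact: row_coef_0].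
Qed.

Definition constmx m n (A : 'M[k]_(m, n)) : 'M[{poly k}]_(m, n) := map_mx polyC A.

Lemma row_coef0_const m n (A : 'M[k]_(m, n)) : row_coef 0 (constmx A) = A.
Proof. by apply/matrixP => i j; rewrite !mxE /= coefC. Qed.

Lemma row_coef0_dvdX m n (A : 'M[{poly k}]_(m, n)) : row_coef 0 A = 0 ->
  exists B, A = 'X *: B.
Proof.
move=> A0; exists (map_mx (drop_poly 1) A); apply/matrixP => i j; rewrite !mxE.
have := congr1 (fun M : 'M_(_, _) => M i j) A0; rewrite !mxE /= => c0.
apply/polyP => l; rewrite mulrC coefMX coef_drop_poly.
by case: l => [|l]; rewrite ?c0 //= addn1.
Qed.

Lemma scaleXn_inj m n J (A B : 'M[{poly k}]_(m, n)) : 'X^J *: A = 'X^J *: B -> A = B.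
Proof.
move/matrixP => AB; apply/matrixP => i j; have := AB i j; rewrite !mxE.
by apply: mulfI; rewrite monic_neq0 // monicXn.
Qed.

End PolyMx.

(** N is a curve of modules through the direct sum of N1 and N2, over k[X]. The factor
    1 + X in the relation comes from the homogenization of the segment that joins the
    two Q-parts; it is a unit near X = 0. *)
Section Lattice.
Variables (k : closedFieldType) (Q : quiver) (t : vertex Q -> nat) (T : rep k t).
Local Notation Qh := (ope t).
Variables (e e' : vertex Qh -> nat).
Local Notation x := (fun j => e j + e' j)%N.
Variables (N1 : rep k e) (N2 : rep k e') (N0 : rep k x).
Hypothesis exactN : forall xi, (forall r, drel T N1 N2 xi r = 0) ->
  exists phi, forall b, dhom N1 N2 phi b = xi b.
Variable N : forall b : arrow Qh, 'M[{poly k}]_(x (src b), x (tgt b)).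
Hypothesis N_at0 : forall b, row_coef 0 (N b) = ext_rep N1 N2 (fun=> 0) b.
Hypothesis N_rel : forall (a : arrow Q) (u : 'I_(t (src a))),
  (N (vec_arr u) : 'M_(x None, x (Some (src a)))) *m N (oarr t a) =
  (1 + 'X) *: \sum_v (T a u v)%:P *: (N (vec_arr v) : 'M_(x None, x (Some (tgt a)))).

(** The rows of lrow w span the deformed submodule, the graph of w, and lcol w is the
    corresponding quotient map. *)
Definition lrow (w : forall j, 'M[{poly k}]_(e j, e' j)) j : 'M[{poly k}]_(e j, e j + e' j) :=
  row_mx 1%:M (w j).
Definition lcol (w : forall j, 'M[{poly k}]_(e j, e' j)) j : 'M[{poly k}]_(e j + e' j, e' j) :=
  col_mx (- w j) 1%:M.

Lemma lrow_lcol_id w j :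
  col_mx 1%:M 0 *m lrow w j + lcol w j *m row_mx 0 1%:M = 1%:M.
Proof.
rewrite !mul_col_row !mulmx1 !mul1mx !mul0mx !mulmx0 add_block_mx !addr0 !add0r.
by rewrite addrN -scalar_mx_block.
Qed.

(** Order by order: the obstruction rho to extending w to the next order satisfies the
    linearized relations, because N satisfies the relations modulo every power of X,
    so it is a coboundary dhom phi, and w - X^(J+1) phi is the next approximation. *)
Lemma lift_sub J : exists w : forall j, 'M[{poly k}]_(e j, e' j),
  (forall j, row_coef 0 (w j) = 0) /\
  forall b, exists R, lrow w (src b) *m N b *m lcol w (tgt b) = 'X^(J.+1) *: R.
Proof.
have e10 (n m : nat) : row_coef 0 (row_mx 1%:M 0 : 'M[{poly k}]_(n, n + m)) = row_mx 1%:M 0.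
  by rewrite /row_coef map_row_mx -!/(row_coef _ _) row_coef0_1 row_coef_0.
have lrow0 w j : row_coef 0 (w j) = 0 -> row_coef 0 (lrow w j) = row_mx 1%:M 0.
  by move=> w0; rewrite /lrow /row_coef map_row_mx -!/(row_coef _ _) row_coef0_1 w0.
have lcol0 w j : row_coef 0 (w j) = 0 -> row_coef 0 (lcol w j) = col_mx 0 1%:M.
  move=> w0; rewrite /lcol /row_coef map_col_mx -!/(row_coef _ _) row_coef0_1.
  by rewrite row_coef_opp w0 oppr0.
have c10 n m : row_coef 0 (col_mx 1%:M 0 : 'M[{poly k}]_(n + m, n)) = col_mx 1%:M 0.
  by rewrite /row_coef map_col_mx -!/(row_coef _ _) row_coef0_1 row_coef_0.
have r01 n m : row_coef 0 (row_mx 0 1%:M : 'M[{poly k}]_(n, m + n)) = row_mx 0 1%:M.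
  by rewrite /row_coef map_row_mx -!/(row_coef _ _) row_coef0_1 row_coef_0.
elim: J => [|J [w [w0 wR]]].
  exists (fun=> 0); split=> [j|b]; first exact: row_coef_0.
  apply: row_coef0_dvdX; rewrite !row_coef0M N_at0 lrow0 ?row_coef_0 // lcol0 ?row_coef_0 //.
  by rewrite /ext_rep mul_row_block mul_row_col !(mul1mx, mulmx1, mul0mx, mulmx0, addr0, add0r).
have [R RE] : exists R : forall b : arrow Qh, 'M[{poly k}]_(e (src b), e' (tgt b)),
    forall b, lrow w (src b) *m N b *m lcol w (tgt b) = 'X^(J.+1) *: R b.
  exact: fin_all_exists wR.
pose rho : @mxfam k (arrow Qh) (fun b => e (src b)) (fun b => e' (tgt b)) :=
  fun b => row_coef 0 (R b).
have rho_closed r : drel T N1 N2 rho r = 0.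
  case: r => a u.
  pose Nu : 'M_(x None, x (Some (src a))) := N (vec_arr u).
  pose Na : 'M_(x (Some (src a)), x (Some (tgt a))) := N (oarr t a).
  pose Nv v : 'M_(x None, x (Some (tgt a))) := N (vec_arr v).
  pose Rv i (v : 'I_(t i)) : 'M[{poly k}]_(e None, e' (Some i)) := R (vec_arr v).
  pose Ra : 'M[{poly k}]_(e (Some (src a)), e' (Some (tgt a))) := R (oarr t a).
  (* Insert the decomposition lrow_lcol_id between the two factors of the relation and
     divide by the common power of X. *)
  have key : lrow w None *m Nu *m col_mx 1%:M 0 *m Ra
      + Rv _ u *m (row_mx 0 1%:M *m Na *m lcol w (Some (tgt a))) =
      (1 + 'X) *: \sum_v (T a u v)%:P *: Rv _ v.
    apply: (@scaleXn_inj _ _ _ J.+1).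
    have h1 : lrow w None *m (Nu *m Na) *m lcol w (Some (tgt a)) =
        'X^(J.+1) *: ((1 + 'X) *: \sum_v (T a u v)%:P *: Rv _ v).
      rewrite N_rel -scalemxAr -scalemxAl scalerA mulrC -scalerA; congr (_ *: _).
      rewrite mulmx_sumr mulmx_suml scaler_sumr; apply: eq_bigr => v _.
      by rewrite -scalemxAr -scalemxAl (RE (vec_arr v)) scalerA mulrC -scalerA.
    have mid : lrow w None *m (Nu *m Na) *m lcol w (Some (tgt a)) =
        lrow w None *m Nu *m (col_mx 1%:M 0 *m lrow w (Some (src a)) +
          lcol w (Some (src a)) *m row_mx 0 1%:M) *m Na *m lcol w (Some (tgt a)).
      by rewrite lrow_lcol_id mulmx1 !mulmxA.
    rewrite -h1 mid mulmxDr !mulmxDl scalerDr; congr (_ + _).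
      by rewrite scalemxAr -(RE (oarr t a)) !mulmxA.
    by rewrite scalemxAl -(RE (vec_arr u)) !mulmxA.
  have := congr1 (row_coef 0) key.
  rewrite row_coef_add !row_coef0M row_coef0_scale coefD coef1 coefX /= addr0 scale1r.
  rewrite row_coef_sum (N_at0 (vec_arr u)) (N_at0 (oarr t a)) lrow0 // lcol0 // c10 r01.
  rewrite /ext_rep !mul_row_block !mul_row_col !(mul1mx, mulmx1, mul0mx, mulmx0, addr0, add0r).
  move=> eq0; rewrite /drel /relmap /= addrA; apply/eqP; rewrite subr_eq0; apply/eqP.
  apply: (etrans eq0); apply: eq_bigr => v _.
  by rewrite row_coef0_scale coefC.
have [phi phiE] := exactN rho_closed.
pose w' j := w j - 'X^(J.+1) *: constmx (phi j).
have X0 : ('X^(J.+1) : {poly k})`_0 = 0 by rewrite coefXn.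
exists w'; split=> [j|b].
  by rewrite row_coef_add row_coef_opp w0 row_coef0_scale X0 scale0r subrr.
pose Ls : 'M[{poly k}]_(e (src b), e (src b) + e' (src b)) := row_mx 0 (constmx (phi (src b))).
pose ct : 'M[{poly k}]_(e (tgt b) + e' (tgt b), e' (tgt b)) := col_mx (constmx (phi (tgt b))) 0.
have LE : lrow w' (src b) = lrow w (src b) - 'X^(J.+1) *: Ls.
  by rewrite /lrow /Ls scale_row_mx opp_row_mx add_row_mx scaler0 subr0.
have CE : lcol w' (tgt b) = lcol w (tgt b) + 'X^(J.+1) *: ct.
  by rewrite /lcol /ct scale_col_mx add_col_mx scaler0 addr0 /w' opprB addrC.
(* The new off-diagonal block divided by X^(J+1); its constant term is
   rho - dhom phi = 0. *)
pose Z := R b - Ls *m N b *m lcol w (tgt b) + lrow w (src b) *m N b *m ct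
  - 'X^(J.+1) *: (Ls *m N b *m ct).
have expand : lrow w' (src b) *m N b *m lcol w' (tgt b) = 'X^(J.+1) *: Z.
  rewrite LE CE mulmxBl -scalemxAl mulmxBl -scalemxAl !mulmxDr -!scalemxAr RE.
  rewrite -scalerDr -scalerBr; congr (_ *: _).
  by rewrite /Z opprD addrA; congr (_ - _); rewrite addrAC.
have [Z' ZE] : exists Z', Z = 'X *: Z'.
  apply: row_coef0_dvdX; rewrite /Z !row_coef_add !row_coef_opp row_coef0_scale X0 scale0r oppr0 addr0.
  rewrite !row_coef0M N_at0 lrow0 // lcol0 //.
  rewrite /Ls /ct /row_coef map_row_mx map_col_mx -!/(row_coef _ _) !row_coef_0 !row_coef0_const.
  rewrite /ext_rep !mul_row_block !mul_row_col !(mul1mx, mulmx1, mul0mx, mulmx0, addr0, add0r).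
  by rewrite -[row_coef 0 (R b)]/(rho b) -phiE /dhom addrAC subrK subrr.
by exists Z'; rewrite expand ZE scalerA -exprSr.
Qed.

End Lattice.

(** * Semistability against a deformed submodule of larger slope *)

Section LatticeRank.
Variable k : fieldType.

(** Modulo X^J the graph of w is isomorphic to its first component. *)
Lemma lattice_rank n1 n2 J (w : 'M[{poly k}]_(n1, n2)) :
  exists U : 'M[k]_(n1 * J, (n1 + n2) * J), \rank U = (n1 * J)%N /\
    forall u, (u <= U)%MS <-> exists r, rowpoly u *m col_mx (- w) 1%:M = 'X^J *: r.
Proof.
pose G (p : 'rV[{poly k}]_n1) : 'rV[{poly k}]_(n1 + n2) :=
  row_mx p (map_mx (take_poly J) (p *m w)).
have GD a p q : G (a%:P *: p + q) = a%:P *: G p + G q.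
  rewrite /G scale_row_mx add_row_mx; congr row_mx; apply/rowP => i.
  by rewrite mulmxDl -scalemxAl !mxE take_polyD !mul_polyC take_polyZ.
have Gsize p : row_size_le J p -> row_size_le J (G p).
  move=> sp i; case: (split_ordP i) => i' ->; rewrite ?row_mxEl ?row_mxEr //.
  by rewrite mxE size_take_poly.
pose F (a : 'rV[k]_(n1 * J)) : 'rV[k]_((n1 + n2) * J) := rowpoly_inv J (G (rowpoly a)).
have rpF a : rowpoly (F a) = G (rowpoly a).
  by rewrite rowpoly_invK //; apply: Gsize; apply: row_size_rowpoly.
have linF : linear F.
  move=> a u v; rewrite -[RHS]rowpolyK rowpolyD !rpF -GD -rowpolyD -rpF.
  by rewrite rowpolyK.
pose Lm := GRing.isLinear.Build _ _ _ _ _ linF.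
pose L : {linear 'rV[k]_(n1 * J) -> 'rV[k]_((n1 + n2) * J)} := HB.pack F Lm.
pose U := lin1_mx L; have UE a : a *m U = F a by rewrite mul_rV_lin1.
exists U; split.
  apply/eqP; rewrite -/(row_free _) -kermx_eq0; apply/rowV0P => a /sub_kermxP.
  rewrite UE => Fa0; have : G (rowpoly a) = G (rowpoly (0 : 'rV_(n1 * J))).
    by rewrite -!rpF Fa0 -UE mul0mx.
  by move/eq_row_mx => [ra _]; rewrite -(rowpolyK a) ra rowpolyK.
move=> u; split=> [/submxP[a ->]|[r ur]].
  exists (- map_mx (drop_poly J) (rowpoly a *m w)).
  rewrite UE rpF /G mul_row_col mulmx1 mulmxN; apply/rowP => i; rewrite !mxE.
  set s := \sum_j _; rewrite mulrN -{1}(poly_take_drop J s) opprD addrAC addNr add0r.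
  by rewrite mulrC.
apply/submxP; exists (rowpoly_inv J (lsubmx (rowpoly u))); rewrite UE.
have sl : row_size_le J (lsubmx (rowpoly u)).
  by move=> i; rewrite mxE; apply: row_size_rowpoly.
rewrite -[LHS]rowpolyK -[RHS]rowpolyK rpF rowpoly_invK //; congr rowpoly_inv.
rewrite -[LHS]hsubmxK /G; congr row_mx; move: (rowpoly u) (row_size_rowpoly u) ur => q sq qr.
have e : rsubmx q = lsubmx q *m w + 'X^J *: r.
  by rewrite -qr -{3}(hsubmxK q) mul_row_col mulmx1 mulmxN addrA addrN add0r.
apply/rowP => i; rewrite [RHS]mxE -[LHS](@take_poly_id _ J); last by rewrite mxE; apply: sq.
by rewrite e mxE take_polyD [('X^J *: r) 0 i]mxE mulrC take_polyMXn_0 addr0.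
Qed.

Lemma lattice_linear n1 n2 J (c : 'M[{poly k}]_(n1, n2)) :
  poly_linear (fun p : 'rV[{poly k}]_n1 => exists r, p *m c = 'X^J *: r).
Proof.
split; first by exists 0; rewrite mul0mx scaler0.
move=> a p q [r pr] [s qs]; exists (a%:P *: r + s).
by rewrite mulmxDl -scalemxAl pr qs scalerDr !scalerA mulrC.
Qed.

End LatticeRank.

Lemma sum_shift_le (f : nat -> nat) B d J : (forall E, (f E <= B)%N) ->
  (\sum_(E < J) f (E + d)%N <= \sum_(E < J) f E + d * B)%N.
Proof.
move=> fB; elim: d => [|d IH]; first by under eq_bigr => E _ do rewrite addn0; rewrite mul0n addn0.
rewrite mulSn addnCA; apply: leq_trans (leq_add (fB (J + d)%N) IH); rewrite addnC.
have -> : (\sum_(E < J) f (E + d)%N + f (J + d)%N = \sum_(E < J.+1) f (E + d)%N)%N.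
  by rewrite big_ord_recr.
rewrite big_ord_recl /= add0n; apply: leq_trans (leq_addl _ _).
by apply: leq_sum => E _; rewrite /bump /= add1n addnS addSn.
Qed.

(** A curve of modules over k[X] that starts at the direct sum of N1 and N2 and whose
    leading coefficients form the semistable module N0, up to scalars. *)
Section LatticeSlope.
Variables (k : closedFieldType) (Q : quiver) (t : vertex Q -> nat) (T : rep k t).
Local Notation Qh := (ope t).
Variables (e e' : vertex Qh -> nat).
Local Notation x := (fun j => e j + e' j)%N.
Variables (N1 : rep k e) (N2 : rep k e') (N0 : rep k x).
Hypothesis exactN : forall xi, (forall r, drel T N1 N2 xi r = 0) ->
  exists phi, forall b, dhom N1 N2 phi b = xi b.
Variable N : forall b : arrow Qh, 'M[{poly k}]_(x (src b), x (tgt b)).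
Hypothesis N_at0 : forall b, row_coef 0 (N b) = ext_rep N1 N2 (fun=> 0) b.
Hypothesis N_rel : forall (a : arrow Q) (u : 'I_(t (src a))),
  (N (vec_arr u) : 'M_(x None, x (Some (src a)))) *m N (oarr t a) =
  (1 + 'X) *: \sum_v (T a u v)%:P *: (N (vec_arr v) : 'M_(x None, x (Some (tgt a)))).
Variables (d : arrow Qh -> nat) (delta : nat).
Hypothesis N_deg : forall b i j, (size (N b i j) <= (d b).+1)%N.
Hypothesis d_le : forall b, (d b <= delta)%N.
Hypothesis N_lead : forall b, exists2 a, a != 0 & row_coef (d b) (N b) = a *: N0 b.
Hypothesis ssN0 : ssrep N0.

(** Polynomial vectors p with p (lcol w) divisible by X^J form the deformed submodule;
    A j E is the space of leading coefficients in degree E of those at the vertex j. *)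
Lemma lattice_slope_bound : ~~ slope_gt e x.
Proof.
apply/negP => gt.
pose tot := (\sum_j x j)%N; pose c := (x None * mdim x)%N.
(* J exceeds the total defect, in which c bounds the slope defect of one space of
   leading coefficients and delta * tot the number of E where the space is not stable. *)
pose J := (c * (delta * tot)).+1.
have [w [w0 wR]] := lift_sub exactN N_at0 N_rel (c * (delta * tot)).
pose P j (p : 'rV[{poly k}]_(x j)) := exists r, p *m lcol w j = 'X^J *: r.
have Plin j : poly_linear (P j) by apply: lattice_linear.
have Pstab b p : P (src b) p -> P (tgt b) (p *m N b).
  have [R RE] := wR b; move=> [r pr].
  exists (p *m col_mx 1%:M 0 *m R + r *m (row_mx 0 1%:M *m N b *m lcol w (tgt b))).
  rewrite -{1}[p]mulmx1 -(lrow_lcol_id w (src b)) mulmxDr !mulmxDl scalerDr; congr (_ + _).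
    by rewrite scalemxAr -RE !mulmxA.
  by rewrite scalemxAl -pr !mulmxA.
have PX j p : P j p -> P j ('X *: p).
  by move=> [r pr]; exists ('X *: r); rewrite -scalemxAl pr !scalerA mulrC.
pose M := (J + delta).+1.
have /fin_all_exists[A0 A0P] (jE : vertex Qh * 'I_M) :
    exists A : 'M[k]_(x jE.1), forall v, (v <= A)%MS <-> lead_space (P jE.1) jE.2 v.
  exact: lead_space_mx.
pose A j E := A0 (j, inord E).
have AP j E : (E < M)%N -> forall v, (v <= A j E)%MS <-> lead_space (P j) E v.
  by move=> lt v; rewrite (A0P (j, inord E)) /= inordK.
clearbody A.
have Amono j E : (E.+1 < M)%N -> (A j E <= A j E.+1)%MS.
  move=> lt; apply/rV_subP => v /(AP _ _ (ltnW lt))[p [Pp sp <-]]; apply/AP => //.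
  exists ('X *: p); split; first exact: PX.
    by move=> i; rewrite mxE mulrC (leq_trans (size_polyMleq _ _)) // size_polyX addn2 ltnS sp.
  by apply/rowP => i; rewrite !mxE /= coefXM.
have Amono2 j E d' : (E + d' < M)%N -> (A j E <= A j (E + d')%N)%MS.
  elim: d' => [|d' IH] lt; first by rewrite addn0.
  rewrite addnS in lt *.
  by apply: submx_trans (IH (ltnW lt)) (Amono _ _ lt).
have Astab b E : (E + delta < M)%N -> (A (src b) E *m N0 b <= A (tgt b) (E + delta)%N)%MS.
  move=> lt; apply: (@submx_trans _ _ _ _ _ _ (A (tgt b) (E + d b)%N)); last first.
    have e1 : (E + delta = E + d b + (delta - d b))%N by have := d_le b; lia.
    by rewrite e1 in lt *; apply: Amono2.
  have ltE : (E + d b < M)%N by apply: leq_ltn_trans lt; rewrite leq_add2l.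
  apply/rV_subP => v /submxP[u ->]; rewrite mulmxA.
  have /(AP _ _ (leq_ltn_trans (leq_addr _ _) ltE))[p [Pp sp pE]] :
    (u *m A (src b) E <= A (src b) E)%MS by apply: submxMl.
  have [a a0 aE] := N_lead b.
  rewrite -(scalerK a0 (u *m _ *m _)); apply: scalemx_sub; apply/AP => //.
  exists (p *m N b); split; first exact: Pstab.
    move=> i; rewrite mxE; apply: leq_trans (size_sum _ _ _) _; apply/bigmax_leqP => l _.
    apply: leq_trans (size_polyMleq _ _) _; move: (leq_add (sp l) (N_deg l i)).
    by move: (size (p 0%R l) + size (N b l i))%N => a1; lia.
  rewrite -pE scalemxAr -aE; apply/rowP => i; rewrite !mxE /= coef_sum; apply: eq_bigr => l _.
  rewrite !mxE /= coefM (bigD1 (inord E)) //= inordK ?ltnS ?leq_addr // addKn.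
  rewrite big1 ?addr0 // => m /eqP ne; have [lm|gm|em] := ltngtP m E.
  - by rewrite [X in _ * X]nth_default ?mulr0 //; apply: leq_trans (N_deg _ _) _; lia.
  - by rewrite [X in X * _]nth_default ?mul0r //; apply: leq_trans (sp l) _.
  - by case: ne; apply: val_inj; rewrite /= inordK ?ltnS ?leq_addr.
have rankJ j : (\sum_(E < J) \rank (A j E) = e j * J)%N.
  have [U [rU UP]] := lattice_rank J (w j); rewrite -rU; symmetry.
  apply: lead_count (Plin j) UP _ => E lt; apply: AP.
  by apply: leq_trans lt _; rewrite /M leqW // leq_addr.
pose g E := (\sum_j \rank (A j E))%N.
have gle E : (g E <= tot)%N by apply: leq_sum => j _; apply: rank_leq_col.
(* If the ranks in degrees E and E + delta agree, the leading coefficients of degree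
   E form a submodule of N0; otherwise the difference of ranks absorbs the defect. *)
have step E : (E < J)%N ->
  (\rank (A None E) * mdim x + c * g E <=
    x None * (\sum_i \rank (A (Some i) E)) + c * g (E + delta))%N.
  move=> lt; have ltM : (E + delta < M)%N by rewrite ltnS leq_add2r ltnW.
  have le j : (\rank (A j E) <= \rank (A j (E + delta)))%N by apply: mxrankS; apply: Amono2.
  have gle2 : (g E <= g (E + delta))%N by apply: leq_sum => j _; apply: le.
  have [eqg|neg] := eqVneq (g E) (g (E + delta)).
    rewrite -eqg leq_add2r.
    suff st : stable N0 (fun j => A j E) by apply: (ssrep_stable ssN0 st).
    move=> b.
    have eqr : \rank (A (tgt b) E) = \rank (A (tgt b) (E + delta)).
      have le2 : (\sum_(j | j != tgt b) \rank (A j E) <=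
          \sum_(j | j != tgt b) \rank (A j (E + delta)))%N.
        by apply: leq_sum => j _; apply: le.
      move: eqg (le (tgt b)); rewrite /g (bigD1 (tgt b)) //= [X in _ = X -> _](bigD1 (tgt b)) //=.
      move: le2; set s1 := (\sum_(j | _) _)%N; set s2 := (\sum_(j | _) _)%N.
      by move: (\rank _) (\rank _) => r1 r2; lia.
    have /eqmxP eqA : (A (tgt b) E == A (tgt b) (E + delta)%N)%MS.
      by rewrite -(geq_leqif (mxrank_leqif_eq (Amono2 _ _ _ ltM))) eqr.
    by rewrite eqA; apply: Astab.
  have ltg : (g E < g (E + delta))%N by rewrite ltn_neqAle neg.
  have : (\rank (A None E) * mdim x <= c)%N by rewrite leq_mul2r rank_leq_col orbT.
  have : (c * (g E).+1 <= c * g (E + delta))%N by rewrite leq_mul2l ltg orbT.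
  by rewrite mulnS; lia.
have : (\sum_(E < J) (\rank (A None E) * mdim x + c * g E) <=
  \sum_(E < J) (x None * (\sum_i \rank (A (Some i) E)) + c * g (E + delta)))%N.
  by apply: leq_sum => E _; apply: step.
have q1 : (\sum_(E < J) \rank (A None E) * mdim x = e None * J * mdim x)%N.
  by rewrite -big_distrl rankJ.
have q2 (f : nat -> nat) : (\sum_(E < J) c * f E = c * \sum_(E < J) f E)%N.
  by rewrite big_distrr.
have q3 : (\sum_(E < J) x None * (\sum_i \rank (A (Some i) E)) = x None * (mdim e * J))%N.
  rewrite -big_distrr exchange_big /= /mdim big_distrl /=; congr (_ * _)%N.
  by apply: eq_bigr => i _; rewrite rankJ.
rewrite !big_split /= q1 q3 !q2 (q2 (fun E => g (E + delta)%N)).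
have := sum_shift_le (f := g) delta J gle.
move: gt; rewrite /slope_gt; set G := (\sum_(E < J) g E)%N; set G' := (\sum_(E < J) _)%N => gt h1 h2.
have h3 : (c * G' <= c * G + c * (delta * tot))%N by rewrite -mulnDr leq_mul2l h1 orbT.
have h4 : ((x None * mdim e).+1 * J <= e None * mdim x * J)%N by rewrite leq_mul2r gt orbT.
have h5 : (e None * J * mdim x = e None * mdim x * J)%N by rewrite mulnAC.
have h6 : (x None * (mdim e * J) = x None * mdim e * J)%N by rewrite mulnA.
have h7 : (c * (delta * tot) < J)%N by [].
by move: h2 h4; rewrite h5 h6 mulSn; lia.
Qed.

End LatticeSlope.

(** * The curve joining a direct sum to a semistable module *)

Section RowCoef.
Variable k : closedFieldType.

Lemma row_coef_constr m n p E (A : 'M[{poly k}]_(m, n)) (B : 'M[k]_(n, p)) :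
  row_coef E (A *m constmx B) = row_coef E A *m B.
Proof.
apply/matrixP => i j; rewrite !mxE /= coef_sum; apply: eq_bigr => l _.
by rewrite !mxE coefMC.
Qed.

Lemma row_coef_scaleC m n E a (A : 'M[{poly k}]_(m, n)) :
  row_coef E (a%:P *: A) = a *: row_coef E A.
Proof. by apply/matrixP => i j; rewrite !mxE /= coefCM. Qed.

Lemma row_coef_scaleX m n E (A : 'M[{poly k}]_(m, n)) :
  row_coef E.+1 ('X *: A) = row_coef E A.
Proof. by apply/matrixP => i j; rewrite !mxE /= coefXM. Qed.

Lemma row_coef_const m n E (A : 'M[k]_(m, n)) :
  row_coef E (constmx A) = if E == 0%N then A else 0.
Proof. by apply/matrixP => i j; rewrite !mxE /= coefC; case: eqP; rewrite ?mxE. Qed.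

Lemma row_coef_inj m n (A B : 'M[{poly k}]_(m, n)) :
  (forall E, row_coef E A = row_coef E B) -> A = B.
Proof.
move=> AB; apply/matrixP => i j; apply/polyP => E.
by have := congr1 (fun M : 'M_(_, _) => M i j) (AB E); rewrite !mxE.
Qed.

(** With Z = S K1, the adjugate H of X + Z satisfies H (X + Z) = det (X + Z), and
    S (K1 + X K0) = X + Z. As g0 + X g1 is sent by the pencil to X c1 with c1 constant,
    subtracting X c1 H S from det (X + Z) (g0 + X g1) gives a solution. The subtracted
    term has degree at most l and no constant term, so the lowest coefficient is a
    multiple of g0 and the highest one a multiple of g1. *)
Lemma pencil_solution N l (K1 K0 : 'M[k]_(N, l)) (S : 'M[k]_(l, N)) (g0 g1 : 'rV[k]_N) :
  S *m K0 = 1%:M -> S *m K1 \in unitmx -> g0 *m K1 = 0 -> g1 *m K0 = 0 ->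
  exists (f : 'rV[{poly k}]_N) c, [/\ c != 0,
    (f *m (constmx K1 + 'X *: constmx K0) = 0),
    row_size_le l.+2 f, row_coef 0 f = g0 & row_coef l.+1 f = c *: g1].
Proof.
move=> SK0 SK1 g0K1 g1K0; pose Z := S *m K1; pose dl := char_poly (- Z).
have c0 : dl`_0 != 0.
  rewrite char_poly_det mulf_neq0 ?signr_eq0 // -unitfE -unitmxE.
  by rewrite -scaleN1r unitmxZ ?unitrN1.
pose H := \adj (char_poly_mx (- Z)).
pose c1 := g1 *m K1 + g0 *m K0.
pose v := constmx c1 *m H *m constmx S.
pose u := constmx g0 + 'X *: constmx g1.
pose c := (dl`_0)^-1.
have cM m n p (A : 'M[k]_(m, n)) (B : 'M[k]_(n, p)) :
    constmx A *m constmx B = constmx (A *m B) by rewrite /constmx -map_mxM.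
have uK : u *m (constmx K1 + 'X *: constmx K0) = 'X *: constmx c1.
  rewrite /u mulmxDl !mulmxDr -!scalemxAl -!scalemxAr !cM g0K1 g1K0.
  have cz m n : constmx (0 : 'M[k]_(m, n)) = 0 by rewrite /constmx map_mx0.
  rewrite !cz !scaler0 add0r addr0 -scalerDr; congr (_ *: _).
  by rewrite /c1 /constmx map_mxD addrC.
have vK : v *m (constmx K1 + 'X *: constmx K0) = dl *: constmx c1.
  rewrite /v -mulmxA mulmxDr -scalemxAr !cM SK0 -/Z -mulmxA.
  have -> : constmx Z + 'X *: constmx (1%:M : 'M[k]_l) = char_poly_mx (- Z).
    rewrite /char_poly_mx /constmx map_mx1 map_mxN opprK addrC; congr (_ + _).
    by rewrite scalemx1.
  by rewrite mul_adj_mx mul_mx_scalar.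
have sv : row_size_le l v.
  move=> i; rewrite mxE; apply: leq_trans (size_sum _ _ _) _; apply/bigmax_leqP => j _.
  rewrite [X in _ * X]mxE mulrC mul_polyC; apply: leq_trans (size_scale_leq _ _) _.
  rewrite mxE; apply: leq_trans (size_sum _ _ _) _; apply/bigmax_leqP => j' _.
  rewrite [X in X * _]mxE mul_polyC; apply: leq_trans (size_scale_leq _ _) _.
  exact: size_adj_char_poly.
have su : row_size_le 2 u.
  move=> i; rewrite !mxE; apply: leq_trans (size_polyD _ _) _; rewrite geq_max.
  rewrite (leq_trans (size_polyC_leq1 _)) //=.
  apply: leq_trans (size_polyMleq _ _) _; rewrite size_polyX /=.
  by rewrite ltnS size_polyC_leq1.
exists (c%:P *: (dl *: u - 'X *: v)), c; split.
- by rewrite invr_eq0.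
- rewrite -scalemxAl mulmxBl -!scalemxAl uK vK !scalerA mulrC subrr scaler0.
  by [].
- move=> i; rewrite !mxE mul_polyC; apply: leq_trans (size_scale_leq _ _) _.
  apply: leq_trans (size_polyD _ _) _; rewrite geq_max size_polyN; apply/andP; split.
    apply: leq_trans (size_polyMleq _ _) _; rewrite size_char_poly.
    by have := su i; rewrite !mxE; move: (size _) => a1; lia.
  apply: leq_trans (size_polyMleq _ _) _; rewrite size_polyX.
  by have := sv i; rewrite !mxE; move: (size _) => a1; lia.
- rewrite row_coef_scaleC row_coef_add row_coef_opp !row_coef0_scale coefX scale0r subr0.
  rewrite scalerA mulVf // scale1r row_coef_add row_coef0_scale coefX scale0r addr0.
  exact: row_coef0_const.
rewrite row_coef_scaleC row_coef_add row_coef_opp row_coef_scaleX; congr (_ *: _).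
have -> : row_coef l v = 0.
  by apply/rowP => i; rewrite [LHS]mxE [RHS]mxE /= nth_default.
rewrite subr0; apply/rowP => i; rewrite [LHS]mxE /= mxE.
have -> : u 0 i = (g0 0 i)%:P + 'X * (g1 0 i)%:P by rewrite !mxE.
rewrite mulrDr coefD coefMC mulrCA coefXM /= coefMC nth_default ?size_char_poly // mul0r add0r.
have /monicP := char_poly_monic (- Z); rewrite lead_coefE size_char_poly /= => ->.
by rewrite mul1r.
Qed.

End RowCoef.

Section Curve.
Variables (k : closedFieldType) (Q : quiver) (t : vertex Q -> nat) (T : rep k t).
Hypothesis hT : ext1_eq0 T T.
Local Notation Qh := (ope t).

(** The V-parts of the curve solve the pencil spanned by the relation matrices of the
    two Q-parts. *)
Lemma ssrep_ext_split_slope (e e' : vertex Qh -> nat) (N1 : rep k e) (N2 : rep k e')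
    (N0 : rep k (fun j => e j + e' j)%N) :
  sat_rel T N1 -> fsurj N1 -> sat_rel T N2 -> fsurj N2 ->
  (forall f, is_hom N1 N2 f -> forall j, f j = 0) -> chi e e' = 0 ->
  sat_rel T N0 -> ssrep N0 -> (0 < e None + e' None)%N ->
  ~~ slope_gt e (fun j => e j + e' j)%N.
Proof.
move=> rel1 s1 rel2 s2 hom0 chi0 rel0 ss0 top0.
have exactN := (chi_le0 hT rel1 rel2 s2 hom0).2 chi0.
have s0 : fsurj N0 := ssrep_fsurj rel0 ss0 top0.
have [Nt [NtE relt st _]] := direct_sum T N1 N2.
move: {relt}(relt rel1 rel2) {st}(st s1 s2) => relt st.
set x := (fun j => e j + e' j)%N in N0 rel0 ss0 top0 s0 Nt NtE relt st *.
have [S [SK0 SK1]] := common_section (rank_relmx hT (x None) rel0 s0) (rank_relmx hT (x None) relt st).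
pose g (M : rep k x) := vec (tpart (M : @mxfam _ _ _ _)).
have gK (M : rep k x) : sat_rel T M -> g M *m relmx T (x None) (omod M) = 0.
  by move=> relM; apply: relmx0; apply: (sat_relE T M).1.
have [f [c [c0 fK sf f0 fl]]] := pencil_solution SK0 SK1 (gK _ relt) (gK _ rel0).
set l := (X in row_coef X.+1 f) in fl; rewrite -/l in sf.
pose N (b : arrow Qh) : 'M[{poly k}]_(x (src b), x (tgt b)) :=
  match b as b return 'M[{poly k}]_(x (@src Qh b), x (@tgt Qh b)) with
  | inl a => constmx (omod Nt a) + 'X *: constmx (omod N0 a)
  | inr q => \matrix_(i, j) f 0 (enum_rank (Tagged
      (fun q : {i : vertex Q & 'I_(t i)} => ('I_(x None) * 'I_(x (Some (tag q))))%type) (i, j)))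
  end.
pose fam E := unvec (row_coef E f) :
  @mxfam k {i : vertex Q & 'I_(t i)} (fun=> x None) (fun q => x (Some (tag q))).
have Nq E q : row_coef E (N (inr q)) = fam E q by apply/matrixP => i j; rewrite !mxE.
pose d (b : arrow Qh) := match b with inl _ => 1%N | inr _ => l.+1 end.
refine (@lattice_slope_bound k Q t T e e' N1 N2 N0 exactN N _ _ d l.+1 _ _ _ ss0).
- move=> [a|q]; rewrite -NtE.
    by rewrite row_coef_add row_coef0_const row_coef0_scale coefX scale0r addr0.
  by rewrite Nq /fam f0 /g vecK.
- move=> a u.
  have Nv E i (v : 'I_(t i)) : row_coef E (N (vec_arr v) : 'M_(x None, x (Some i))) =
    tfam_at (x := fun i => x (Some i)) (fam E) v := Nq E (Tagged (fun i => 'I_(t i)) v).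
  have rel_coef E : row_coef E f *m relmx T (x None) (omod Nt) +
      (if E is E'.+1 then row_coef E' f *m relmx T (x None) (omod N0) else 0) = 0.
    have := congr1 (row_coef E) fK; rewrite mulmxDr -scalemxAr row_coef_add row_coef_0.
    rewrite row_coef_constr; case: E => [|E]; last by rewrite row_coef_scaleX row_coef_constr.
    by rewrite row_coef0_scale coefX scale0r.
  have relfam E (M : rep k x) :
      vec (relmap (x := fun i => x (Some i)) T (omod M) (fam E)) =
      row_coef E f *m relmx T (x None) (omod M).
    by rewrite fammxE; [rewrite unvecK|apply: relmap_linear].
  have rl E : relmap (x := fun i => x (Some i)) T (omod Nt) (fam E) (Tagged _ u) +
      (if E is E'.+1 then relmap (x := fun i => x (Some i)) T (omod N0) (fam E') (Tagged _ u)
       else 0) = 0.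
    have := rel_coef E; rewrite -relfam; case: E => [|E].
      by rewrite addr0 => /vec0P/(_ (Tagged _ u)) ->; rewrite addr0.
    by rewrite -relfam -vecD => /vec0P/(_ (Tagged _ u)).
  apply: row_coef_inj => E.
  rewrite scalerDl scale1r row_coef_add row_coef_sum.
  rewrite [N (oarr t a)]/(constmx (omod Nt a) + 'X *: constmx (omod N0 a)) mulmxDr.
  rewrite -scalemxAr row_coef_add row_coef_constr Nv.
  under [X in _ = X + _]eq_bigr => v _ do rewrite row_coef_scaleC Nv.
  apply/eqP; rewrite -subr_eq0 -[X in _ == X](rl E) /relmap /=; apply/eqP.
  rewrite opprD addrACA; congr (_ + _).
  case: E => [|E]; first by rewrite !row_coef0_scale coefX !scale0r subrr.
  rewrite !row_coef_scaleX row_coef_constr Nv row_coef_sum; congr (_ - _).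
  by apply: eq_bigr => v _; rewrite row_coef_scaleC Nv.
- move=> [a|q] i j /=.
    rewrite !mxE; apply: leq_trans (size_polyD _ _) _; rewrite geq_max.
    rewrite (leq_trans (size_polyC_leq1 _)) //=.
    apply: leq_trans (size_polyMleq _ _) _; rewrite size_polyX /=.
    by rewrite ltnS size_polyC_leq1.
  by rewrite mxE; apply: sf.
- by move=> [a|q].
- move=> [a|q].
    exists 1; first exact: oner_neq0.
    rewrite row_coef_add row_coef_scaleX row_coef0_const row_coef_const /= add0r scale1r.
    by [].
  exists c => //; rewrite [d _]/= Nq /fam fl unvecZ /g vecK.
  by [].
Qed.

End Curve.

(** * Translation to modules with structure map *)

Section Translation.
Variables (k : closedFieldType) (Q : quiver) (t : dimvec Q) (T : rep k t).
Local Notation Qh := (ope t).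

Definition odim (s : nat) (d : vertex Q -> nat) : vertex Qh -> nat :=
  fun j => if j is Some i then d i else s.

Lemma sum_mxtens (V : nmodType) m n (F : 'I_(m * n) -> V) :
  \sum_l F l = \sum_u \sum_c F (mxtens_index (u, c)).
Proof.
rewrite pair_bigA (reindex (@mxtens_index m n)) //=; last first.
  by exists (@mxtens_unindex m n) => l _; [apply: mxtens_indexK|apply: mxtens_unindexK].
by apply: eq_bigr => -[u c].
Qed.

Section Maps.
Variables (s : nat) (d : vertex Q -> nat).

(** The u-th slice of the map T_i (x) k^s -> M_i. *)
Definition of_map (F : @mxfam k (vertex Q) (fun i => t i * s)%N d) i (u : 'I_(t i)) : 'M[k]_(s, d i) :=
  \matrix_(c, b) F i (mxtens_index (u, c)) b.

Definition to_map (G : forall i, 'I_(t i) -> 'M[k]_(s, d i)) :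
    @mxfam k (vertex Q) (fun i => t i * s)%N d :=
  fun i => \matrix_(l, b) G i (mxtens_unindex l).1 (mxtens_unindex l).2 b.

Lemma to_mapK G i u : of_map (to_map G) u = G i u.
Proof. by apply/matrixP => c b; rewrite !mxE mxtens_indexK. Qed.

Lemma is_hom_rep_power (M : rep k d) F : is_hom (rep_power T s) M F <->
  forall a (u : 'I_(t (src a))), of_map F u *m M a = \sum_v T a u v *: of_map F v.
Proof.
have lhs a u c b : (rep_power T s a *m F (tgt a)) (mxtens_index (u, c)) b =
    (\sum_v T a u v *: of_map F v) c b.
  rewrite mxE sum_mxtens summxE; apply: eq_bigr => v _.
  rewrite (bigD1 c) //= tensmxE !mxE eqxx mulr1 big1 ?addr0 // => c' ne.
  by rewrite tensmxE !mxE eq_sym (negPf ne) mulr0 mul0r.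
have rhs a u c b : (F (src a) *m M a) (mxtens_index (u, c)) b = (of_map F u *m M a) c b.
  by rewrite !mxE; apply: eq_bigr => l _; rewrite !mxE.
split=> [hF a u|hF a].
  by apply/matrixP => c b; rewrite -lhs -rhs hF.
apply/matrixP => l b; case: (mxtens_indexP l) => u c.
by rewrite lhs rhs hF.
Qed.

Lemma sub_map_mx n (W : 'M[k]_s) (F : @mxfam k (vertex Q) (fun i => t i * s)%N d) i (U : 'M[k]_(n, d i)) :
  ((1%:M *t W) *m F i <= U)%MS <-> forall u, (W *m of_map F u <= U)%MS.
Proof.
have rowE u c : row (mxtens_index (u, c)) ((1%:M *t W) *m F i) = row c (W *m of_map F u).
  apply/rowP => b; rewrite !mxE sum_mxtens (bigD1 u) //= [X in _ + X]big1 ?addr0.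
    by apply: eq_bigr => c' _; rewrite tensmxE !mxE eqxx mul1r.
  by move=> v ne; apply: big1 => c' _; rewrite tensmxE !mxE eq_sym (negPf ne) !mul0r.
split=> [/row_subP sub u|sub].
  by apply/row_subP => c; rewrite -rowE.
apply/row_subP => l; case: (mxtens_indexP l) => u c; rewrite rowE.
by apply: submx_trans (sub u); apply: row_sub.
Qed.

Lemma row_full_of_map (F : @mxfam k (vertex Q) (fun i => t i * s)%N d) i :
  row_full (F i) <-> exists R : 'I_(t i) -> 'M[k]_(d i, s), \sum_u R u *m of_map F u = 1%:M.
Proof.
split=> [/row_fullP[R RF]|[R RF]].
  exists (fun u => \matrix_(b, c) R b (mxtens_index (u, c))); rewrite -RF.
  apply/matrixP => b b'; rewrite summxE mxE sum_mxtens; apply: eq_bigr => u _.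
  by rewrite mxE; apply: eq_bigr => c _; rewrite !mxE.
apply/row_fullP; exists (\matrix_(b, l) R (mxtens_unindex l).1 b (mxtens_unindex l).2).
rewrite -RF; apply/matrixP => b b'; rewrite summxE mxE sum_mxtens; apply: eq_bigr => u _.
by rewrite [RHS]mxE; apply: eq_bigr => c _; rewrite !mxE mxtens_indexK.
Qed.

Definition orep (M : rep k d) (F : @mxfam k (vertex Q) (fun i => t i * s)%N d) :
  rep k (odim s d) := fun b =>
  match b as b return 'M[k]_(odim s d (@src Qh b), odim s d (@tgt Qh b)) with
  | inl a => M a | inr q => of_map F (tagged q) end.

Lemma orep_sat_rel M F : is_hom (rep_power T s) M F -> sat_rel T (orep M F).
Proof. by move/is_hom_rep_power. Qed.

Lemma sat_rel_hom (N : rep k (odim s d)) : sat_rel T N ->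
  is_hom (rep_power T s) (omod N : rep k d) (to_map (fun i (u : 'I_(t i)) => tvec N u)).
Proof.
move=> relN; apply/is_hom_rep_power => a u; rewrite to_mapK.
by under [RHS]eq_bigr => v _ do rewrite to_mapK; apply: relN.
Qed.

(** The zero submodule and the whole module, excluded on one side, satisfy the cleared
    inequality trivially. *)
Lemma semistable_odim (hs : (0 < s)%N) :
  (exists Mt : oprep T s d, semistable_rep Mt) <-> ssdim T (odim s d).
Proof.
have msum : mdim (odim s d) = (\sum_i d i)%N by [].
split=> [[[M F hF] ssM]|[N relN ssN]].
  exists (orep M F); first exact: orep_sat_rel.
  move=> e A f hf ff.
  have rk j : \rank <<f j>>%MS = e j by rewrite mxrank_gen (eqP (ff j)).
  have sub : is_subrep (OPRep hF) <<f None>>%MS (fun i => <<f (Some i)>>%MS : 'M_(d i)).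
    split=> [a|i].
      by rewrite genmxE (eqmxMr _ (genmxE _)) -(hf (inl a)) submxMl.
    apply/sub_map_mx => u; rewrite genmxE (eqmxMr _ (genmxE _)).
    by have := hf (vec_arr u) => /= <-; apply: submxMl.
  have slE : slope (\rank <<f None>>%MS) (fun i => \rank (<<f (Some i)>>%MS : 'M_(d i))) =
      slope (e None) (fun i => e (Some i)).
    by rewrite /slope rk (eq_bigr _ (fun i _ => rk (Some i))).
  have := ssM _ _ sub; rewrite slE => h.
  have [e0|e0] := posnP (e None + mdim e).
    by move/eqP: e0; rewrite addn_eq0 => /andP[/eqP -> _]; rewrite mul0n.
  case: (classic (forall j, e j = odim s d j)) => [eqe|nee].
    by rewrite eqe /mdim; under [X in (_ <= _ * X)%N]eq_bigr => i _ do rewrite eqe.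
  have s0 : (0 < s + \sum_i d i)%N by rewrite addn_gt0 hs.
  move: h; rewrite /slope (slope_le_nat s0 e0) => h; apply: h.
    move=> [W0 U0]; move: e0; rewrite lt0n addn_eq0 negb_and -rk W0 mxrank0 /=.
    rewrite /mdim big1 // => i _; rewrite -rk [X in \rank X]U0.
    exact: mxrank0.
  move=> [W1 U1]; apply: nee => -[i|]; rewrite -rk; apply/eqP; last exact: W1.
  exact: (U1 i).
pose F := to_map (fun i (u : 'I_(t i)) => tvec N u).
exists (OPRep (sat_rel_hom relN)) => W U [subM subF] _ _.
pose UU : mxfam k (odim s d) (odim s d) := fun j =>
  match j as j return 'M[k]_(odim s d j) with None => W | Some i => U i end.
have st : stable N UU.
  move=> [a|[i u]]; first exact: subM.
  by have /sub_map_mx/(_ u) := subF i; rewrite to_mapK.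
have := ssrep_stable ssN st; rewrite /= msum => le.
rewrite /slope; have [z|nz] := posnP (\rank W + \sum_i \rank (U i)).
  by rewrite z invr0 mulr0 divr_ge0 ?ler0n.
by rewrite slope_le_nat // addn_gt0 hs.
Qed.

End Maps.
End Translation.

Section GeneralRank.
Variable k : closedFieldType.

Lemma polyfun_entries (X : finType) (m n : X -> nat) (f : mxfam k m n -> k) :
  polyfun (@fam_coord k X m n) f -> exists p : {mpoly k[#|entry_index m n|]},
    forall F, f F = p.@[entries F].
Proof.
apply: polyfun_mpoly => c [x [i [j ->]]].
exists (enum_rank (Tagged (fun x => ('I_(m x) * 'I_(n x))%type) (i, j))) => F.
by rewrite /entries enum_rankK.
Qed.

Lemma entries_polyfun (X : finType) (m n : X -> nat) (p : {mpoly k[#|entry_index m n|]}) :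
  polyfun (@fam_coord k X m n) (fun F => p.@[entries F]).
Proof.
apply: (@polyfun_ext _ _ _ (fun F => \sum_(l <- msupp p) p@_l * \prod_i entries F i ^+ l i)).
  by move=> F; rewrite mevalE.
apply: polyfun_sum => l _; apply: polyfun_mul; first exact: polyfun_const.
apply: polyfun_prod => i _; elim: (l i) => [|r IH].
  by apply: polyfun_ext (polyfun_const _ 1) => F; rewrite expr0.
apply: (@polyfun_ext _ _ _ (fun F => entries F i * entries F i ^+ r)).
  by move=> F; rewrite exprS.
apply: polyfun_mul IH; apply: polyfun_coord; pose e := enum_val i.
by exists (tag e), (tagged e).1, (tagged e).2.
Qed.

(** A principal open set that meets Y is dense in Y as soon as Y contains the segments
    between its points. *)
Lemma dense_open_of_polyfun (X : finType) (m n : X -> nat) (Y P : mxfam k m n -> Prop) f F0 :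
  (forall F G a, Y F -> Y G -> Y (segment F G a)) ->
  polyfun (@fam_coord k X m n) f -> Y F0 -> f F0 != 0 -> (forall F, f F != 0 -> P F) ->
  exists2 O, dense_open_in Y O & forall F, O F -> P F.
Proof.
move=> Yseg pf YF0 fF0 fP; have [p pE] := polyfun_entries pf.
exists (fun F => f F != 0) => //; split.
  exists (fun q => q = p) => F; rewrite pE; split=> [nz|[q -> //]].
  by exists p.
move=> O' [S' OS'] [G YG /OS'[q Sq qG]].
have [a [nz1 nz2]] := polyfun_common_nonzero pf (entries_polyfun q) fF0 qG.
exists (segment F0 G a); split=> //; first exact: Yseg.
by apply/OS'; exists q.
Qed.

Lemma polyfun_det_family (X : finType) (m n : X -> nat) (R : forall x, 'M[k]_(n x, m x)) :
  polyfun (@fam_coord k X m n) (fun F => \prod_x \det (R x *m F x)).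
Proof.
apply: polyfun_prod => x _; apply: polyfun_det; apply: polymx_mul; first exact: polymx_const.
by move=> i j; apply: polyfun_coord; exists x, i, j.
Qed.

Variables (Q : quiver) (t : dimvec Q) (T : rep k t).

(** One surjection T^s -> M suffices: the existence of a surjection is then open and
    dense in M by generic_normal_form, and for each such M the surjective
    homomorphisms are the non-zeros of a product of determinants in a linear space. *)
Lemma general_rank_full (hT : ext1_eq0 T T) s (d : dimvec Q) :
  general_rank T s d d <->
  exists N : rep k (odim (t := t) s d), sat_rel T N /\ fsurj N.
Proof.
split=> [[U [oU dU] UW]|[N1 [rel1 s1]]].
  have [M [_ UM _]] := dU _ (zariski_openT _ _ _) (ex_intro2 _ _ (fun=> 0) I I).
  have [W [oW dW] Wr] := UW M UM.
  have hom0 : is_hom (rep_power T s) M (fun=> 0) by move=> a; rewrite mulmx0 mul0mx.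
  have [f [hf Wf _]] := dW _ (zariski_openT _ _ _) (ex_intro2 _ _ _ hom0 I).
  exists (orep M f); split; first exact: orep_sat_rel.
  move=> i; have /row_full_of_map[R RE] : row_full (f i) by apply/eqP/(Wr f hf Wf).
  by exists R.
have [S [psi [ppsi psi1 psiP]]] := generic_normal_form hT rel1 s1.
(* Keep the V-part of N1 while the Q-part varies; away from N1 it is not a module
   any more, but its normal form is. *)
pose Y (M : rep k d) : rep k (odim (t := t) s d) :=
  orep M (to_map (fun i (u : 'I_(t i)) => tvec N1 u)).
pose C := @fam_coord k (arrow Q) (fun a => d (src a)) (fun a => d (tgt a)).
have pY : polyfun C (psi \o Y).
  apply: polyfun_comp ppsi => c [[a|q] [i [j ->]]].
    by apply: polyfun_coord; exists a, i, j.
  exact: polyfun_const.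
have Y1 : Y (omod N1) = N1.
  apply: functional_extensionality_dep => -[a|[i u]] //=.
  exact: to_mapK.
have nz1 : (psi \o Y) (omod N1) != 0 by rewrite /= Y1.
have psiY (M : rep k d) : (psi \o Y) M != 0 -> exists N : rep k (odim (t := t) s d),
    [/\ omod N = M, sat_rel T N & fsurj N].
  move=> nz; have [N [z [relN sN NE]]] := psiP (Y M) nz; exists N; split=> //.
  apply: functional_extensionality_dep => a.
  by have := congr1 (fun Z : rep k _ => omod Z a) NE; rewrite [omod (perturb _ _) a]/=.
have [U dU UP] := dense_open_of_polyfun (fun _ _ _ _ _ => I) pY (I : (fun _ => True) _) nz1 psiY.
exists U => // M /UP[N [<- relN sN]].
pose F0 := to_map (fun i (u : 'I_(t i)) => tvec N u).
have hF0 := sat_rel_hom relN.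
have full0 i : row_full (F0 i).
  apply/row_full_of_map; have [R RE] := sN i; exists R; rewrite -RE.
  by apply: eq_bigr => u _; rewrite to_mapK.
have /fin_all_exists[R RF] i : exists R : 'M[k]_(d i, t i * s), R *m F0 i = 1%:M.
  by have /row_fullP := full0 i.
have seg F G a : is_hom (rep_power T s) (omod N : rep k d) F ->
    is_hom (rep_power T s) (omod N : rep k d) G ->
    is_hom (rep_power T s) (omod N : rep k d) (segment F G a).
  move=> hF hG b; rewrite /segment mulmxDr mulmxDl -scalemxAr -scalemxAl.
  by rewrite mulmxBr mulmxBl hF hG.
have nz0 : \prod_i \det (R i *m F0 i) != 0.
  by rewrite big1 ?oner_neq0 // => i _; rewrite RF det1.
have detP (F : mxfam k (fun i => t i * s)%N d) :
    \prod_i \det (R i *m F i) != 0 -> forall i, \rank (F i) = d i.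
  move=> /prodf_neq0 nz i; have := nz i isT; rewrite -unitfE -unitmxE => u.
  apply/eqP; apply/row_fullP; exists (invmx (R i *m F i) *m R i).
  by rewrite -mulmxA mulVmx.
have [W dW WP] := dense_open_of_polyfun seg (polyfun_det_family R) hF0 nz0 detP.
by exists W => // f _ /WP.
Qed.

End GeneralRank.

(** * Harder-Narasimhan types and the theorem *)

Section HNTypes.
Variables (k : closedFieldType) (Q : quiver) (t : dimvec Q) (T : rep k t).
Local Notation Qh := (ope t).
Local Notation dv := (vertex Qh -> nat).
Local Notation zdim := (0%N, [ffun=> 0%N] : dimvec Q).

Definition dim_of (y : nat * dimvec Q) : dv := odim (t := t) y.1 y.2.
Definition of_dim (y : dv) : nat * dimvec Q := (y None, [ffun i => y (Some i)]).

Lemma of_dimK y : dim_of (of_dim y) = y.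
Proof. by apply: functional_extensionality => -[i|] //=; rewrite ffunE. Qed.

Lemma sum_optionE (I : finType) (F : option I -> nat) :
  (\sum_j F j = F None + \sum_i F (Some i))%N.
Proof.
rewrite (bigD1 None) //=; congr (_ + _)%N.
rewrite (reindex_omap Some id) => [|[i|]] //=.
by apply: eq_bigl => i; rewrite eqxx.
Qed.

Lemma sum_tagged (I : finType) (c : I -> nat) (F : I -> nat) :
  (\sum_(q : {i : I & 'I_(c i)}) F (tag q) = \sum_i c i * F i)%N.
Proof.
rewrite -(@sig_big_dep _ _ _ _ (fun i => 'I_(c i)) xpredT (fun _ => xpredT) (fun i _ => F i)) /=.
by apply: eq_bigr => i _; rewrite sum_nat_const card_ord.
Qed.

Lemma euler_op_chi y z : euler_op t y z = chi (dim_of y) (dim_of z).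
Proof.
have sumZ (I : finType) (F : I -> nat) : (\sum_i F i)%N%:Z = \sum_i (F i)%:Z.
  by apply: (big_morph Posz PoszD).
have eulerE (a b : vertex Q -> nat) : euler a b =
    (\sum_i a i * b i)%N%:Z - (\sum_a' a (src a') * b (tgt a'))%N%:Z.
  rewrite /euler !sumZ; congr (_ - _); apply: eq_bigr => i _; exact: PoszM.
rewrite /euler_op !eulerE /chi sum_optionE big_sumType /=.
have -> : (\sum_(q : {i : vertex Q & 'I_(t i)}) y.1 * z.2 (tag q) =
    y.1 * \sum_i t i * z.2 i)%N.
  by rewrite -big_distrr -sum_tagged.
have -> : (\sum_(r : rel_index t) y.1 * z.2 (tgt (tag r)) =
    y.1 * \sum_a t (src a) * z.2 (tgt a))%N.
  by rewrite -big_distrr -(sum_tagged (fun a => t (src a)) (fun a => z.2 (tgt a))).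
set A := (\sum_i t i * z.2 i)%N; set B := (\sum_a t (src a) * z.2 (tgt a))%N.
set C := (\sum_i y.2 i * z.2 i)%N; set D := (\sum_a y.2 (src a) * z.2 (tgt a))%N.
by rewrite !PoszD !PoszM; ring.
Qed.

Lemma semistable_dim_of y : (0 < y.1)%N -> semistable T y <-> ssdim T (dim_of y).
Proof. exact: semistable_odim. Qed.

Lemma slope_gt_dim_of (y z : nat * dimvec Q) : (0 < y.1)%N -> (0 < z.1)%N ->
  (slope z.1 z.2 < slope y.1 y.2) = slope_gt (dim_of y) (dim_of z).
Proof.
move=> y0 z0; rewrite /slope ltNge slope_le_nat ?addn_gt0 ?y0 ?z0 //.
by rewrite -ltnNge /slope_gt [(y.1 * _)%N]mulnC mulnC.
Qed.

(** Slopes decrease strictly and the last one is positive, so every entry has a nonzero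
    first component. *)
Lemma hn_type_hn_list (h : seq (nat * dimvec Q)) : HN_type T h -> (last zdim h).1 <> 0%N ->
  hn_list T (map dim_of h).
Proof.
elim: h => [//|y h IH] [ss srt] last0.
have sp (z : nat * dimvec Q) : (0 < z.1)%N -> 0 < slope z.1 z.2.
  by move=> z0; rewrite divr_gt0 ?ltr0n // addn_gt0 z0.
have ssy z : (0 < z.1)%N -> z \in y :: h -> ssdim T (dim_of z).
  by move=> z0 zh; apply/(semistable_dim_of z0)/ss.
case: h IH ss srt last0 ssy => [|z h] IH ss srt last0 ssy.
  have y0 : (0 < y.1)%N by rewrite lt0n; apply/eqP.
  by split=> //; apply: ssy; rewrite ?mem_head.
have /andP[zy srt'] : (slope z.1 z.2 < slope y.1 y.2) && sorted
   (fun x y : nat * dimvec Q => slope y.1 y.2 < slope x.1 x.2) (z :: h) := srt.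
have hl := IH (conj (fun w wh => ss w (mem_behead (s := y :: z :: h) wh)) srt') last0.
have z0 : (0 < z.1)%N by case: hl.
have y0 : (0 < y.1)%N.
  rewrite lt0n; apply/eqP => y0; move: (lt_trans (sp z z0) zy).
  by rewrite /slope y0 mul0r ltxx.
split=> //; first by apply: ssy; rewrite ?mem_head.
by rewrite /= -slope_gt_dim_of.
Qed.

Lemma hn_list_hn_type (h : seq dv) : hn_list T h -> HN_type T (map of_dim h).
Proof.
elim: h => [|y h IH]; first by split.
move=> [ssy y0 gt hl]; have [ss srt] := IH hl; split.
  move=> w; rewrite inE => /orP[/eqP ->|]; last exact: ss.
  by apply/semistable_dim_of => //; rewrite of_dimK.
case: h gt hl {IH ss} srt => [//|z h] gt [_ z0 _ _] /= srt.
apply/andP; split; last exact: srt.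
rewrite -[(z None)]/((of_dim z).1) -[(y None)]/((of_dim y).1).
by rewrite slope_gt_dim_of // !of_dimK.
Qed.

Lemma dimsum_sum (h : seq dv) j : dimsum h j = (\sum_(y <- h) y j)%N.
Proof. by elim: h => [|y h IH]; rewrite ?big_nil ?big_cons //= IH. Qed.

Lemma slope_gt_dimsum (y : dv) (h : seq dv) : h <> [::] ->
  (forall l, (l < size h)%N -> slope_gt y (nth (fun=> 0%N) h l)) -> slope_gt y (dimsum h).
Proof.
elim: h => [//|z h IH] _ gt; have gtz := gt 0%N isT.
have [h0|hn] := eqVneq (size h) 0%N.
  move: gtz; rewrite (size0nil h0) /slope_gt /= addn0 /mdim.
  by under [X in _ -> (_ < _ * X)%N]eq_bigr => i _ do rewrite addn0.
have gth : slope_gt y (dimsum h).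
  by apply: IH (fun l => gt l.+1) => h0; rewrite h0 in hn.
rewrite /slope_gt /mdim big_split /= mulnDl mulnDr -addSn.
exact: leq_add gtz (ltnW gth).
Qed.

End HNTypes.

Theorem theorem5p10 (k : closedFieldType) (Q : quiver) (t : dimvec Q)
    (T : rep k t) (hT : ext1_eq0 T T) (s : nat) (d : dimvec Q) (hs : (0 < s)%N) :
  semistable T (s, d) <->
  general_rank T s d d /\
  ~ (exists h : seq (nat * dimvec Q),
       [/\ (2 <= size h)%N,
           HN_type T h,
           (\sum_(x <- h) x.1)%N = s /\
             (forall i : vertex Q, (\sum_(x <- h) x.2 i)%N = d i),
           (last (0%N, [ffun=> 0%N]) h).1 <> 0%N &
           forall n l : nat, (n < l < size h)%N ->
             euler_op t (nth (0%N, [ffun=> 0%N]) h n)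
                        (nth (0%N, [ffun=> 0%N]) h l) = 0]).
Proof.
rewrite (semistable_dim_of (y := (s, d)) T hs) (general_rank_full hT) /dim_of /=.
split.
  move=> [N rel0 ss0]; split.
    by exists N; split; last exact: ssrep_fsurj rel0 ss0 hs.
  move=> [[|y h] [//= sz hn [sums sumd] last0 eu]].
  pose f := @dim_of Q t; pose e := f y.
  have hl0 : hn_list T (e :: map f h) := hn_type_hn_list hn last0.
  have [ssy y0] : ssdim T e /\ (0 < e None)%N by case: hl0.
  have hl := hn_list_gt hl0.
  have [N1 rel1 ss1] := ssy; have s1 := ssrep_fsurj rel1 ss1 y0.
  have [N2 [rel2 s2 hom0]] := hom0_direct_sum ss1 y0 hl.
  set e' := dimsum _ in N2 rel2 s2 hom0.
  have xE : odim s d = (fun j => e j + e' j)%N :> (vertex (ope t) -> nat).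
    apply: functional_extensionality => j; rewrite /e' dimsum_sum big_map.
    by case: j => [i|] /=; rewrite ?(esym sums) ?(esym (sumd _)) big_cons.
  have chi0 : chi e e' = 0.
    apply: chi_dimsum0 => l; rewrite size_map => lt.
    rewrite (nth_map (0%N, [ffun=> 0%N])) // -euler_op_chi.
    by have := eu 0%N l.+1; rewrite /= ltnS lt; apply.
  have : ssdim T (odim s d : vertex (ope t) -> nat) by exists N.
  rewrite xE => -[M relM ssM].
  have := ssrep_ext_split_slope hT rel1 s1 rel2 s2 hom0 chi0 relM ssM.
  rewrite addn_gt0 y0 => /(_ isT) /negP; apply.
  have : slope_gt e e'.
    apply: slope_gt_dimsum => [h0|l lt]; last by have [] := hl l lt.
    by move: sz; rewrite -(size_map f h) h0.
  by rewrite /slope_gt /mdim big_split /= mulnDl mulnDr ltn_add2l.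
move=> [[N1 [rel1 s1]] noHN].
have [h [hl hn hd eu]] := generic_HN_zero hT hs rel1 s1.
case: h hl hn hd eu => [//|y [|z h]] hl _ hd eu.
  have -> : odim s d = y :> (vertex (ope t) -> nat).
    by apply: functional_extensionality => j; apply: etrans (esym (hd j)) _; rewrite /= addn0.
  by case: hl.
case: noHN; exists (map (@of_dim Q t) [:: y, z & h]); split=> //.
- exact: hn_list_hn_type.
- split=> [|i]; rewrite big_map.
    by have := hd None; rewrite dimsum_sum => <-.
  have := hd (Some i); rewrite dimsum_sum => <-.
  by apply: eq_bigr => w _; rewrite ffunE.
- have top w h' : hn_list T (w :: h') -> (last w h' None != 0)%N.
    elim: h' w => [|v h' IH] w [_ w0 _ hl']; first by rewrite -lt0n.
    exact: IH hl'.
  rewrite [last _ _](_ : _ = of_dim (last y (z :: h))); last by rewrite -(last_map (@of_dim Q t)).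
  exact/eqP/(top y (z :: h)).
move=> n l /[dup] lt /andP[nl ls]; rewrite size_map in lt ls.
rewrite !(nth_map (fun=> 0%N)) //; last exact: ltn_trans nl ls.
by rewrite euler_op_chi !of_dimK eu.
Qed.
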